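(* Let $\mathscr{P}_{\bullet}$ be an irreducible subfactor planar algebra with finite index $\delta^2$, $\delta>0$. For any positive operators $x,y\in\mathscr{P}_{2,\pm}$ with $\|x\|_1=\|y\|_1=\delta$ and any $0\le\theta\le1$, $$H(x\ast y)\ \ge\ (1-\theta)H(x)+\theta H(y).$$ Moreover, equality holds for some $0<\theta<1$ if and only if $x,y$ are multiples of right shifts of biprojections such that $\mathcal{R}(\mathcal{F}^{-1}(x)^* )=\mathcal{R}(\mathcal{F}^{-1}(y))$.
   Context: For a subfactor planar algebra $\mathscr{P}_\bullet$ (in the sense of Jones) with finite index $\delta^2$ ($\delta>0$ is the value of a closed loop), $\mathscr{P}_{2,\pm}$ are the 2-box spaces, which are finite-dimensional $C^*$-algebras with unnormalized faithful Markov trace $\mathrm{Tr}$; irreducible means $\dim\mathscr{P}_{1,\pm}=1$. $\|x\|_p=\mathrm{Tr}(|x|^p)^{1/p}$. $H(x)=\mathrm{Tr}(-x\log x)$ for $x\ge0$ (with $0\log 0=0$). $\mathcal{R}(x)$ is the range projection of $x$. The convolution (coproduct) $x\ast y$ of $x,y\in\mathscr{P}_{2,\pm}$ is the element of $\mathscr{P}_{2,\pm}$ given by the planar tangle in which the box $x$ is placed to the left of the box $y$, the upper right string of $x$ is joined to the upper left string of $y$ by an arc, the lower right string of $x$ is joined to the lower left string of $y$ by an arc, and the remaining four strings are the four boundary strings of the result. $\mathcal{F}:\mathscr{P}_{2,\pm}\to\mathscr{P}_{2,\mp}$ is the Fourier transform, i.e. the one-click rotation of 2-boxes, oriented so that $x\ast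 y=\mathcal{F}(\mathcal{F}^{-1}(x)\mathcal{F}^{-1}(y))$. A biprojection is a projection $B\in\mathscr{P}_{2,\pm}$ which is also, up to a scalar, a projection with respect to convolution (equivalently, $\mathcal{F}(B)$ is a multiple of a projection). A projection $P\in\mathscr{P}_{2,\pm}$ is a right shift of a biprojection $B$ if $\mathrm{Tr}(P)=\mathrm{Tr}(B)$ and $B\ast P=\frac{\mathrm{Tr}(B)}{\delta}P$. *)

(* Defs.v *)
From HB Require Import structures.
From mathcomp Require Import all_boot all_order all_algebra.
From mathcomp Require Import complex.
From mathcomp Require Import all_classical all_reals all_analysis.

Set Implicit Arguments.
Unset Strict Implicit.
Unset Printing Implicit Defensive.

Import Order.TTheory GRing.Theory Num.Theory.

Local Open Scope ring_scope.
Local Open Scope classical_set_scope.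

(* A disc of shape (n, b) has 2n boundary points, numbered clockwise 0 .. 2n-1
   from the starred boundary interval (the one between points 2n-1 and 0).
   b is the shading of that interval, so that box spaces of shape (n, true)
   and (n, false) are P_{n,+} and P_{n,-}. *)
Definition disc_shape : Type := nat * bool.

Section Tangles.
Variables (I : finType) (ty : I -> disc_shape) (out : disc_shape).

(* Boundary points: Some i is the i-th input disc, None the output disc. *)
Definition bpoint : finType :=
  {o : option I & 'I_((oapp ty out o).1.*2)}.

(* The strings that meet a disc are recorded by matching their end points;
   closed strings are only counted. The nesting of the connected components
   of a tangle is not recorded: in a subfactor planar algebra P_{0,+} and
   P_{0,-} are the scalars and closed diagrams have spherically invariant
   values, so that a component which does not touch the output disc acts by a
   scalar that does not depend on the region where it floats. *)
Record tangle := Tangle {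
  strand : bpoint -> bpoint;
  loops : nat
}.

(* The tangle lives on the sphere, the exterior of the output disc being one
   more disc: clockwise around it is the reverse of its own numbering. *)
Definition turn (d : bpoint) : bpoint :=
  match d with
  | existT None j => Tagged _ (ord_pred j)
  | existT o j => Tagged _ (ordS j)
  end.

(* Shading of the region on the left-hand side of the string that leaves its
   disc at the point d. *)
Definition left_shade (d : bpoint) : bool :=
  (oapp ty out (tag d)).2 (+) odd (tagged d) (+) (tag d == None).

Definition linked (t : tangle) : rel bpoint :=
  [rel d d' | (strand t d == d') || (turn d == d')].

(* A tangle is a matching of the boundary points which is compatible with the
   shading and such that each component of the resulting map of strings
   (edges) and discs (vertices) has genus zero, by Euler's formula. *)
Definition planar (t : tangle) : bool :=
  [&& [forall d, strand t (strand t d) == d],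
      [forall d, left_shade (strand t d) == ~~ left_shade d]
    & (fcard (strand t) predT + fcard turn predT
         + fcard (turn \o strand t) predT
       == #|bpoint| + (n_comp (linked t) predT).*2)%N].

Definition mirror_point (d : bpoint) : bpoint :=
  match d with existT o j => Tagged _ (rev_ord j) end.

(* The reflected tangle. *)
Definition mirror (t : tangle) : tangle :=
  Tangle (fun d => mirror_point (strand t (mirror_point d))) (loops t).

End Tangles.

(* t' is t with its input discs renamed along f. *)
Definition relabel_point (I I' : finType) (f : I -> I') (ty : I' -> disc_shape)
    (out : disc_shape) (d : bpoint (ty \o f) out) : bpoint ty out :=
  match d with
  | existT None j => @Tagged _ None (fun o => 'I_((oapp ty out o).1.*2)) j
  | existT (Some i) j =>
      @Tagged _ (Some (f i)) (fun o => 'I_((oapp ty out o).1.*2)) j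
  end.

Definition relabels (I I' : finType) (f : I -> I') (ty : I' -> disc_shape)
    (out : disc_shape) (t : tangle (ty \o f) out) (t' : tangle ty out) : Prop :=
  (forall d, strand t' (relabel_point d) = relabel_point (strand t d)) /\
  loops t' = loops t.

(* Gluing s into the input disc None of t, whose other inputs are the Some i. *)
Section Glue.
Variables (I J : finType) (tyI : I -> disc_shape) (tyJ : J -> disc_shape).
Variables (mid out : disc_shape).

Definition glued_ty (k : I + J) : disc_shape :=
  match k with inl i => tyI i | inr j => tyJ j end.

Definition outer_ty : option I -> disc_shape := oapp tyI mid.

Definition old_point (d : bpoint glued_ty out) :
    bpoint outer_ty out + bpoint tyJ mid :=
  match d with
  | existT None j =>
      inl (@Tagged _ None (fun o => 'I_((oapp outer_ty out o).1.*2)) j)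
  | existT (Some (inl i)) j =>
      inl (@Tagged _ (Some (Some i))
             (fun o => 'I_((oapp outer_ty out o).1.*2)) j)
  | existT (Some (inr k)) j =>
      inr (@Tagged _ (Some k) (fun o => 'I_((oapp tyJ mid o).1.*2)) j)
  end.

(* Two old points are adjacent if a string joins them or they get identified. *)
Definition glue_step (t : tangle outer_ty out) (s : tangle tyJ mid) :
    rel (bpoint outer_ty out + bpoint tyJ mid) :=
  fun x y => match x, y with
  | inl d, inl d' => strand t d == d'
  | inr d, inr d' => strand s d == d'
  | inl (existT (Some None) j), inr (existT None j') => j == j' :> nat
  | inr (existT None j'), inl (existT (Some None) j) => j == j' :> nat
  | _, _ => false
  end.

(* Strings of the composite are the paths between surviving points; the
   paths that close up contain no surviving point and become loops. *)
Definition glues (t : tangle outer_ty out) (s : tangle tyJ mid)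
    (u : tangle glued_ty out) : Prop :=
  (forall d d', (strand u d == d') =
     (d != d') && connect (glue_step t s) (old_point d) (old_point d')) /\
  loops u = (loops t + loops s
    + n_comp (glue_step t s)
        [pred x | [forall d, ~~ connect (glue_step t s) x (old_point d)]])%N.

End Glue.

Definition no_input (T : void -> Type) (i : void) : T i :=
  match i return T i with end.

Section StandardTangles.
Variables (n : nat) (b : bool).
Let s : disc_shape := (n, b).
Let one_s (_ : unit) : disc_shape := s.
Let two_s (_ : bool) : disc_shape := s.

Let pt1 o (j : 'I_n.*2) : bpoint one_s s :=
  match o with
  | None => @Tagged _ None (fun o => 'I_((oapp one_s s o).1.*2)) j
  | Some i => @Tagged _ (Some i) (fun o => 'I_((oapp one_s s o).1.*2)) j
  end.

Definition identity_tangle : tangle (fun _ : unit => s) s :=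
  Tangle (fun d : bpoint one_s s => match d with
    | existT None j => pt1 (Some tt) j
    | existT (Some _) j => pt1 None j
    end) 0.

Let pt0 (j : 'I_n.*2) : bpoint (fun _ : void => s) s :=
  @Tagged _ None (fun o => 'I_((oapp (fun _ : void => s) s o).1.*2)) j.

Definition unit_tangle : tangle (fun _ : void => s) s :=
  Tangle (fun d : bpoint (fun _ : void => s) s => match d with
    | existT None j => pt0 (rev_ord j)
    | existT (Some i) _ => match i with end
    end) 0.

Let pt2 o (j : 'I_n.*2) : bpoint two_s s :=
  match o with
  | None => @Tagged _ None (fun o => 'I_((oapp two_s s o).1.*2)) j
  | Some i => @Tagged _ (Some i) (fun o => 'I_((oapp two_s s o).1.*2)) j
  end.

(* Boxes are drawn with points 0 .. n-1 on top, from left to right, and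
   n .. 2n-1 at the bottom, from right to left, the star being on the left.
   The input true is stacked on top of the input false. *)
Definition mult_tangle : tangle (fun _ : bool => s) s :=
  Tangle (fun d : bpoint two_s s => match d with
    | existT None j => pt2 (Some (j < n)%N) j
    | existT (Some true) j =>
        if (j < n)%N then pt2 None j else pt2 (Some false) (rev_ord j)
    | existT (Some false) j =>
        if (j < n)%N then pt2 (Some true) (rev_ord j) else pt2 None j
    end) 0.

Let z : disc_shape := (0%N, b).

Let ptr i (j : 'I_n.*2) : bpoint one_s z :=
  @Tagged _ (Some i) (fun o => 'I_((oapp one_s z o).1.*2)) j.

(* On the sphere there is no difference between left and right closure. *)
Definition trace_tangle : tangle (fun _ : unit => s) z :=
  Tangle (fun d : bpoint one_s z => match d with
    | existT (Some i) j => ptr i (rev_ord j)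
    | d => d
    end) 0.

Definition empty_tangle : tangle (fun _ : void => z) z :=
  Tangle (fun d => d) 0.

End StandardTangles.

Section TwoBoxTangles.
Variable b : bool.
Let s : disc_shape := (2, b).
Let s' : disc_shape := (2, ~~ b).
Let two_s (_ : bool) : disc_shape := s.
Let one_s (_ : unit) : disc_shape := s.

(* 0 = upper left, 1 = upper right, 2 = lower right, 3 = lower left. *)
Definition flip_lr (j : 'I_4) : 'I_4 :=
  match val j with
  | 0 => @Ordinal 4 1 isT
  | 1 => @Ordinal 4 0 isT
  | 2 => @Ordinal 4 3 isT
  | _ => @Ordinal 4 2 isT
  end%N.

Definition on_left (j : 'I_4) : bool := (j == 0 :> nat)%N || (j == 3 :> nat)%N.

Let pt2 o (j : 'I_4) : bpoint two_s s :=
  match o with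
  | None => @Tagged _ None (fun o => 'I_((oapp two_s s o).1.*2)) j
  | Some i => @Tagged _ (Some i) (fun o => 'I_((oapp two_s s o).1.*2)) j
  end.

(* The input true is on the left of the input false. *)
Definition conv_tangle : tangle (fun _ : bool => s) s :=
  Tangle (fun d : bpoint two_s s => match d with
    | existT None j => pt2 (Some (on_left j)) j
    | existT (Some true) j =>
        if on_left j then pt2 None j else pt2 (Some false) (flip_lr j)
    | existT (Some false) j =>
        if on_left j then pt2 (Some true) (flip_lr j) else pt2 None j
    end) 0.

Let pt1 o (j : 'I_4) : bpoint one_s s' :=
  match o with
  | None => @Tagged _ None (fun o => 'I_((oapp one_s s' o).1.*2)) j
  | Some i => @Tagged _ (Some i) (fun o => 'I_((oapp one_s s' o).1.*2)) j
  end.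

(* A counterclockwise quarter turn: it takes "on top of" in mult_tangle to
   "on the left of" in conv_tangle. *)
Definition fourier_tangle : tangle (fun _ : unit => s) s' :=
  Tangle (fun d : bpoint one_s s' => match d with
    | existT None j => pt1 (Some tt) (ordS j)
    | existT (Some _) j => pt1 None (ord_pred j)
    end) 0.

Definition inv_fourier_tangle : tangle (fun _ : unit => s) s' :=
  Tangle (fun d : bpoint one_s s' => match d with
    | existT None j => pt1 (Some tt) (ord_pred j)
    | existT (Some _) j => pt1 None (ordS j)
    end) 0.

End TwoBoxTangles.

(* Data of a planar *-algebra with finite-dimensional box spaces. The laws
   below only constrain the action of planar tangles. *)
Record planar_data (R : realType) := PlanarData {
  box :> disc_shape -> vectType R[i];
  act : forall (I : finType) (ty : I -> disc_shape) (out : disc_shape),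
    tangle ty out -> (forall i, box (ty i)) -> box out;
  star : forall s : disc_shape, box s -> box s;
  delta : R
}.

Arguments act {R} p {I ty out}.
Arguments star {R p s}.
Arguments delta {R} p.

Section Operations.
Variables (R : realType) (P : planar_data R).

Definition bone n b : P (n, b) := act P (unit_tangle n b) (no_input _).

Definition bmul n b (x y : P (n, b)) : P (n, b) :=
  act P (mult_tangle n b) (fun i => if i then x else y).

(* The scalar c such that v is c times the empty diagram. *)
Definition scalar_of b (v : P (0%N, b)) : R[i] :=
  xget 0 [set c | v = c *: act P (empty_tangle b) (no_input _)].

Definition Tr n b (x : P (n, b)) : R[i] :=
  scalar_of (act P (trace_tangle n b) (fun _ => x)).

End Operations.

Arguments bone {R} P n b.

Record subfactor_planar_algebra (R : realType) (P : planar_data R) : Prop := {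
  act_multilinear : forall (I : finType) (ty : I -> disc_shape) (out : disc_shape)
      (t : tangle ty out) (x : forall i, P (ty i)) (i : I) (a : R[i])
      (u v : P (ty i)),
    planar t ->
    act P t (dfwith x i (a *: u + v)) =
    a *: act P t (dfwith x i u) + act P t (dfwith x i v);
  act_relabel : forall (I I' : finType) (f : I -> I') (ty : I' -> disc_shape)
      (out : disc_shape) (t : tangle (ty \o f) out) (t' : tangle ty out)
      (x : forall i, P (ty i)),
    planar t -> planar t' -> bijective f -> relabels t t' ->
    act P t' x = act P t (fun i => x (f i));
  act_glue : forall (I J : finType) (tyI : I -> disc_shape) (tyJ : J -> disc_shape)
      (mid out : disc_shape) (t : tangle (outer_ty tyI mid) out)
      (s : tangle tyJ mid) (u : tangle (glued_ty tyI tyJ) out)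
      (x : forall k, P (glued_ty tyI tyJ k)),
    planar t -> planar s -> planar u -> glues t s u ->
    act P u x =
    act P t (fun o => match o return P (outer_ty tyI mid o) with
                      | Some i => x (inl i)
                      | None => act P s (fun j => x (inr j))
                      end);
  act_identity : forall n b (x : P (n, b)),
    act P (identity_tangle n b) (fun _ => x) = x;
  act_loop : forall (I : finType) (ty : I -> disc_shape) (out : disc_shape)
      (t : tangle ty out) (x : forall i, P (ty i)),
    planar t ->
    act P (Tangle (strand t) (loops t).+1) x = (delta P)%:C%C *: act P t x;
  delta_gt0 : 0 < delta P;
  star_semilinear : forall (s : disc_shape) (a : R[i]) (x y : P s),
    star (a *: x + y) = a^*%C *: star x + star y;
  star_involutive : forall (s : disc_shape) (x : P s), star (star x) = x;
  star_act : forall (I : finType) (ty : I -> disc_shape) (out : disc_shape)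
      (t : tangle ty out) (x : forall i, P (ty i)),
    planar t ->
    star (act P t x) = act P (mirror t) (fun i => star (x i));
  box0_dim : forall b, dim (P (0%N, b)) = 1%N;
  Tr_positive : forall n b (x : P (n, b)), x != 0 -> 0 < Tr (bmul (star x) x)
}.

Definition irreducible (R : realType) (P : planar_data R) : Prop :=
  forall b, dim (P (1%N, b)) = 1%N.

Section Calculus.
Variables (R : realType) (P : planar_data R) (n : nat) (b : bool).
Local Notation A := (P (n, b)).
Implicit Types x y p q : A.

Definition projection p : Prop := bmul p p = p /\ star p = p.

Definition positive x : Prop := exists a : A, x = bmul (star a) a.

(* f(x) for a self-adjoint x, through its spectral decomposition. *)
Definition fcalc (f : R -> R) x : A :=
  xget 0 [set y | exists (m : nat) (l : 'I_m -> R) (p : 'I_m -> A),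
    [/\ forall i, projection (p i),
        forall i j, i != j -> bmul (p i) (p j) = 0,
        \sum_i p i = bone P n b,
        x = \sum_i (l i)%:C%C *: p i
      & y = \sum_i (f (l i))%:C%C *: p i]].

Definition absolute x : A := fcalc Num.sqrt (bmul (star x) x).

Definition pnorm (r : R) x : R :=
  (complex.Re (Tr (fcalc (fun t => t `^ r) (absolute x)))) `^ r^-1.

Definition entropy x : R :=
  complex.Re (Tr (fcalc (fun t => - (t * ln t)) x)).

(* The least projection p such that p x = x. *)
Definition range_projection x : A :=
  xget 0 [set p | [/\ projection p, bmul p x = x
    & forall q, projection q -> bmul q x = x -> bmul q p = p]].

End Calculus.

Section TwoBoxes.
Variables (R : realType) (P : planar_data R) (b : bool).
Implicit Types x y : P (2%N, b).

Definition convolution x y : P (2%N, b) :=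
  act P (conv_tangle b) (fun i => if i then x else y).

Definition fourier x : P (2%N, ~~ b) := act P (fourier_tangle b) (fun _ => x).

Definition inv_fourier x : P (2%N, ~~ b) :=
  act P (inv_fourier_tangle b) (fun _ => x).

Definition biprojection (B : P (2%N, b)) : Prop :=
  projection B /\
  exists (c : R[i]) (q : P (2%N, ~~ b)), projection q /\ fourier B = c *: q.

Definition right_shift (B Q : P (2%N, b)) : Prop :=
  [/\ projection Q, Tr Q = Tr B
    & convolution B Q = (Tr B / (delta P)%:C%C) *: Q].

Definition multiple_of_right_shift x : Prop :=
  exists (c : R[i]) (B Q : P (2%N, b)),
    [/\ biprojection B, right_shift B Q & x = c *: Q].

End TwoBoxes.

(* Main.v *)
Require Import Defs.
From HB Require Import structures.
From mathcomp Require Import all_boot all_order all_algebra.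
From mathcomp Require Import falgebra complex.
From mathcomp Require Import all_classical all_reals all_analysis.
From mathcomp Require Import ring.
Import Order.TTheory GRing.Theory Num.Theory.
Local Open Scope ring_scope.

(* Write [t] for the trace of a projection divided by delta. For y of trace
   delta, the map x |-> x * y is unital and preserves the trace, and it is
   positive because Tr (z^* ((a^* a) * (c^* c)) z) is the squared norm of a
   vector of the 3-box space. Jensen's inequality for -t ln t gives
   H(x * y) >= H(x), and symmetrically H(x * y) >= H(y).
   If both are equalities, strict concavity forces p * y to be a projection
   for every spectral projection p of x, and x * r for every spectral
   projection r of y. Comparing the traces of supports, x and y are multiples
   of projections X and Y of the same trace, and X * Y = t Q with Q a
   projection of that trace. By Frobenius reciprocity Q * Y~ = t X and
   X~ * Q = t Y, where ~ is the half turn; hence X * X~ = t W and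
   X~ * X = Y * Y~ = t Z with biprojections W and Z such that W * X = t X and
   Z * Y = t Y. Conversely, if B * X = t X with Tr B = Tr X, then
   X * X~ = t B, the range projection of F^-1(X)^* is a multiple of
   F^-1(X~ * X), and the equality of ranges gives back X * Y = t Q.
   The identities between planar tangles come from tracing strings: a tangle
   is encoded by a matching of named points, composites are computed, and
   their planarity is checked by evaluation. *)

Set Implicit Arguments.
Unset Strict Implicit.
Unset Printing Implicit Defensive.

(** * Components of a finite relation *)

(** The gluing law asks for planarity of both tangles and of their composite, while a tangle is a
    function on a dependent type of points, which does not lend itself to evaluation. So diagrams
    are lists of pairs of numbers, a search on them returns a certificate, and only the check of
    certificates is proved correct. That composites of planar tangles are planar is never shown in
    general; it is tested for each composite that occurs. Once the planar identities are known, what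
    remains is a finite-dimensional algebra with a faithful trace, a convolution and a half turn. No
    operator norm is used: [s] is bounded by [t] when [t - s] is of the form a^* a, and for [p * y]
    such a bound comes from [(1 - p) * y]. The rigidity steps share one pattern: positive elements
    whose product has trace zero are orthogonal, so a trace inequality that is attained forces an
    operator identity. Irreducibility enters through 1 * x = (Tr x / delta) 1, which makes
    convolution with a density both unital and trace preserving. *)

Section Components.
Variables (K : eqType) (succ : K -> seq K).

(* The search below is not proved correct: are_components checks its output. *)
Fixpoint flood (fuel : nat) (seen todo : seq K) : seq K :=
  if fuel isn't n.+1 then seen else
  if todo isn't k :: todo' then seen else
  if k \in seen then flood n seen todo'
  else flood n (rcons seen k) (todo' ++ succ k).

Definition components (L : seq K) : seq (seq K) :=
  foldl (fun cs k => if has (fun S : seq K => k \in S) cs then cs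
           else rcons cs (flood (4 * size L).+1 [::] [:: k])) [::] L.

(** The list is its own certificate of connectedness: each entry is a successor of an earlier one.
    Closure under successors, added in [component], then gives maximality. *)
Fixpoint grown (seen S : seq K) : bool :=
  if S is k :: S' then has (fun l => k \in succ l) seen && grown (rcons seen k) S'
  else true.

Definition component (S : seq K) : bool :=
  if S is k :: S' then grown [:: k] S' && all (fun k => all (mem S) (succ k)) S
  else false.

Definition are_components (L : seq K) (cs : seq (seq K)) : bool :=
  [&& uniq (flatten cs), all (mem (flatten cs)) L, all (mem L) (flatten cs)
    & all component cs].

Definition component_index (cs : seq (seq K)) (k : K) : nat :=
  find (fun S : seq K => k \in S) cs.

Lemma component_index_uniq (cs : seq (seq K)) (k : K) (i : nat) :
  uniq (flatten cs) -> k \in nth [::] cs i -> component_index cs k = i.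
Proof.
elim: cs i => [|S cs IH] i; first by rewrite nth_nil.
rewrite /component_index /= cat_uniq => /and3P[_ /hasPn dis ucs].
case: i => [|i] /= ki; first by rewrite ki.
have [kS|kS] := ifP; last by rewrite -(IH i ucs ki).
case: (ltnP i (size cs)) ki => [ilt ki|ige]; last by rewrite nth_default.
have /dis/negP[] // : k \in flatten cs.
by apply/flattenP; exists (nth [::] cs i) => //; exact: mem_nth.
Qed.

Variables (T : finType) (c : T -> K) (L : seq K) (e : rel T) (cs : seq (seq K)).
Hypotheses (c_inj : injective c) (cL : forall k, (k \in L) = (k \in codom c)).
Hypotheses (eE : forall x y, e x y = (c y \in succ (c x))) (e_sym : connect_sym e).
Hypothesis good : are_components L cs.

Lemma cs_uniq : uniq (flatten cs). Proof. by case/and4P: good. Qed.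

Lemma mem_component_index x : c x \in nth [::] cs (component_index cs (c x)).
Proof.
have /flattenP[S Scs xS] : c x \in flatten cs.
  by case/and4P: good => _ /allP h _ _; apply: h; rewrite cL codom_f.
by apply: (@nth_find _ [::] (fun S : seq K => c x \in S)); apply/hasP; exists S.
Qed.

Lemma index_lt x : (component_index cs (c x) < size cs)%N.
Proof.
rewrite ltnNge; apply/negP => h; have := mem_component_index x.
by rewrite nth_default.
Qed.

Lemma nth_component i : (i < size cs)%N -> component (nth [::] cs i).
Proof. by case/and4P: good => _ _ _ /all_nthP; apply. Qed.

Lemma component_decode i k : k \in nth [::] cs i -> exists x, c x = k.
Proof.
move=> ki; have ilt : (i < size cs)%N.
  by rewrite ltnNge; apply/negP => h; move: ki; rewrite nth_default.
have : k \in flatten cs by apply/flattenP; exists (nth [::] cs i) => //; exact: mem_nth.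
case/and4P: good => _ _ /allP h _ /h /=.
by rewrite cL => /codomP[x ->]; exists x.
Qed.

Lemma step_index x y : e x y ->
  component_index cs (c y) = component_index cs (c x).
Proof.
rewrite eE => exy; apply: component_index_uniq; first exact: cs_uniq.
have := nth_component (index_lt x); have := mem_component_index x.
case: (nth _ _ _) => // k S xS /andP[_ /allP/(_ _ xS)/allP/(_ _ exy)].
exact.
Qed.

Lemma grown_connect x seen S :
  (forall y, c y \in seen -> connect e x y) ->
  (forall k, k \in seen -> exists y, c y = k) ->
  (forall k, k \in S -> exists y, c y = k) ->
  grown seen S -> forall y, c y \in S -> connect e x y.
Proof.
elim: S seen => // k S IH seen Hs ds dS /= /andP[/hasP[l lseen kl] gS] y.
have [z zl] := ds l lseen.
have [w wk] := dS k (mem_head _ _).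
have xw : connect e x w.
  apply: connect_trans (Hs z _) (connect1 _); first by rewrite zl.
  by rewrite eE wk zl.
rewrite inE => /orP[/eqP yk|yS]; first by rewrite (c_inj (etrans yk (esym wk))).
apply: (IH (rcons seen k)) => //.
- by move=> y'; rewrite mem_rcons inE -wk => /orP[/eqP/c_inj->|/Hs].
- by move=> k'; rewrite mem_rcons inE => /orP[/eqP->|/ds//]; exists w.
- by move=> k' k'S; apply: dS; rewrite inE k'S orbT.
Qed.

Lemma index_connect_head i : (i < size cs)%N ->
  exists x0, c x0 \in nth [::] cs i /\
    forall y, c y \in nth [::] cs i -> connect e x0 y.
Proof.
move=> ilt; have := nth_component ilt; have := @component_decode i.
case: (nth _ _ _) => // k S dS /= /andP[gS _].
have [x0 x0k] := dS k (mem_head _ _).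
exists x0; split=> [|y]; first by rewrite x0k mem_head.
rewrite inE => /orP[/eqP yk|yS]; first by rewrite (c_inj (etrans yk (esym x0k))).
apply: (@grown_connect x0 [:: k] S) => //.
- by move=> z; rewrite inE -x0k => /eqP/c_inj->.
- by move=> k'; rewrite inE => /eqP->; exists x0.
- by move=> k' k'S; apply: dS; rewrite inE k'S orbT.
Qed.

(** Closure under successors keeps the index constant along paths. Conversely both points are
    reachable from the head of their list, and symmetry allows going back through that head. *)
Lemma connect_index x y :
  connect e x y = (component_index cs (c x) == component_index cs (c y)).
Proof.
apply/idP/eqP => [/connectP[p]|ixy].
  elim: p x => [|z p IH] x /= => [_ ->//|/andP[exz pz] yE].
  by rewrite -(step_index exz) (IH z).
have [x0 [_ h]] := index_connect_head (index_lt x).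
have xx : connect e x0 x by apply/h/mem_component_index.
have yy : connect e x0 y by apply: h; rewrite ixy; apply: mem_component_index.
by apply: connect_trans yy; rewrite e_sym.
Qed.

(** The index is injective on roots and reaches every list, so counting roots is counting lists. The
    hypothesis on [aS] makes [a] constant on components. *)
Lemma n_comp_count (a : pred T) (aS : pred (seq K)) :
  (forall x, a x = aS (nth [::] cs (component_index cs (c x)))) ->
  n_comp e a = count aS cs.
Proof.
move=> aE; pose h x := component_index cs (c x).
rewrite /n_comp_mem -size_filter cardE -(size_map h).
have -> : size [seq x <- cs | aS x] =
    size [seq i <- iota 0 (size cs) | aS (nth [::] cs i)].
  rewrite !size_filter -[in LHS](mkseq_nth [::] cs) /mkseq count_map.
  by apply: eq_count.
apply/perm_size/uniq_perm; last 1 first.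
- move=> i; rewrite mem_filter mem_iota /= add0n; apply/mapP/andP => [[x]|[ai ilt]].
    by rewrite mem_enum inE /= => /andP[_ ax] ->; split; [rewrite -aE|exact: index_lt].
  have [x0 [x0i _]] := index_connect_head ilt.
  have hx0 : h x0 = i by apply: component_index_uniq x0i; exact: cs_uniq.
  have cr := connect_root e x0.
  have hr : h (fingraph.root e x0) = i by move: cr; rewrite connect_index => /eqP /esym hE; rewrite /h hE.
  exists (fingraph.root e x0) => //; rewrite mem_enum; apply/andP; split.
    exact: roots_root.
  by change (is_true (a (fingraph.root e x0))); rewrite aE -/(h _) hr.
- rewrite map_inj_in_uniq ?enum_uniq // => x y.
  rewrite !mem_enum !inE /= => /andP[/eqP rx _] /andP[/eqP ry _] hxy.
  have /(fingraph.rootP e_sym) : connect e x y by rewrite connect_index; apply/eqP.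
  by rewrite rx ry.
- by rewrite filter_uniq ?iota_uniq.
Qed.

End Components.

Fixpoint assoc (K : eqType) (V : Type) (d : V) (s : seq (K * V)) (k : K) : V :=
  if s is (k', v) :: s' then if k == k' then v else assoc d s' k else d.

(** * Tangles as matchings of named points *)

(* The point j of the input named v is (Some v, j), that of the output is
   (None, j). *)
Definition lpoint : Type := (option nat * nat)%type.

Record diagram := Diagram {
  inputs : seq (nat * disc_shape);
  output : disc_shape;
  matching : seq (lpoint * lpoint);
  floats : nat
}.

Section Diagram.
Variable u : diagram.

Definition names : seq nat := unzip1 (inputs u).

Definition shape_of (o : option nat) : disc_shape :=
  if o is Some v then assoc (0%N, true) (inputs u) v else output u.

Definition points : seq lpoint :=
  flatten [seq [seq (o, j) | j <- iota 0 (shape_of o).1.*2]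
          | o <- None :: map Some names].

Definition lturn (k : lpoint) : lpoint :=
  let n := (shape_of k.1).1.*2 in
  (k.1, if k.1 is None then (k.2 + n).-1 %% n else k.2.+1 %% n)%N.

Definition lshade (k : lpoint) : bool :=
  (shape_of k.1).2 (+) odd k.2 (+) (k.1 == None).

Definition mate (k : lpoint) : lpoint := assoc k (matching u) k.

Definition wellformed : bool :=
  [&& uniq names, uniq points & all (fun k => mate k \in points) points].

Definition strings k := [:: mate k].
Definition discs k := [:: lturn k].
Definition faces k := [:: lturn (mate k)].
Definition links k := [:: mate k; lturn k].

(** The evaluable counterpart of [planar]: each of the four counts in Euler's formula is the length
    of a certified list of components. *)
Definition plane : bool :=
  let cs1 := components strings points in
  let cs2 := components discs points in
  let cs3 := components faces points in
  let cs4 := components links points in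
  [&& wellformed,
      all (fun k => mate (mate k) == k) points,
      all (fun k => lshade (mate k) == ~~ lshade k) points,
      are_components strings points cs1,
      are_components discs points cs2,
      are_components faces points cs3,
      are_components links points cs4
    & size cs1 + size cs2 + size cs3 == size points + (size cs4).*2]%N.

Lemma mem_points k :
  (k \in points) = [&& (if k.1 is Some v then v \in names else true)
                     & (k.2 < (shape_of k.1).1.*2)%N].
Proof.
case: k => o j /=; apply/flatten_mapP/andP => [[p ho' /mapP[j']]|[ho hj]].
  rewrite mem_iota /= add0n => hj' [] -> ->; split=> //.
  move: ho'; rewrite inE => /orP[/eqP->//|/mapP[v hv ->//]].
exists o; last by apply/mapP; exists j => //; rewrite mem_iota add0n.
by case: o ho {hj} => [v hv|_]; rewrite inE // mem_map ?hv ?orbT //; apply: Some_inj.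
Qed.

End Diagram.

Arguments shape_of : simpl never.

Section Labelling.
Variables (I : finType) (ty : I -> disc_shape) (out : disc_shape).
Variables (lab : I -> nat) (u : diagram).

Record labelling : Prop := {
  lab_inj : injective lab;
  lab_codom : names u =i codom lab;
  lab_shape : forall i, ty i = shape_of u (Some (lab i));
  lab_out : out = output u
}.

Definition code (d : bpoint ty out) : lpoint := (omap lab (tag d), val (tagged d)).

Definition draws (t : tangle ty out) : Prop :=
  (forall d, code (strand t d) = mate u (code d)) /\ loops t = floats u.

(** Points are decoded by search; the default [d] is not reached when the diagram is well formed. *)
Definition drawing : tangle ty out :=
  Tangle (fun d => odflt d [pick d' | code d' == mate u (code d)]) (floats u).

Hypothesis labP : labelling.

Lemma code_inj : injective code.
Proof.
move=> [p j] [p' j'] [] /(inj_omap (lab_inj labP)) pp'.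
by move: j'; rewrite -pp' => j' /val_inj->.
Qed.

Lemma shape_code (o : option I) : oapp ty out o = shape_of u (omap lab o).
Proof. by case: o => [i|] /=; [exact: lab_shape labP i|exact: lab_out labP]. Qed.

Lemma mem_code k : (k \in points u) = (k \in codom code).
Proof.
rewrite mem_points; apply/andP/codomP => [[]|[[p j] ->]] /=; last first.
  split; last by rewrite -shape_code ltn_ord.
  by case: p j => //= i _; rewrite (lab_codom labP) codom_f.
case: k => [[v|] j] /=.
  rewrite (lab_codom labP) => /codomP[i ->]; rewrite -(lab_shape labP) => hj.
  by exists (@Tagged _ (Some i) (fun o => 'I_((oapp ty out o).1.*2)) (Ordinal hj)).
move=> _; rewrite -[shape_of u None]/(output u) -(lab_out labP) => hj.
by exists (@Tagged _ None (fun o => 'I_((oapp ty out o).1.*2)) (Ordinal hj)).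
Qed.

Lemma code_points d : code d \in points u. Proof. by rewrite mem_code codom_f. Qed.

Lemma code_turn d : code (turn d) = lturn u (code d).
Proof.
case: d => -[i|] j; rewrite /code /lturn /=.
  by rewrite -(shape_code (Some i)).
by rewrite -(shape_code None).
Qed.

Lemma code_shade d : left_shade d = lshade u (code d).
Proof. by case: d => o j; rewrite /left_shade /lshade /= -shape_code; case: o j. Qed.

Lemma card_bpoint : uniq (points u) -> #|bpoint ty out| = size (points u).
Proof.
move=> uu; rewrite cardT -(size_map code); apply/perm_size/uniq_perm => //.
  by rewrite map_inj_uniq ?enum_uniq //; exact: code_inj.
by move=> k; rewrite mem_code; apply/mapP/codomP => [[d _ ->]|[d ->]]; exists d; rewrite ?mem_enum.
Qed.

Lemma drawing_draws : wellformed u -> draws drawing.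
Proof.
case/and3P => _ _ /allP wf; split=> //= d.
have := wf _ (code_points d); rewrite mem_code => /codomP[d' dE].
by case: pickP => [d'' /eqP//|/(_ d')]; rewrite dE eqxx.
Qed.

Lemma turn_inj : injective (@turn I ty out).
Proof.
move=> d d' /(congr1 code); rewrite /code.
case: d d' => [[i|] j] [[i'|] j'] //=.
  case=> /(lab_inj labP) ii'; move: j'; rewrite -ii' => j' h.
  by rewrite (@ordS_inj _ j j') //; apply/val_inj.
by case=> h; rewrite (@ord_pred_inj _ j j') //; apply/val_inj.
Qed.

(** The relation itself need not be symmetric, but on a finite type an injective map is undone by
    iterating it. *)
Lemma two_functions_connect_sym (T : finType) (f g : T -> T) :
  injective f -> injective g -> connect_sym [rel x y | (f x == y) || (g x == y)].
Proof.
move=> fi gi; set e := [rel x y | _].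
suff h x y : e x y -> connect e y x.
  suff hh x y : connect e x y -> connect e y x by move=> x y; apply/idP/idP; exact: hh.
  case/connectP => p; elim: p x => [|z p IH] x /= => [_ ->//|/andP[exz pz] yE].
  by apply: connect_trans (h _ _ exz); apply: IH.
case/orP => /eqP <-.
  have : fconnect f (f x) x by rewrite fconnect_sym // fconnect1.
  apply: connect_sub => a b /eqP <-; apply: connect1; by rewrite /= eqxx.
have : fconnect g (g x) x by rewrite fconnect_sym // fconnect1.
apply: connect_sub => a b /eqP <-; apply: connect1; by rewrite /= eqxx orbT.
Qed.

(** [code] is a bijection onto the listed points that carries [strand] to [mate] and [turn] to
    [lturn], so all counts in Euler's formula transfer. *)
Lemma plane_planar (t : tangle ty out) : plane u -> draws t -> planar t.
Proof.
case/and5P => /and3P[_ pu _] /allP inv /allP shd c1 /and4P[c2 c3 c4 /eqP eul] [tE _].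
have sinv : involutive (strand t).
  by move=> d; apply: code_inj; rewrite !tE; apply/eqP/inv/code_points.
have si := inv_inj sinv.
apply/and3P; split.
- by apply/forallP => d; rewrite sinv.
- by apply/forallP => d; rewrite !code_shade tE; apply/shd/code_points.
rewrite (card_bpoint pu); move: eul.
rewrite -!count_predT.
rewrite (n_comp_count code_inj mem_code _ (fconnect_sym si) c1 (a := predT) (aS := predT)) //; last first.
  by move=> x y; rewrite inE -tE (inj_eq code_inj) eq_sym.
rewrite (n_comp_count code_inj mem_code _ (fconnect_sym turn_inj) c2 (a := predT) (aS := predT)) //; last first.
  by move=> x y; rewrite inE -code_turn (inj_eq code_inj) eq_sym.
rewrite (n_comp_count code_inj mem_code _ (fconnect_sym (inj_comp turn_inj si)) c3 (a := predT) (aS := predT)) //; last first.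
  by move=> x y; rewrite inE -tE -code_turn (inj_eq code_inj) eq_sym.
rewrite (n_comp_count code_inj mem_code _ (two_functions_connect_sym si turn_inj) c4 (a := predT) (aS := predT)) //; last first.
  by move=> x y; rewrite !inE -tE -code_turn !(inj_eq code_inj) !(eq_sym y).
by move=> ->.
Qed.

End Labelling.

(** * Plugging a tangle into another *)

Section Plugging.
Variables (u : diagram) (w : nat) (v : diagram).

(* Points of u carry the mark true, those of v the mark false. *)
Definition plug_succ (k : bool * lpoint) : seq (bool * lpoint) :=
  if k.1 then
    (true, mate u k.2) ::
      (if k.2.1 == Some w then [:: (false, (None, k.2.2))] else [::])
  else
    (false, mate v k.2) ::
      (if k.2.1 == None then [:: (true, (Some w, k.2.2))] else [::]).

Definition plug_points : seq (bool * lpoint) :=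
  [seq (true, k) | k <- points u] ++ [seq (false, k) | k <- points v].

Definition survives (k : bool * lpoint) : bool :=
  if k.1 then k.2.1 != Some w else k.2.1 != None.

Definition plug_components : seq (seq (bool * lpoint)) :=
  components plug_succ plug_points.

(** A component of the glued graph is either a path between two surviving points, which becomes a
    string, or a closed curve without survivors, which becomes a float. *)
Definition plug : diagram :=
  let cs := plug_components in
  Diagram ([seq i <- inputs u | i.1 != w] ++ inputs v) (output u)
    (flatten [seq (if [seq k <- s | survives k] is [:: k; l]
                   then [:: (k.2, l.2); (l.2, k.2)] else [::]) | s <- cs])
    (floats u + floats v + count (fun s => ~~ has survives s) cs).

(** Recovers the mark of a surviving point from its name: the output and the inputs not named in [v]
    come from [u]. *)
Definition origin (k : lpoint) : bool * lpoint :=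
  (if k.1 is Some i then i \notin names v else true, k).

(** The defining property of [glues] is tested on all pairs of points of the result. The table of
    partners and component indices is built beforehand, so that the double loop repeats no
    search. *)
Definition pluggable : bool :=
  let r := plug in
  let cs := plug_components in
  let table := [seq (k, (mate r k, component_index cs (origin k))) | k <- points r] in
  [&& w \in names u, shape_of u (Some w) == output v, plane r,
      are_components plug_succ plug_points cs
    & all (fun p => all (fun q =>
        (p.2.1 == q.1) == (p.1 != q.1) && (p.2.2 == q.2.2)) table) table].

End Plugging.

(** Packing a box with its shape lets boxes of different shapes share one environment indexed by
    names. *)
Definition element (R : realType) (P : planar_data R) (s : disc_shape) (x : P s) :
  {s : disc_shape & P s} := existT (fun s => P s : Type) s x.

Lemma element_inj (R : realType) (P : planar_data R) (s : disc_shape) :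
  injective (@element R P s).
Proof.
move=> x y e; have := projT2_eq e.
(* Shapes have decidable equality, so the equality proof between them is reflexivity and the
   transport disappears. *)
by rewrite (eq_irrelevance (projT1_eq e) erefl).
Qed.

Lemma element_tagged (R : realType) (P : planar_data R) (x : {s : disc_shape & P s}) :
  element (tagged x) = x.
Proof. by case: x. Qed.

Section Values.
Variables (R : realType) (P : planar_data R) (hP : subfactor_planar_algebra P).
Variable env : nat -> {s : disc_shape & P s}.

Definition input_shape (s : seq nat) (i : seq_sub s) : disc_shape :=
  tag (env (ssval i)).

Definition value (u : diagram) : P (output u) :=
  act P (drawing (@input_shape (names u)) (output u) (@ssval _ _) u)
    (fun i => tagged (env (ssval i))).

Definition fits (u : diagram) : Prop :=
  forall i, i \in names u -> tag (env i) = shape_of u (Some i).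

Definition holds (o : nat) (u : diagram) : Prop :=
  [/\ plane u, fits u & env o = element (value u)].

Lemma plane_wellformed u : plane u -> wellformed u.
Proof. by case/and5P. Qed.

Lemma value_labelling u : fits u ->
  labelling (@input_shape (names u)) (output u) (@ssval _ _) u.
Proof.
move=> fu; split=> [||i|//]; first exact: val_inj.
  move=> i; apply/idP/codomP => [iu|[j ->]]; last exact: ssvalP.
  by exists (SeqSub iu).
by apply: fu; exact: ssvalP.
Qed.

(** A labelled tangle drawn by [u] is the canonical one of [value] with its inputs renamed, so
    [act_relabel] applies once the shape equalities are substituted away. *)
Lemma act_value (I : finType) (ty : I -> disc_shape) out (t : tangle ty out)
    (x : forall i, P (ty i)) (lab : I -> nat) u :
  labelling ty out lab u -> draws lab u t -> plane u ->
  (forall i, env (lab i) = element (x i)) ->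
  element (act P t x) = element (value u).
Proof.
move=> labP tu pu xE.
have lu i : lab i \in names u by rewrite (lab_codom labP) codom_f.
pose f i : seq_sub (names u) := SeqSub (lu i).
(* As an equation between functions it can be substituted, which gives [t] the type
   [tangle (_ \o f) _] demanded by [relabels]. *)
have e : ty = @input_shape (names u) \o f.
  by apply/funext => i /=; rewrite /input_shape xE.
have outE := lab_out labP; subst out.
have fu : fits u.
  move=> i; rewrite (lab_codom labP) => /codomP[j ->].
  by rewrite xE -(lab_shape labP).
subst ty; congr element.
have {}xE : x = fun i => tagged (env (ssval (f i))).
  apply: functional_extensionality_dep => i.
  by apply: (@element_inj R P _); rewrite -xE; exact/esym/(element_tagged (env (lab i))).
rewrite xE; have vP := value_labelling fu.
have tvu := drawing_draws vP (plane_wellformed pu).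
rewrite /value; symmetry; apply: (act_relabel hP).
- by have := plane_planar labP pu tu.
- by have := plane_planar vP pu tvu.
- have fi : injective f by move=> i j /(congr1 (@ssval _ _)) /(lab_inj labP).
  have cI : (#|{: seq_sub (names u)}| <= #|I|)%N.
    have nu : uniq (names u) by case/and3P: (plane_wellformed pu).
    rewrite card_seq_sub // -(size_codom lab).
    by apply: uniq_leq_size => // i; rewrite (lab_codom labP).
  by have := inj_card_bij fi cI.
split; last by case: tu tvu => [_ ->] [_ ->].
have codeE (d : bpoint (@input_shape (names u) \o f) (output u)) :
    code (@ssval _ _) (relabel_point d) = code lab d by case: d => -[i|] j.
by move=> d; apply: (code_inj vP); rewrite tvu.1 !codeE tu.1.
Qed.

Lemma holds_act (I : finType) (ty : I -> disc_shape) out (t : tangle ty out)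
    (x : forall i, P (ty i)) (lab : I -> nat) o u :
  labelling ty out lab u -> draws lab u t -> plane u ->
  (forall i, env (lab i) = element (x i)) -> env o = element (act P t x) ->
  holds o u.
Proof.
move=> labP tu pu xE oE; split=> //; last by rewrite oE; exact: act_value xE.
move=> i; rewrite (lab_codom labP) => /codomP[j ->].
by rewrite xE -(lab_shape labP).
Qed.

End Values.

Section PlugTheory.
Variables (R : realType) (P : planar_data R) (hP : subfactor_planar_algebra P).
Variable env : nat -> {s : disc_shape & P s}.

Section Plug.
Variables (u v : diagram) (w : nat).
Hypotheses (fu : fits env u) (fv : fits env v) (pu : plane u) (pv : plane v).
Hypothesis uwv : pluggable u w v.

Local Notation rest := [seq i <- names u | i != w].
Local Notation I := (seq_sub rest).
Local Notation J := (seq_sub (names v)).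
Local Notation tyI := (@input_shape _ _ env rest).
Local Notation tyJ := (@input_shape _ _ env (names v)).

Local Definition outer_name (o : option I) : nat := oapp (@ssval _ _) w o.
Local Definition glued_name (k : I + J) : nat :=
  match k with inl i => ssval i | inr j => ssval j end.

Local Lemma names_plug : names (plug u w v) = rest ++ names v.
Proof. by rewrite /names /unzip1 map_cat filter_map. Qed.

Local Lemma plane_plug : plane (plug u w v).
Proof. by case/and5P: uwv. Qed.

Local Lemma uniq_names_plug : uniq (rest ++ names v).
Proof. by rewrite -names_plug; case/and3P: (plane_wellformed plane_plug). Qed.

Local Lemma outer_labelling :
  labelling (outer_ty tyI (output v)) (output u) outer_name u.
Proof.
case/and5P: uwv => wu /eqP wE _ _ _.
have niw (i : I) : (ssval i != w) && (ssval i \in names u).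
  by have := ssvalP i; rewrite mem_filter.
split=> //.
- move=> [i|] [j|] //= ij; first by congr Some; exact: val_inj.
    by have /andP[/eqP] := niw i.
  by have /andP[/eqP] := niw j; rewrite -ij.
- move=> i; apply/idP/codomP => [iu|[[j|] -> //=]]; last by case/andP: (niw j).
  have [iw|iw] := eqVneq i w; first by exists None; rewrite iw.
  have ir : i \in rest by rewrite mem_filter iw.
  by exists (Some (SeqSub ir)).
- by move=> [i|] //=; apply: fu; case/andP: (niw i).
Qed.

Local Lemma inner_labelling : labelling tyJ (output v) (@ssval _ _) v.
Proof. exact: value_labelling fv. Qed.

Local Lemma assoc_cat (K : eqType) (V : Type) (d : V) (s1 s2 : seq (K * V)) k :
  assoc d (s1 ++ s2) k =
  if k \in unzip1 s1 then assoc d s1 k else assoc d s2 k.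
Proof.
elim: s1 => // -[k' x] s1 IH /=; rewrite inE.
by case: eqP => //= _; rewrite IH.
Qed.

Local Lemma assoc_filter (s : seq (nat * disc_shape)) d k : k != w ->
  assoc d [seq i <- s | i.1 != w] k = assoc d s k.
Proof.
move=> kw; elim: s => // -[k' x] s IH /=.
case: ifP => /= [_|/negbFE/eqP ->]; first by rewrite IH.
by rewrite (negbTE kw).
Qed.

Local Lemma glued_labelling :
  labelling (glued_ty tyI tyJ) (output u) glued_name (plug u w v).
Proof.
have := uniq_names_plug; rewrite cat_uniq => /and3P[_ /hasPn dis _].
split=> //.
- move=> [i|i] [j|j] /= ij; first by congr inl; exact: val_inj.
  + by have /dis/negP[] := ssvalP j; rewrite -ij; exact: ssvalP.
  + by have /dis/negP[] := ssvalP i; rewrite ij; exact: ssvalP.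
  + by congr inr; exact: val_inj.
- move=> i; rewrite names_plug mem_cat; apply/orP/codomP => [[ir|iv]|[[j|j] ->]].
  + by exists (inl (SeqSub ir)).
  + by exists (inr (SeqSub iv)).
  + by left; exact: ssvalP.
  + by right; exact: ssvalP.
- have E (i : nat) : shape_of (plug u w v) (Some i) =
      if i \in rest then shape_of u (Some i) else shape_of v (Some i).
    rewrite /shape_of /= assoc_cat.
    have -> : unzip1 [seq i0 <- inputs u | i0.1 != w] = rest by rewrite /unzip1 filter_map.
    by case: ifP => //; rewrite mem_filter => /andP[iw _]; rewrite assoc_filter.
  move=> [i|j] /=; rewrite E.
    rewrite ssvalP; apply: fu; by have := ssvalP i; rewrite mem_filter => /andP[].
  by rewrite (negbTE (dis _ (ssvalP j))); apply: fv; exact: ssvalP.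
Qed.

Local Notation t := (drawing (outer_ty tyI (output v)) (output u) outer_name u).
Local Notation s := (drawing tyJ (output v) (@ssval _ _) v).
Local Notation r := (drawing (glued_ty tyI tyJ) (output u) glued_name (plug u w v)).
Local Notation old := (bpoint (outer_ty tyI (output v)) (output u) +
                       bpoint tyJ (output v))%type.

Local Notation old_pt := (@old_point I J tyI tyJ (output v) (output u)).

Local Definition old_code (x : old) : bool * lpoint :=
  match x with
  | inl d => (true, code outer_name d)
  | inr d => (false, code (@ssval _ _) d)
  end.

Local Lemma old_code_inj : injective old_code.
Proof.
move=> [d|d] [d'|d'] // /(congr1 snd).
  by move/(code_inj outer_labelling) => ->.
by move/(code_inj inner_labelling) => ->.
Qed.

Local Lemma mem_old_code k : (k \in plug_points u v) = (k \in codom old_code).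
Proof.
case: k => b k; rewrite mem_cat; apply/orP/codomP.
  case=> /mapP[l lu [-> ->]].
    by move: lu; rewrite (mem_code outer_labelling) => /codomP[d ->]; exists (inl d).
  by move: lu; rewrite (mem_code inner_labelling) => /codomP[d ->]; exists (inr d).
case=> -[d|d] [-> ->].
  by left; rewrite map_f // -/(code outer_name d) (code_points outer_labelling).
by right; rewrite map_f // -/(code (@ssval _ _) d) (code_points inner_labelling).
Qed.

Local Lemma t_draws : draws outer_name u t.
Proof. exact: drawing_draws outer_labelling (plane_wellformed pu). Qed.

Local Lemma s_draws : draws (@ssval _ _) v s.
Proof. exact: drawing_draws inner_labelling (plane_wellformed pv). Qed.

Local Lemma r_draws : draws glued_name (plug u w v) r.
Proof. exact: drawing_draws glued_labelling (plane_wellformed plane_plug). Qed.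

Local Lemma glue_stepE x y : glue_step t s x y = (old_code y \in plug_succ u w v (old_code x)).
Proof.
have tE d d' : (strand t d == d') = (code outer_name d' == mate u (code outer_name d)).
  by rewrite -t_draws.1 eq_sym (inj_eq (code_inj outer_labelling)).
have sE d d' : (strand s d == d') = (code (@ssval _ _) d' == mate v (code (@ssval _ _) d)).
  by rewrite -s_draws.1 eq_sym (inj_eq (code_inj inner_labelling)).
have nw (i : I) : (ssval i == w) = false.
  by have := ssvalP i; rewrite mem_filter => /andP[/negbTE].
rewrite /plug_succ; case: x y => [x|x] [y|y]; rewrite [old_code _]/= [old_code (_ y)]/= /fst /snd inE xpair_eqE.
- have -> : glue_step t s (inl x) (inl y) = (strand t x == y) by case: x => -[[i|]|] j.
  rewrite eqxx andTb tE; case: ifP => _; last by rewrite in_nil orbF.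
  by rewrite mem_seq1 xpair_eqE orbF.
- rewrite [false == true]/= andFb orFb; case: x => -[[i|]|] j; rewrite /code /=.
  + case: eqP => [[e]|_]; last by rewrite in_nil.
    by have := nw i; rewrite e eqxx.
  + rewrite eqxx mem_seq1 !xpair_eqE eqxx; by case: y => [[k|] l].
  + by rewrite in_nil.
- rewrite [true == false]/= andFb orFb; case: x => [[k|] j]; rewrite /code /=.
    by rewrite in_nil; case: y => [[[i|]|] l].
  rewrite mem_seq1 !xpair_eqE eqxx /=; case: y => [[[i|]|] l] //=.
    by case: eqP => [[e]|//]; have := nw i; rewrite e eqxx.
  by rewrite eqxx eq_sym.
- have -> : glue_step t s (inr x) (inr y) = (strand s x == y) by case: x => -[i|] j.
  rewrite eqxx andTb sE; case: ifP => _; last by rewrite in_nil orbF.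
  by rewrite mem_seq1 xpair_eqE orbF.
Qed.

Local Lemma planar_strandK (I0 : finType) (ty : I0 -> disc_shape) out (t0 : tangle ty out) :
  planar t0 -> involutive (strand t0).
Proof. by case/and3P => /forallP h _ _ d; exact/eqP. Qed.

Local Lemma t_planar : planar t.
Proof. by have := plane_planar outer_labelling pu t_draws. Qed.

Local Lemma s_planar : planar s.
Proof. by have := plane_planar inner_labelling pv s_draws. Qed.

Local Lemma r_planar : planar r.
Proof. by have := plane_planar glued_labelling plane_plug r_draws. Qed.

Local Lemma glue_step_sym : symmetric (glue_step t s).
Proof.
have tK := planar_strandK t_planar; have sK := planar_strandK s_planar.
move=> [x|x] [y|y].
- have E a c : glue_step t s (inl a) (inl c) = (strand t a == c) by case: a => -[[i|]|] j.
  by rewrite !E (can2_eq tK tK) eq_sym.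
- by case: x y => -[[i|]|] j [[k|] l].
- by case: x y => -[k|] l [[[i|]|] j].
- have E a c : glue_step t s (inr a) (inr c) = (strand s a == c) by case: a => -[i|] j.
  by rewrite !E (can2_eq sK sK) eq_sym.
Qed.

Local Notation index_of := (component_index (plug_components u w v)).

Local Lemma components_ok :
  are_components (plug_succ u w v) (plug_points u v) (plug_components u w v).
Proof. by case/and5P: uwv. Qed.

Local Lemma connectE x y :
  connect (glue_step t s) x y = (index_of (old_code x) == index_of (old_code y)).
Proof.
exact: (connect_index old_code_inj mem_old_code glue_stepE
          (sym_connect_sym glue_step_sym) components_ok).
Qed.

Local Lemma old_code_point d : old_code (old_pt d) = origin v (code glued_name d).
Proof.
have := uniq_names_plug; rewrite cat_uniq => /and3P[_ /hasPn dis _].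
case: d => -[[i|j]|] k //; rewrite /origin /=.
  by case: (boolP (ssval i \in names v)) => //= /dis/negP[]; exact: ssvalP.
by rewrite (ssvalP j).
Qed.

Local Lemma old_pointP x :
  reflect (exists d, x = old_pt d) (survives w (old_code x)).
Proof.
have niw (i : I) : (ssval i == w) = false.
  by have := ssvalP i; rewrite mem_filter => /andP[/negbTE].
apply: (iffP idP) => [|[d ->]]; last first.
  case: d => -[[i|j]|] k //; rewrite /survives /=.
  by apply/eqP => -[e]; have := niw i; rewrite e eqxx.
case: x => -[q j]; rewrite /survives /=; last first.
  case: q j => // i j _.
  by exists (existT (fun o => 'I_((oapp (glued_ty tyI tyJ) (output u) o).1.*2)) (Some (inr i)) j).
case: q j => [[i|]|] j; rewrite /= ?eqxx // => _.
  by exists (existT (fun o => 'I_((oapp (glued_ty tyI tyJ) (output u) o).1.*2)) (Some (inl i)) j).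
by exists (existT (fun o => 'I_((oapp (glued_ty tyI tyJ) (output u) o).1.*2)) None j).
Qed.

(** The clause on strings is the table tested by [pluggable]. The clause on loops is [n_comp_count],
    since the components avoiding all surviving points are the lists without survivors. *)
Local Lemma glues_plug : glues t s r.
Proof.
split=> [d d'|].
  case/and5P: uwv => _ _ _ _ /allP chk.
  pose row k := (k, (mate (plug u w v) k, index_of (origin v k))).
  have rowP (e : bpoint (glued_ty tyI tyJ) (output u)) :
      row (code glued_name e) \in [seq row k | k <- points (plug u w v)].
    by apply: map_f; have := code_points glued_labelling e.
  have /allP/(_ _ (rowP d'))/eqP/= e := chk _ (rowP d).
  rewrite -r_draws.1 !(inj_eq (code_inj glued_labelling)) in e.
  by rewrite connectE !old_code_point -e.
rewrite /=; congr (_ + _)%N; symmetry.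
apply: (n_comp_count old_code_inj mem_old_code glue_stepE
          (sym_connect_sym glue_step_sym) components_ok) => x /=.
set S := nth _ _ _.
have memS y : (old_code y \in S) = connect (glue_step t s) x y.
  rewrite connectE; apply/idP/eqP => [yS|e].
    apply/esym/component_index_uniq => //; by case/and4P: components_ok.
  rewrite /S e; exact: (mem_component_index mem_old_code components_ok).
apply/forallP/hasPn => [h k kS|h d]; last first.
  by rewrite -memS; apply/negP => /h/negP[]; apply/old_pointP; exists d.
have [y yE] := component_decode mem_old_code components_ok kS.
apply/negP; rewrite -yE => /old_pointP[d dE].
by have /negP[] := h d; rewrite -dE -memS yE.
Qed.

(** [act_glue] works with the index types [option I] and [I + J]; [act_value] is used at both ends
    to return to inputs indexed by names. *)
Lemma value_plug : env w = element (value env v) ->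
  element (value env u) = element (value env (plug u w v)).
Proof.
move=> wE.
pose x (k : I + J) : P (glued_ty tyI tyJ k) :=
  match k with
  | inl i => tagged (env (ssval i))
  | inr j => tagged (env (ssval j))
  end.
rewrite -(act_value hP (x := x) glued_labelling r_draws plane_plug); last first.
  by move=> [i|j]; rewrite /x /= element_tagged.
rewrite (act_glue hP x t_planar s_planar r_planar glues_plug).
apply/esym/(act_value hP outer_labelling t_draws pu).
by move=> [i|]; rewrite /= ?element_tagged.
Qed.

End Plug.

Lemma holds_plug o u w v : holds env o u -> holds env w v -> pluggable u w v ->
  holds env o (plug u w v).
Proof.
move=> [pu fu oE] [pv fv wE] uwv; have fr : fits env (plug u w v).
  move=> i iu; have labP := glued_labelling fu fv uwv.
  move: iu; rewrite (lab_codom labP) => /codomP[k ->].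
  by rewrite -(lab_shape labP); case: k.
split=> //; first exact: plane_plug uwv.
by rewrite oE; exact: value_plug.
Qed.

End PlugTheory.

(** * Comparison of composites, and reflection of diagrams *)

Fixpoint plug_all (u : diagram) (prog : seq (nat * diagram)) : option diagram :=
  if prog is (w, v) :: prog' then
    if pluggable u w v then plug_all (plug u w v) prog' else None
  else Some u.

(** [k] is the excess of closed strings in [u] over [v], each of them worth one factor [delta P]. *)
Definition same_drawing (k : nat) (u v : diagram) : bool :=
  [&& all (mem (names v)) (names u), all (mem (names u)) (names v),
      output u == output v,
      all (fun i => shape_of u (Some i) == shape_of v (Some i)) (names u),
      all (fun l => mate u l == mate v l) (points v)
    & floats u == k + floats v]%N.

Definition same_composite (k : nat) (u v : diagram)
    (prog_u prog_v : seq (nat * diagram)) : bool :=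
  if plug_all u prog_u is Some r then
    if plug_all v prog_v is Some s then same_drawing k r s else false
  else false.

Definition diagram_of (ins : seq (nat * disc_shape)) (out : disc_shape)
    (f : lpoint -> lpoint) : diagram :=
  Diagram ins out [seq (k, f k) | k <- points (Diagram ins out [::] 0)] 0.

Lemma mate_diagram_of ins out f k : k \in points (diagram_of ins out f) ->
  mate (diagram_of ins out f) k = f k.
Proof.
rewrite /mate /=; have -> : points (diagram_of ins out f) = points (Diagram ins out [::] 0) by [].
elim: (points _) => // l L IH; rewrite inE /=; have [->//|_ /=] := eqVneq k l.
exact: IH.
Qed.

(** The adjoint of the input [i] is named [m + i], so that a box and its adjoint can occur in the
    same diagram. *)
Definition reflect_point (u : diagram) (m : nat) (k : lpoint) : lpoint :=
  (omap (addn m) k.1, (shape_of u k.1).1.*2 - k.2.+1)%N.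

Definition reflect_diagram (m : nat) (u : diagram) : diagram :=
  Diagram [seq ((m + i.1)%N, i.2) | i <- inputs u] (output u)
    [seq (reflect_point u m k, reflect_point u m (mate u k)) | k <- points u]
    (floats u).

Definition reflectable (m : nat) (u : diagram) : bool :=
  plane (reflect_diagram m u) &&
  all (fun k => mate (reflect_diagram m u) (reflect_point u m k)
                == reflect_point u m (mate u k)) (points u).

Lemma element_scale (R : realType) (P : planar_data R) s s' (x y : P s) (z : P s') c :
  element y = element z -> element x = element (c *: z) -> x = c *: y.
Proof.
move=> yz; have e : s' = s := esym (projT1_eq yz); subst s'.
by rewrite (element_inj yz) => /element_inj.
Qed.

Section Identities.
Variables (R : realType) (P : planar_data R) (hP : subfactor_planar_algebra P).
Variable env : nat -> {s : disc_shape & P s}.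

Fixpoint all_hold (prog : seq (nat * diagram)) : Prop :=
  if prog is (w, v) :: prog' then holds env w v /\ all_hold prog' else True.

Lemma holds_plug_all o u prog r : holds env o u -> all_hold prog ->
  plug_all u prog = Some r -> holds env o r.
Proof.
elim: prog u => [|[w v] prog IH] u hu /=; first by move=> _ [<-].
case=> hv hprog; case: ifP => // uwv; apply: IH => //.
exact: holds_plug.
Qed.

Lemma act_loops (I : finType) (ty : I -> disc_shape) out (t : tangle ty out)
    (x : forall i, P (ty i)) k n :
  planar t ->
  act P (Tangle (strand t) (k + n)) x =
  (delta P)%:C%C ^+ k *: act P (Tangle (strand t) n) x.
Proof.
move=> pt; elim: k => [|k IH]; first by rewrite expr0 scale1r.
rewrite addSn (act_loop hP (t := Tangle (strand t) (k + n))) //.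
by rewrite IH scalerA exprS.
Qed.

Lemma same_drawing_eq o o' k u v s (x y : P s) :
  env o = element x -> env o' = element y ->
  holds env o u -> holds env o' v -> same_drawing k u v ->
  x = (delta P)%:C%C ^+ k *: y.
Proof.
move=> ox oy [pu fu oE] [pv fv oE'] /and5P[/allP uv /allP vu /eqP out_uv /allP shp].
case/andP => /allP mt /eqP fl.
have lv := value_labelling fv.
pose ty := @input_shape _ _ env (names v).
have lu : labelling ty (output v) (@ssval _ _) u.
  split=> //; first exact: lab_inj lv.
    move=> i; rewrite -(lab_codom lv); apply/idP/idP; [exact: uv|exact: vu].
  move=> i; apply: (etrans (lab_shape lv i)); apply/esym/eqP/shp.
  by apply: vu; exact: ssvalP.
pose t := drawing ty (output v) (@ssval _ _) v.
have tv : draws (@ssval _ _) v t by exact: drawing_draws lv (plane_wellformed pv).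
pose t' : tangle ty (output v) := Tangle (strand t) (floats u).
have tu : draws (@ssval _ _) u t'.
  split=> // d; rewrite [strand t']/(strand t) tv.1; apply/esym/eqP/mt.
  by have := code_points lv d.
have pt : planar t by have := plane_planar lv pv tv.
have e0 := act_value hP lu tu pu
  (fun i : seq_sub (names v) => esym (element_tagged (env (ssval i)))).
move: e0; rewrite -oE /t' fl act_loops //; have -> : Tangle (strand t) (floats v) = t by [].
rewrite -[act P t _]/(value env v) => e.
have yv : element y = element (value env v) by rewrite -oE' oy.
by apply: (element_scale yv); rewrite -ox.
Qed.

Lemma same_composite_eq o o' k u v prog_u prog_v s (x y : P s) :
  holds env o u -> holds env o' v -> all_hold prog_u -> all_hold prog_v ->
  same_composite k u v prog_u prog_v ->
  env o = element x -> env o' = element y -> x = (delta P)%:C%C ^+ k *: y.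
Proof.
move=> hu hv hpu hpv; rewrite /same_composite.
case ur: plug_all => [r|//]; case vr: plug_all => [r'|//] c ox oy.
exact: same_drawing_eq ox oy (holds_plug_all hu hpu ur) (holds_plug_all hv hpv vr) c.
Qed.

Definition star_element (x : {s : disc_shape & P s}) : {s : disc_shape & P s} :=
  element (star (tagged x)).

Lemma unzip1_shift m (s : seq (nat * disc_shape)) :
  unzip1 [seq ((m + i.1)%N, i.2) | i <- s] = [seq (m + i)%N | i <- unzip1 s].
Proof. by rewrite /unzip1 -!map_comp. Qed.

Lemma assoc_shift m d (s : seq (nat * disc_shape)) i :
  assoc d [seq ((m + i.1)%N, i.2) | i <- s] (m + i)%N = assoc d s i.
Proof. by elim: s => // -[j x] s IH /=; rewrite eqn_add2l IH. Qed.

(** This is [star_act]; that the reflected diagram draws the mirror tangle is read off the test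
    [reflectable]. *)
Lemma holds_reflect m o o' u : holds env o u -> env o' = star_element (env o) ->
  (forall i, i \in names u -> env (m + i)%N = star_element (env i)) ->
  reflectable m u -> holds env o' (reflect_diagram m u).
Proof.
move=> [pu fu oE] o'E iE /andP[pr /allP rm].
have lu := value_labelling fu.
pose ty := @input_shape _ _ env (names u).
pose t := drawing ty (output u) (@ssval _ _) u.
have tu : draws (@ssval _ _) u t by exact: drawing_draws lu (plane_wellformed pu).
have pt : planar t by have := plane_planar lu pu tu.
have shE (q : option nat) :
    shape_of (reflect_diagram m u) (omap (addn m) q) = shape_of u q.
  by case: q => // i; rewrite /shape_of /= assoc_shift.
pose lab (i : seq_sub (names u)) : nat := (m + ssval i)%N.
have lr : labelling ty (output u) lab (reflect_diagram m u).
  split=> //.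
  - by move=> i j /addnI /(lab_inj lu).
  - move=> i; rewrite /names /= unzip1_shift; apply/mapP/codomP.
      by case=> j ju ->; exists (SeqSub ju).
    by case=> j ->; exists (ssval j) => //; exact: ssvalP.
  - by move=> i; apply: (etrans (lab_shape lu i)); rewrite -(shE (Some _)).
apply: (holds_act hP (t := mirror t) (x := fun i => star (tagged (env (ssval i)))) lr) => //.
- split=> [d|]; last by [].
  have cE (e : bpoint ty (output u)) :
      code lab (mirror_point e) = reflect_point u m (code (@ssval _ _) e).
    rewrite /reflect_point /code; case: e => q j /=.
    congr (_, _); first by case: q j.
    by rewrite -(shape_code lu).
  rewrite [strand _ _]/= cE tu.1 -(eqP (rm _ _)) -?cE; last first.
    by have := code_points lu (mirror_point d).
  by congr (mate _ (code _ _)); case: d => q j; rewrite /= rev_ordK.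
- by move=> i; apply: iE; exact: ssvalP.
- by rewrite o'E oE /star_element -(star_act hP).
Qed.
End Identities.

(** * Diagrams of the elementary tangles *)

Definition pair_diagram n b (i j : nat) (f : lpoint -> lpoint) : diagram :=
  diagram_of [:: (i, (n, b)); (j, (n, b))] (n, b) f.

Definition mul_diagram n b (i j : nat) : diagram :=
  pair_diagram n b i j (fun k =>
    let opp := (n.*2 - k.2.+1)%N in
    if k.1 is Some v then
      if v == i then if (k.2 < n)%N then (None, k.2) else (Some j, opp)
      else if (k.2 < n)%N then (Some i, opp) else (None, k.2)
    else (Some (if (k.2 < n)%N then i else j), k.2)).

Definition conv_diagram b (i j : nat) : diagram :=
  pair_diagram 2 b i j (fun k =>
    let left := (k.2 == 0) || (k.2 == 3) in
    let flip := nth 0 [:: 1; 0; 3; 2] k.2 in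
    if k.1 is Some v then
      if v == i then if left then (None, k.2) else (Some j, flip)
      else if left then (Some i, flip) else (None, k.2)
    else (Some (if left then i else j), k.2))%N.

Definition unit_diagram n b : diagram :=
  diagram_of [::] (n, b) (fun k => (None, n.*2 - k.2.+1)%N).

Definition one_diagram (s t : disc_shape) (i : nat) (f g : nat -> lpoint) : diagram :=
  diagram_of [:: (i, s)] t (fun k => if k.1 is None then f k.2 else g k.2).

Definition identity_diagram n b i : diagram :=
  one_diagram (n, b) (n, b) i (fun j => (Some i, j)) (fun j => (None, j)).

Definition trace_diagram n b i : diagram :=
  one_diagram (n, b) (0%N, b) i (fun j => (None, j)) (fun j => (Some i, n.*2 - j.+1)%N).

Definition fourier_diagram b i : diagram :=
  one_diagram (2%N, b) (2%N, ~~ b) i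
    (fun j => (Some i, j.+1 %% 4)%N) (fun j => (None, (j + 4).-1 %% 4)%N).

Definition inv_fourier_diagram b i : diagram :=
  one_diagram (2%N, b) (2%N, ~~ b) i
    (fun j => (Some i, (j + 4).-1 %% 4)%N) (fun j => (None, j.+1 %% 4)%N).

Definition half_turn_diagram b i : diagram :=
  one_diagram (2%N, b) (2%N, b) i
    (fun j => (Some i, (j + 2) %% 4)%N) (fun j => (None, (j + 2) %% 4)%N).

(** The arc joining the two left points encloses the starred region, hence the opposite shading of
    the output. *)
Definition left_cap_diagram b i : diagram :=
  one_diagram (2%N, b) (1%N, ~~ b) i (fun j => (Some i, j.+1))
    (nth (None, 0%N) [:: (Some i, 3); (None, 0); (None, 1); (Some i, 0)]%N).

Definition left_strand_diagram b i : diagram :=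
  one_diagram (1%N, ~~ b) (2%N, b) i
    (nth (None, 0%N) [:: (None, 3); (Some i, 0); (Some i, 1); (None, 0)]%N)
    (fun j => (None, j.+1)).

Definition disc_point (I : finType) (ty : I -> disc_shape) out (q : option I)
    (j : 'I_((oapp ty out q).1.*2)) : bpoint ty out :=
  @Tagged _ q (fun q => 'I_((oapp ty out q).1.*2)) j.

Definition half_turn_tangle b : tangle (fun _ : unit => (2%N, b)) (2%N, b) :=
  Tangle (fun d : bpoint (fun _ : unit => (2%N, b)) (2%N, b) => match d with
    | existT None j => disc_point (q := Some tt) (ordS (ordS j))
    | existT (Some _) j => disc_point (q := None) (ordS (ordS j))
    end) 0.

Definition left_cap_tangle b : tangle (fun _ : unit => (2%N, b)) (1%N, ~~ b) :=
  let ty (_ : unit) : disc_shape := (2%N, b) in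
  let in_pt (j : 'I_4) : bpoint ty (1%N, ~~ b) := @disc_point _ ty (1%N, ~~ b) (Some tt) j in
  let out_pt (j : 'I_2) : bpoint ty (1%N, ~~ b) := @disc_point _ ty (1%N, ~~ b) None j in
  Tangle (fun d : bpoint ty (1%N, ~~ b) => match d with
    | existT None j => in_pt (inord j.+1)
    | existT (Some _) j =>
        nth d [:: in_pt (@Ordinal 4 3 isT); out_pt (@Ordinal 2 0 isT);
                  out_pt (@Ordinal 2 1 isT); in_pt (@Ordinal 4 0 isT)] j
    end) 0.

Definition left_strand_tangle b : tangle (fun _ : unit => (1%N, ~~ b)) (2%N, b) :=
  let ty (_ : unit) : disc_shape := (1%N, ~~ b) in
  let in_pt (j : 'I_2) : bpoint ty (2%N, b) := @disc_point _ ty (2%N, b) (Some tt) j in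
  let out_pt (j : 'I_4) : bpoint ty (2%N, b) := @disc_point _ ty (2%N, b) None j in
  Tangle (fun d : bpoint ty (2%N, b) => match d with
    | existT None j =>
        nth d [:: out_pt (@Ordinal 4 3 isT); in_pt (@Ordinal 2 0 isT);
                  in_pt (@Ordinal 2 1 isT); out_pt (@Ordinal 4 0 isT)] j
    | existT (Some _) j => out_pt (inord j.+1)
    end) 0.

Section Holds.
Variables (R : realType) (P : planar_data R) (hP : subfactor_planar_algebra P).

Definition half_turn b (x : P (2%N, b)) : P (2%N, b) :=
  act P (half_turn_tangle b) (fun _ => x).

Definition left_cap b (x : P (2%N, b)) : P (1%N, ~~ b) :=
  act P (left_cap_tangle b) (fun _ => x).

Definition left_strand b (x : P (1%N, ~~ b)) : P (2%N, b) :=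
  act P (left_strand_tangle b) (fun _ => x).

Variable env : nat -> {s : disc_shape & P s}.

Lemma draws_diagram_of (I : finType) (ty : I -> disc_shape) out (lab : I -> nat)
    ins f (t : tangle ty out) :
  labelling ty out lab (diagram_of ins out f) -> loops t = 0%N ->
  (forall d, code lab (strand t d) = f (code lab d)) ->
  draws lab (diagram_of ins out f) t.
Proof.
move=> lP t0 tf; split=> // d; rewrite tf mate_diagram_of //.
by have := code_points lP d.
Qed.

Lemma pair_labelling n b i j f : i != j ->
  labelling (fun _ : bool => (n, b)) (n, b) (fun k => if k then i else j)
    (pair_diagram n b i j f).
Proof.
move=> ij; split=> //.
- by move=> [] [] // e; move: ij; rewrite e eqxx.
- move=> k; rewrite /names /= !inE; apply/orP/codomP.
    by case=> /eqP->; [exists true|exists false].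
  by case=> -[] ->; rewrite eqxx; [left|right].
- by case; rewrite /shape_of /= ?eqxx // eq_sym (negbTE ij).
Qed.

Lemma one_labelling s t i f g :
  labelling (fun _ : unit => s) t (fun _ => i) (one_diagram s t i f g).
Proof.
split=> //.
- by move=> [] [].
- move=> k; rewrite /names /= !inE; apply/eqP/codomP => [->|[_ ->//]].
  by exists tt.
- by rewrite /shape_of /= eqxx.
Qed.

Lemma unit_labelling n b lab :
  labelling (fun _ : void => (n, b)) (n, b) lab (unit_diagram n b).
Proof. by split=> // k; rewrite /names /= in_nil; apply/esym/negP => /codomP[[]]. Qed.

Local Notation pair_name i j := (fun k : bool => if k then i else j).

Lemma holds_pair n b i j f (t : tangle (fun _ : bool => (n, b)) (n, b)) x y o :
  i != j -> draws (pair_name i j) (pair_diagram n b i j f) t ->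
  env i = element x -> env j = element y ->
  env o = element (act P t (fun k => if k then x else y)) ->
  plane (pair_diagram n b i j f) -> holds env o (pair_diagram n b i j f).
Proof.
move=> ij tf ix jy oE pl.
by apply: (holds_act hP (pair_labelling n b f ij) tf pl _ oE) => -[].
Qed.

Lemma holds_one s s' i f g (t : tangle (fun _ : unit => s) s') x o :
  draws (fun=> i) (one_diagram s s' i f g) t ->
  env i = element x -> env o = element (act P t (fun=> x)) ->
  plane (one_diagram s s' i f g) -> holds env o (one_diagram s s' i f g).
Proof.
move=> tf ix oE pl.
exact: (holds_act hP (one_labelling s s' i f g) tf pl _ oE).
Qed.

Lemma mul_draws n b i j : i != j ->
  draws (pair_name i j) (mul_diagram n b i j) (mult_tangle n b).
Proof.
move=> ij; apply: draws_diagram_of (pair_labelling n b _ ij) _ _ => //.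
move=> -[[[]|] k]; rewrite /code /=.
- by rewrite eqxx; case: ifP.
- by rewrite eq_sym (negbTE ij); case: ifP.
- by [].
Qed.

Lemma conv_draws b i j : i != j ->
  draws (pair_name i j) (conv_diagram b i j) (conv_tangle b).
Proof.
move=> ij; apply: draws_diagram_of (pair_labelling 2 b _ ij) _ _ => //.
move=> -[[[]|] k]; rewrite /code /=.
- by rewrite eqxx; case: k => -[|[|[|[|k]]]] kP.
- by rewrite eq_sym (negbTE ij); case: k => -[|[|[|[|k]]]] kP.
- by [].
Qed.

Lemma identity_draws n b i :
  draws (fun=> i) (identity_diagram n b i) (identity_tangle n b).
Proof.
apply: draws_diagram_of (one_labelling _ _ i _ _) _ _ => // -[[[]|] k].
all: by [].
Qed.

Lemma trace_draws n b i :
  draws (fun=> i) (trace_diagram n b i) (trace_tangle n b).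
Proof.
apply: draws_diagram_of (one_labelling _ _ i _ _) _ _ => // -[[[]|] k].
all: by [].
Qed.

Lemma fourier_draws b i :
  draws (fun=> i) (fourier_diagram b i) (fourier_tangle b).
Proof.
apply: draws_diagram_of (one_labelling _ _ i _ _) _ _ => // -[[[]|] k].
all: by [].
Qed.

Lemma inv_fourier_draws b i :
  draws (fun=> i) (inv_fourier_diagram b i) (inv_fourier_tangle b).
Proof.
apply: draws_diagram_of (one_labelling _ _ i _ _) _ _ => // -[[[]|] k].
all: by [].
Qed.

Lemma half_turn_draws b i :
  draws (fun=> i) (half_turn_diagram b i) (half_turn_tangle b).
Proof.
apply: draws_diagram_of (one_labelling _ _ i _ _) _ _ => // -[[[]|] k].
all: by rewrite /code /=; case: k => -[|[|[|[|k]]]] kP.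
Qed.

Lemma left_cap_draws b i :
  draws (fun=> i) (left_cap_diagram b i) (left_cap_tangle b).
Proof.
apply: draws_diagram_of (one_labelling _ _ i _ _) _ _ => // -[[[]|] k].
  by rewrite /code /=; case: k => -[|[|[|[|k]]]] kP.
by rewrite /code /=; case: k => -[|[|k]] kP //; rewrite inordK.
Qed.

Lemma left_strand_draws b i :
  draws (fun=> i) (left_strand_diagram b i) (left_strand_tangle b).
Proof.
apply: draws_diagram_of (one_labelling _ _ i _ _) _ _ => // -[[[]|] k].
  by rewrite /code /=; case: k => -[|[|k]] kP //; rewrite inordK.
by rewrite /code /=; case: k => -[|[|[|[|k]]]] kP.
Qed.

Lemma holds_mul n b i j (x y : P (n, b)) o : i != j ->
  env i = element x -> env j = element y -> env o = element (bmul x y) ->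
  plane (mul_diagram n b i j) -> holds env o (mul_diagram n b i j).
Proof. by move=> ij; apply: holds_pair (mul_draws n b ij). Qed.

Lemma holds_conv b i j (x y : P (2%N, b)) o : i != j ->
  env i = element x -> env j = element y -> env o = element (convolution x y) ->
  plane (conv_diagram b i j) -> holds env o (conv_diagram b i j).
Proof. by move=> ij; apply: holds_pair (conv_draws b ij). Qed.

Lemma holds_unit n b o : env o = element (bone P n b) ->
  plane (unit_diagram n b) -> holds env o (unit_diagram n b).
Proof.
move=> oE pl; have lP := unit_labelling n b (fun i : void => match i with end).
apply: (holds_act hP lP _ pl _ oE) => [|[]]; apply: draws_diagram_of => //.
by case=> -[[]|] k.
Qed.

Lemma holds_empty b o : env o = element (act P (empty_tangle b) (no_input _)) ->
  plane (unit_diagram 0 b) -> holds env o (unit_diagram 0 b).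
Proof.
move=> oE pl; have lP := unit_labelling 0 b (fun i : void => match i with end).
apply: (holds_act hP lP _ pl _ oE) => [|[]]; apply: draws_diagram_of => //.
by case=> -[[]|] [].
Qed.

Lemma holds_identity n b i (x : P (n, b)) o :
  env i = element x -> env o = element x ->
  plane (identity_diagram n b i) -> holds env o (identity_diagram n b i).
Proof.
move=> ix ox; apply: holds_one (identity_draws n b i) ix _.
by rewrite (act_identity hP).
Qed.

Lemma holds_trace n b i (x : P (n, b)) o :
  env i = element x -> env o = element (act P (trace_tangle n b) (fun=> x)) ->
  plane (trace_diagram n b i) -> holds env o (trace_diagram n b i).
Proof. exact: holds_one (trace_draws n b i). Qed.

Lemma holds_fourier b i (x : P (2%N, b)) o :
  env i = element x -> env o = element (fourier x) ->
  plane (fourier_diagram b i) -> holds env o (fourier_diagram b i).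
Proof. exact: holds_one (fourier_draws b i). Qed.

Lemma holds_inv_fourier b i (x : P (2%N, b)) o :
  env i = element x -> env o = element (inv_fourier x) ->
  plane (inv_fourier_diagram b i) -> holds env o (inv_fourier_diagram b i).
Proof. exact: holds_one (inv_fourier_draws b i). Qed.

Lemma holds_half_turn b i (x : P (2%N, b)) o :
  env i = element x -> env o = element (half_turn x) ->
  plane (half_turn_diagram b i) -> holds env o (half_turn_diagram b i).
Proof. exact: holds_one (half_turn_draws b i). Qed.

Lemma holds_left_cap b i (x : P (2%N, b)) o :
  env i = element x -> env o = element (left_cap x) ->
  plane (left_cap_diagram b i) -> holds env o (left_cap_diagram b i).
Proof. exact: holds_one (left_cap_draws b i). Qed.

Lemma holds_left_strand b i (x : P (1%N, ~~ b)) o :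
  env i = element x -> env o = element (left_strand x) ->
  plane (left_strand_diagram b i) -> holds env o (left_strand_diagram b i).
Proof. exact: holds_one (left_strand_draws b i). Qed.

End Holds.

(** * Identities between 2-boxes *)

(* The diagram of the vector whose squared norm is
   Tr (z^* ((a^* a) * (c^* c)) z), for a, c and z named 0, 1 and 2. *)
Definition schur_diagram b : diagram :=
  diagram_of [:: (0, (2, b)); (1, (2, b)); (2, (2, b))]%N (3, b)%N (fun k =>
    match k.1 with
    | None => nth (None, 0) [:: (Some 0, 0); (Some 0, 1); (Some 1, 0); (Some 1, 1);
                                (Some 2, 2); (Some 2, 3)] k.2
    | Some 0 => nth (None, 0) [:: (None, 0); (None, 1); (Some 1, 3); (Some 2, 0)] k.2
    | Some 1 => nth (None, 0) [:: (None, 2); (None, 3); (Some 2, 1); (Some 0, 2)] k.2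
    | Some _ => nth (None, 0) [:: (Some 0, 3); (Some 1, 2); (None, 4); (None, 5)] k.2
    end)%N.

Section Laws.
Variables (R : realType) (P : planar_data R) (hP : subfactor_planar_algebra P).

Definition env_of (s : seq {s : disc_shape & P s}) (i : nat) : {s : disc_shape & P s} :=
  nth (element (0 : P (0%N, true))) s i.

Lemma same_composite_eq0 env o o' u v prog_u prog_v s (x y : P s) :
  holds env o u -> holds env o' v -> all_hold env prog_u -> all_hold env prog_v ->
  same_composite 0 u v prog_u prog_v ->
  env o = element x -> env o' = element y -> x = y.
Proof.
move=> hu hv hpu hpv c ox oy.
by rewrite (same_composite_eq hP hu hv hpu hpv c ox oy) expr0 scale1r.
Qed.

Definition schur_vector b (a c z : P (2%N, b)) : P (3%N, b) :=
  act P (drawing (fun _ : 'I_3 => (2%N, b)) (3%N, b) val (schur_diagram b))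
    (fun i => nth a [:: a; c; z] i).

Lemma schur_labelling b :
  labelling (fun _ : 'I_3 => (2%N, b)) (3%N, b) val (schur_diagram b).
Proof.
split=> //.
- move=> k; rewrite /names /= !inE; apply/idP/codomP; last first.
    by case=> -[[|[|[|i]]] iP] ->.
  case/or3P => /eqP->; first by exists (@Ordinal 3 0 isT).
    by exists (@Ordinal 3 1 isT).
  by exists (@Ordinal 3 2 isT).
- by case=> -[|[|[|i]]] iP.
Qed.

Lemma holds_schur env b o (a c z : P (2%N, b)) :
  env 0%N = element a -> env 1%N = element c -> env 2%N = element z ->
  env o = element (schur_vector a c z) -> plane (schur_diagram b) ->
  holds env o (schur_diagram b).
Proof.
move=> ea ec ez oE pl; have lP := schur_labelling b.
apply: (holds_act hP lP (drawing_draws lP (plane_wellformed pl)) pl _ oE).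
by case=> -[|[|[|i]]] iP.
Qed.

Local Open Scope nat_scope.

Ltac holds_tac :=
  lazymatch goal with
  | |- holds _ _ (mul_diagram _ _ _ _) => eapply holds_mul
  | |- holds _ _ (conv_diagram _ _ _) => eapply holds_conv
  | |- holds _ _ (half_turn_diagram _ _) => eapply holds_half_turn
  | |- holds _ _ (trace_diagram _ _ _) => eapply holds_trace
  | |- holds _ _ (unit_diagram _ _) => eapply holds_unit
  | |- holds _ _ (identity_diagram _ _ _) => eapply holds_identity
  | |- holds _ _ (fourier_diagram _ _) => eapply holds_fourier
  | |- holds _ _ (inv_fourier_diagram _ _) => eapply holds_inv_fourier
  | |- holds _ _ (left_cap_diagram _ _) => eapply holds_left_cap
  | |- holds _ _ (left_strand_diagram _ _) => eapply holds_left_strand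
  | |- holds _ _ (schur_diagram _) => eapply holds_schur
  end;
  lazymatch goal with
  | |- subfactor_planar_algebra _ => exact: hP
  | |- _ = _ => reflexivity
  | |- _ => vm_compute; reflexivity
  end.

Ltac all_hold_tac := cbn [all_hold]; repeat (split; first by holds_tac); by [].

(* Names are positions in the list [s], which also contains the intermediate boxes; the two programs
   replace the latter by their diagrams before the results are compared. *)
Tactic Notation "by_diagrams" uconstr(s) uconstr(o) uconstr(u) uconstr(prog_u)
    uconstr(o') uconstr(v) uconstr(prog_v) :=
  eapply (@same_composite_eq0 (env_of s) o o' u v prog_u prog_v);
  [ holds_tac | holds_tac | all_hold_tac | all_hold_tac | by vm_compute
  | reflexivity | reflexivity ].

Tactic Notation "reflect_tac" uconstr(o) :=
  eapply (@holds_reflect _ _ hP _ _ o);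
  [ holds_tac | reflexivity
  | move=> i; rewrite /names /= !inE;
    repeat (case/orP; first by move/eqP->); by move/eqP->
  | vm_compute; reflexivity ].

Lemma bmulA b (x y z : P (2, b)) : bmul (bmul x y) z = bmul x (bmul y z).
Proof.
(* The shading is fixed first, so that the diagrams are closed terms and their comparison
   evaluates. *)
case: b x y z => x y z; by_diagrams
  [:: element x; element y; element z; element (bmul x y);
      element (bmul (bmul x y) z); element (bmul y z); element (bmul x (bmul y z))]
  4 (mul_diagram 2 _ 3 2) [:: (3, mul_diagram 2 _ 0 1)]
  6 (mul_diagram 2 _ 0 5) [:: (5, mul_diagram 2 _ 1 2)].
Qed.

(** The bare box on the right-hand side is read through the identity tangle, by [act_identity]. *)
Lemma bmul1l b (x : P (2, b)) : bmul (bone P 2 b) x = x.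
Proof.
case: b x => x; by_diagrams
  [:: element x; element (bone P 2 _); element (bmul (bone P 2 _) x); element x]
  2 (mul_diagram 2 _ 1 0) [:: (1, unit_diagram 2 _)] 3 (identity_diagram 2 _ 0) [::].
Qed.

Lemma bmul1r b (x : P (2, b)) : bmul x (bone P 2 b) = x.
Proof.
case: b x => x; by_diagrams
  [:: element x; element (bone P 2 _); element (bmul x (bone P 2 _)); element x]
  2 (mul_diagram 2 _ 0 1) [:: (1, unit_diagram 2 _)] 3 (identity_diagram 2 _ 0) [::].
Qed.

Lemma bmul_empty b (x : P (0, b)) :
  bmul x (act P (empty_tangle b) (no_input _)) = x.
Proof.
case: b x => x;
  [ pose e := act P (empty_tangle true) (no_input _)
  | pose e := act P (empty_tangle false) (no_input _) ];
  (eapply (@same_composite_eq0 (env_of [:: element x; element e; element (bmul x e); element x])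
     2 3 (mul_diagram 0 _ 0 1) (identity_diagram 0 _ 0) [:: (1, unit_diagram 0 _)] [::]);
   [ holds_tac | holds_tac
   | split=> //; apply: (holds_empty hP); [reflexivity | by vm_compute]
   | by [] | by vm_compute | reflexivity | reflexivity ]).
Qed.

Lemma star_bmul b (x y : P (2, b)) : star (bmul x y) = bmul (star y) (star x).
Proof.
case: b x y => x y;
  (* Reflection with shift 3 sends the names 0 and 1 to 3 and 4, where the adjoints are listed. *)
  (eapply (@same_composite_eq0 (env_of [:: element x; element y; element (bmul x y);
     element (star x); element (star y); element (star (bmul x y));
     element (bmul (star y) (star x))]) 5 6
     (reflect_diagram 3 (mul_diagram 2 _ 0 1)) (mul_diagram 2 _ 4 3) [::] [::]);
   [ reflect_tac 2 | holds_tac | by [] | by [] | by vm_compute | reflexivity | reflexivity ]).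
Qed.

Lemma star_convolution b (x y : P (2, b)) :
  star (convolution x y) = convolution (star x) (star y).
Proof.
case: b x y => x y;
  (eapply (@same_composite_eq0 (env_of [:: element x; element y; element (convolution x y);
     element (star x); element (star y); element (star (convolution x y));
     element (convolution (star x) (star y))]) 5 6
     (reflect_diagram 3 (conv_diagram _ 0 1)) (conv_diagram _ 3 4) [::] [::]);
   [ reflect_tac 2 | holds_tac | by [] | by [] | by vm_compute | reflexivity | reflexivity ]).
Qed.

Lemma star_half_turn b (x : P (2, b)) : star (half_turn x) = half_turn (star x).
Proof.
case: b x => x;
  (eapply (@same_composite_eq0 (env_of [:: element x; element (half_turn x);
     element (star x); element (star (half_turn x)); element (half_turn (star x))]) 3 4
     (reflect_diagram 2 (half_turn_diagram _ 0)) (half_turn_diagram _ 2) [::] [::]);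
   [ reflect_tac 1 | holds_tac | by [] | by [] | by vm_compute | reflexivity | reflexivity ]).
Qed.

Lemma star_inv_fourier b (x : P (2, b)) : star (inv_fourier x) = fourier (star x).
Proof.
case: b x => x;
  (eapply (@same_composite_eq0 (env_of [:: element x; element (inv_fourier x);
     element (star x); element (star (inv_fourier x)); element (fourier (star x))]) 3 4
     (reflect_diagram 2 (inv_fourier_diagram _ 0)) (fourier_diagram _ 2) [::] [::]);
   [ reflect_tac 1 | holds_tac | by [] | by [] | by vm_compute | reflexivity | reflexivity ]).
Qed.

Local Notation trace x := (act P (trace_tangle _ _) (fun=> x)).

Lemma trace_bmulC b (x y : P (2, b)) : trace (bmul x y) = trace (bmul y x).
Proof.
case: b x y => x y; by_diagrams
  [:: element x; element y; element (bmul x y); element (bmul y x);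
      element (trace (bmul x y)); element (trace (bmul y x))]
  4 (trace_diagram 2 _ 2) [:: (2, mul_diagram 2 _ 0 1)]
  5 (trace_diagram 2 _ 3) [:: (3, mul_diagram 2 _ 1 0)].
Qed.

Lemma convolutionA b (x y z : P (2, b)) :
  convolution (convolution x y) z = convolution x (convolution y z).
Proof.
case: b x y z => x y z; by_diagrams
  [:: element x; element y; element z; element (convolution x y);
      element (convolution (convolution x y) z); element (convolution y z);
      element (convolution x (convolution y z))]
  4 (conv_diagram _ 3 2) [:: (3, conv_diagram _ 0 1)]
  6 (conv_diagram _ 0 5) [:: (5, conv_diagram _ 1 2)].
Qed.

Lemma inv_fourier_convolution b (x y : P (2, b)) :
  inv_fourier (convolution x y) = bmul (inv_fourier x) (inv_fourier y).
Proof.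
case: b x y => x y; by_diagrams
  [:: element x; element y; element (convolution x y); element (inv_fourier x);
      element (inv_fourier y); element (inv_fourier (convolution x y));
      element (bmul (inv_fourier x) (inv_fourier y))]
  5 (inv_fourier_diagram _ 2) [:: (2, conv_diagram _ 0 1)]
  6 (mul_diagram 2 _ 3 4) [:: (3, inv_fourier_diagram _ 0); (4, inv_fourier_diagram _ 1)].
Qed.

Lemma inv_fourier_half_turn b (x : P (2, b)) : inv_fourier (half_turn x) = fourier x.
Proof.
case: b x => x; by_diagrams
  [:: element x; element (half_turn x); element (inv_fourier (half_turn x));
      element (fourier x)]
  2 (inv_fourier_diagram _ 1) [:: (1, half_turn_diagram _ 0)]
  3 (fourier_diagram _ 0) [::].
Qed.

Lemma inv_fourier_inj b : injective (@inv_fourier R P b).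
Proof.
suff h (x : P (2, b)) : element (fourier (inv_fourier x)) = element x.
  move=> x y e; apply: (@element_inj R P); by rewrite -!h e.
case: b x => x; congr element; by_diagrams
  [:: element x; element (inv_fourier x); element (fourier (inv_fourier x)); element x]
  2 (fourier_diagram _ 1) [:: (1, inv_fourier_diagram _ 0)]
  3 (identity_diagram 2 _ 0) [::].
Qed.

Lemma half_turnK b : involutive (@half_turn R P b).
Proof.
case: b => x; by_diagrams
  [:: element x; element (half_turn x); element (half_turn (half_turn x)); element x]
  2 (half_turn_diagram _ 1) [:: (1, half_turn_diagram _ 0)]
  3 (identity_diagram 2 _ 0) [::].
Qed.

Lemma half_turn_bmul b (x y : P (2, b)) :
  half_turn (bmul x y) = bmul (half_turn y) (half_turn x).
Proof.
case: b x y => x y; by_diagrams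
  [:: element x; element y; element (bmul x y); element (half_turn x);
      element (half_turn y); element (half_turn (bmul x y));
      element (bmul (half_turn y) (half_turn x))]
  5 (half_turn_diagram _ 2) [:: (2, mul_diagram 2 _ 0 1)]
  6 (mul_diagram 2 _ 4 3) [:: (3, half_turn_diagram _ 0); (4, half_turn_diagram _ 1)].
Qed.

Lemma half_turn_convolution b (x y : P (2, b)) :
  half_turn (convolution x y) = convolution (half_turn y) (half_turn x).
Proof.
case: b x y => x y; by_diagrams
  [:: element x; element y; element (convolution x y); element (half_turn x);
      element (half_turn y); element (half_turn (convolution x y));
      element (convolution (half_turn y) (half_turn x))]
  5 (half_turn_diagram _ 2) [:: (2, conv_diagram _ 0 1)]
  6 (conv_diagram _ 4 3) [:: (3, half_turn_diagram _ 0); (4, half_turn_diagram _ 1)].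
Qed.

Lemma trace_half_turn b (x : P (2, b)) : trace (half_turn x) = trace x.
Proof.
case: b x => x; by_diagrams
  [:: element x; element (half_turn x); element (trace (half_turn x)); element (trace x)]
  2 (trace_diagram 2 _ 1) [:: (1, half_turn_diagram _ 0)]
  3 (trace_diagram 2 _ 0) [::].
Qed.

(** Frobenius reciprocity: in the closed diagram [y] may be regarded as attached to [x] or to [z],
    and seen from [z] it has made a half turn. *)
Lemma trace_convolutionl b (x y z : P (2, b)) :
  trace (bmul (convolution x y) z) = trace (bmul x (convolution z (half_turn y))).
Proof.
case: b x y z => x y z; by_diagrams
  [:: element x; element y; element z; element (convolution x y);
      element (bmul (convolution x y) z); element (trace (bmul (convolution x y) z));
      element (half_turn y); element (convolution z (half_turn y));
      element (bmul x (convolution z (half_turn y)));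
      element (trace (bmul x (convolution z (half_turn y))))]
  5 (trace_diagram 2 _ 4) [:: (4, mul_diagram 2 _ 3 2); (3, conv_diagram _ 0 1)]
  9 (trace_diagram 2 _ 8)
  [:: (8, mul_diagram 2 _ 0 7); (7, conv_diagram _ 2 6); (6, half_turn_diagram _ 1)].
Qed.

Lemma trace_convolutionr b (x y z : P (2, b)) :
  trace (bmul (convolution x y) z) = trace (bmul y (convolution (half_turn x) z)).
Proof.
case: b x y z => x y z; by_diagrams
  [:: element x; element y; element z; element (convolution x y);
      element (bmul (convolution x y) z); element (trace (bmul (convolution x y) z));
      element (half_turn x); element (convolution (half_turn x) z);
      element (bmul y (convolution (half_turn x) z));
      element (trace (bmul y (convolution (half_turn x) z)))]
  5 (trace_diagram 2 _ 4) [:: (4, mul_diagram 2 _ 3 2); (3, conv_diagram _ 0 1)]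
  9 (trace_diagram 2 _ 8)
  [:: (8, mul_diagram 2 _ 1 7); (7, conv_diagram _ 6 2); (6, half_turn_diagram _ 0)].
Qed.

(** The right string of the unit closes up the left side of [x] and its left string stays. The value
    factors through a 1-box space, where irreducibility can act. *)
Lemma convolution_bone b (x : P (2, b)) :
  convolution (bone P 2 b) x = left_strand (left_cap x).
Proof.
case: b x => x; by_diagrams
  [:: element x; element (bone P 2 _); element (convolution (bone P 2 _) x);
      element (left_cap x); element (left_strand (left_cap x))]
  2 (conv_diagram _ 1 0) [:: (1, unit_diagram 2 _)]
  4 (left_strand_diagram _ 3) [:: (3, left_cap_diagram _ 0)].
Qed.

Lemma left_strand_bone b : left_strand (bone P 1 (~~ b)) = bone P 2 b.
Proof.
case: b; [by_diagrams
  [:: element (bone P 1 (~~ true)); element (@left_strand R P true (bone P 1 (~~ true)));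
      element (bone P 2 true)]
  1 (left_strand_diagram true 0) [:: (0, unit_diagram 1 (~~ true))] 2 (unit_diagram 2 true) [::] |
  by_diagrams
  [:: element (bone P 1 (~~ false)); element (@left_strand R P false (bone P 1 (~~ false)));
      element (bone P 2 false)]
  1 (left_strand_diagram false 0) [:: (0, unit_diagram 1 (~~ false))] 2 (unit_diagram 2 false) [::]].
Qed.

(** The Schur product theorem in planar form: a curve separating [a], [c], [z] from their adjoints
    crosses six strings, and the two halves are a 3-box and its reflection. *)
Lemma trace_schur b (a c z : P (2, b)) :
  trace (bmul (star z) (bmul (convolution (bmul (star a) a) (bmul (star c) c)) z))
  = trace (bmul (star (schur_vector a c z)) (schur_vector a c z)).
Proof.
pose v := schur_vector a c z; pose w := convolution (bmul (star a) a) (bmul (star c) c).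
rewrite -/v -/w; case: b a c z @v @w => a c z v w;
  (eapply (@same_composite_eq0 (env_of [:: element a; element c; element z; element v;
     element (star a); element (star c); element (star z); element (star v);
     element (bmul (star v) v); element (trace (bmul (star v) v));
     element (bmul (star a) a); element (bmul (star c) c); element w;
     element (bmul w z); element (bmul (star z) (bmul w z));
     element (trace (bmul (star z) (bmul w z)))]) 15 9
     (trace_diagram 2 _ 14) (trace_diagram 3 _ 8)
     [:: (14, mul_diagram 2 _ 6 13); (13, mul_diagram 2 _ 12 2); (12, conv_diagram _ 10 11);
         (10, mul_diagram 2 _ 4 0); (11, mul_diagram 2 _ 5 1)]
     [:: (8, mul_diagram 3 _ 7 3); (7, reflect_diagram 4 (schur_diagram _));
         (3, schur_diagram _)]);
   [ holds_tac | holds_tac | all_hold_tac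
   | cbn [all_hold]; split; [holds_tac | split; [reflect_tac 3 | all_hold_tac]]
   | by vm_compute | reflexivity | reflexivity ]).
Qed.

Lemma trace_convolution_bone b (x : P (2, b)) :
  trace (convolution (bone P 2 b) x) = ((delta P)%:C%C *: trace x)%R.
Proof.
(* One closed string: the left string of the unit, closed up by the trace. *)
rewrite -[((delta P)%:C%C)]expr1; case: b x => x;
  (eapply (@same_composite_eq _ _ hP (env_of [:: element x; element (bone P 2 _);
      element (convolution (bone P 2 _) x);
      element (trace (convolution (bone P 2 _) x)); element (trace x)]) 3 4 1
    (trace_diagram 2 _ 2) (trace_diagram 2 _ 0)
    [:: (2, conv_diagram _ 1 0); (1, unit_diagram 2 _)] [::])%N;
  [ holds_tac | holds_tac | all_hold_tac | all_hold_tac | by vm_compute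
  | reflexivity | reflexivity ]).
Qed.

Lemma trace_bone b : trace (bone P 2 b) = ((delta P)%:C%C ^+ 2 *: act P (empty_tangle b) (no_input _))%R.
Proof.
case: b; [
  (pose e := act P (empty_tangle true) (no_input _); rewrite -/e;
   eapply (@same_composite_eq _ _ hP (env_of [:: element (bone P 2 true);
      element (trace (bone P 2 true)); element e]) 1 2 2
    (trace_diagram 2 true 0) (unit_diagram 0 true) [:: (0, unit_diagram 2 true)] [::])%N;
  [ holds_tac | apply: (holds_empty hP); [reflexivity | by vm_compute]
  | all_hold_tac | all_hold_tac | by vm_compute | reflexivity | reflexivity ])
| (pose e := act P (empty_tangle false) (no_input _); rewrite -/e;
   eapply (@same_composite_eq _ _ hP (env_of [:: element (bone P 2 false);
      element (trace (bone P 2 false)); element e]) 1 2 2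
    (trace_diagram 2 false 0) (unit_diagram 0 false) [:: (0, unit_diagram 2 false)] [::])%N;
  [ holds_tac | apply: (holds_empty hP); [reflexivity | by vm_compute]
  | all_hold_tac | all_hold_tac | by vm_compute | reflexivity | reflexivity ]) ].
Qed.

End Laws.

(** * Scalars, linearity and the trace *)

Section Scalars.
Variables (R : realType) (P : planar_data R) (hP : subfactor_planar_algebra P).

Local Notation trace x := (act P (trace_tangle _ _) (fun=> x)).
Local Notation empty b := (act P (empty_tangle b) (no_input _)).
Local Notation loop := ((delta P)%:C%C).

Lemma act_linear1 s s' (t : tangle (fun _ : unit => s) s') a (u v : P s) :
  planar t ->
  act P t (fun=> a *: u + v) = a *: act P t (fun=> u) + act P t (fun=> v).
Proof.
move=> pt; have E w : @dfwith _ (fun _ : unit => P s) (fun=> u) tt w = fun=> w.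
  by apply/funext => -[]; rewrite dfwithin.
by have := act_multilinear hP (fun=> u) (i := tt) a u v pt; rewrite !E.
Qed.

Lemma act_linear2 s s' (t : tangle (fun _ : bool => s) s') a (u v w : P s) :
  planar t ->
  act P t (fun k => if k then a *: u + v else w) =
    a *: act P t (fun k => if k then u else w) + act P t (fun k => if k then v else w) /\
  act P t (fun k => if k then w else a *: u + v) =
    a *: act P t (fun k => if k then w else u) + act P t (fun k => if k then w else v).
Proof.
move=> pt; split.
- have E z : @dfwith _ (fun _ : bool => P s) (fun=> w) true z =
      fun k => if k then z else w.
    by apply/funext => -[]; rewrite ?dfwithin // dfwithout.
  by have := act_multilinear hP (fun=> w) (i := true) a u v pt; rewrite !E.
- have E z : @dfwith _ (fun _ : bool => P s) (fun=> w) false z =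
      fun k => if k then w else z.
    by apply/funext => -[]; rewrite ?dfwithin // dfwithout.
  by have := act_multilinear hP (fun=> w) (i := false) a u v pt; rewrite !E.
Qed.

Lemma mul_planar n b : plane (mul_diagram n b 0 1) -> planar (mult_tangle n b).
Proof.
move=> pl; have ij : 0%N != 1%N by [].
by have := plane_planar (pair_labelling n b _ ij) pl (mul_draws n b ij).
Qed.

Lemma mul2_planar b : planar (mult_tangle 2 b).
Proof. by apply: mul_planar; case: b; vm_compute. Qed.

Lemma mul3_planar b : planar (mult_tangle 3 b).
Proof. by apply: mul_planar; case: b; vm_compute. Qed.

Lemma mul0_planar b : planar (mult_tangle 0 b).
Proof. by apply: mul_planar; case: b; vm_compute. Qed.

Lemma conv_planar b : planar (conv_tangle b).
Proof.
have ij : 0%N != 1%N by [].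
have pl : plane (conv_diagram b 0 1) by case: b; vm_compute.
by have := plane_planar (pair_labelling 2 b _ ij) pl (conv_draws b ij).
Qed.

Lemma one_planar s s' i f g (t : tangle (fun _ : unit => s) s') :
  plane (one_diagram s s' i f g) -> draws (fun=> i) (one_diagram s s' i f g) t ->
  planar t.
Proof. by move=> pl tf; have := plane_planar (one_labelling s s' i f g) pl tf. Qed.

Lemma trace2_planar b : planar (trace_tangle 2 b).
Proof. by apply: one_planar (trace_draws 2 b 0); case: b; vm_compute. Qed.

Lemma inv_fourier_planar b : planar (inv_fourier_tangle b).
Proof. by apply: one_planar (inv_fourier_draws b 0); case: b; vm_compute. Qed.

Lemma half_turn_planar b : planar (half_turn_tangle b).
Proof. by apply: one_planar (half_turn_draws b 0); case: b; vm_compute. Qed.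

Lemma left_strand_planar b : planar (left_strand_tangle b).
Proof. by apply: one_planar (left_strand_draws b 0); case: b; vm_compute. Qed.

Lemma vect_neq0 (K : fieldType) (V : vectType K) :
  dim V = 1%N -> exists x : V, x != 0.
Proof. by move=> d1; exists (vpick {:V}); rewrite vpick0 -dimv_eq0 dimvf d1. Qed.

Lemma vect_line (K : fieldType) (V : vectType K) (x y : V) :
  dim V = 1%N -> x != 0 -> exists c, y = c *: x.
Proof.
move=> d1 x0; apply/vlineP; have -> : <[x]>%VS = {:V}%VS; last exact: memvf.
by apply/eqP; rewrite eqEdim subvf dimvf d1 dim_vline x0.
Qed.

(** The empty diagram is a right unit for 0-boxes, so its vanishing would kill a nonzero 0-box. *)
Lemma empty_neq0 b : empty b != 0.
Proof.
have [x x0] := vect_neq0 (box0_dim hP b).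
apply: contra x0 => /eqP e0; rewrite -(bmul_empty hP x) e0.
have := (act_linear2 1 0 0 x (mul0_planar b)).2.
by rewrite scale1r addr0 scale1r => /eqP; rewrite -subr_eq subrr eq_sym.
Qed.

Lemma scalar_ofZ b c : scalar_of (c *: empty b) = c.
Proof.
apply: (xget_unique _ (P := [set d | c *: empty b = d *: empty b]%classic)) => //= d.
by move/eqP; rewrite -subr_eq0 -scalerBl scaler_eq0 (negbTE (empty_neq0 b)) orbF subr_eq0 => /eqP.
Qed.

Lemma scalar_ofK b (v : P (0%N, b)) : v = scalar_of v *: empty b.
Proof.
have [c ->] := vect_line v (box0_dim hP b) (empty_neq0 b).
by rewrite scalar_ofZ.
Qed.

Lemma scalar_of_linear b a (v w : P (0%N, b)) :
  scalar_of (a *: v + w) = a * scalar_of v + scalar_of w.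
Proof. by rewrite [in LHS](scalar_ofK v) [in LHS](scalar_ofK w) scalerA -scalerDl scalar_ofZ. Qed.

Lemma scalar_of0 b : scalar_of (0 : P (0%N, b)) = 0.
Proof. by rewrite -(scale0r (empty b)) scalar_ofZ. Qed.

Variable b : bool.
Implicit Types x y z : P (2%N, b).

Lemma bmul_linearl a x y z : bmul (a *: x + y) z = a *: bmul x z + bmul y z.
Proof. exact: (act_linear2 a x y z (mul2_planar b)).1. Qed.

Lemma bmul_linearr a x y z : bmul z (a *: x + y) = a *: bmul z x + bmul z y.
Proof. exact: (act_linear2 a x y z (mul2_planar b)).2. Qed.

Lemma convolution_linearl a x y z :
  convolution (a *: x + y) z = a *: convolution x z + convolution y z.
Proof. exact: (act_linear2 a x y z (conv_planar b)).1. Qed.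

Lemma convolution_linearr a x y z :
  convolution z (a *: x + y) = a *: convolution z x + convolution z y.
Proof. exact: (act_linear2 a x y z (conv_planar b)).2. Qed.

Lemma half_turn_linear a x y :
  half_turn (a *: x + y) = a *: half_turn x + half_turn y.
Proof. exact: act_linear1 (half_turn_planar b). Qed.

Lemma inv_fourier_linear a x y :
  inv_fourier (a *: x + y) = a *: inv_fourier x + inv_fourier y.
Proof. exact: act_linear1 (inv_fourier_planar b). Qed.

Lemma Tr_linear a x y : Tr (a *: x + y) = a * Tr x + Tr y.
Proof. by rewrite /Tr (act_linear1 a x y (trace2_planar b)) scalar_of_linear. Qed.

Lemma TrC x y : Tr (bmul x y) = Tr (bmul y x).
Proof. by rewrite /Tr (trace_bmulC hP). Qed.

Lemma Tr_half_turn x : Tr (half_turn x) = Tr x.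
Proof. by rewrite /Tr (trace_half_turn hP). Qed.

Lemma Tr_convolutionl x y z :
  Tr (bmul (convolution x y) z) = Tr (bmul x (convolution z (half_turn y))).
Proof. by rewrite /Tr (trace_convolutionl hP). Qed.

Lemma Tr_convolutionr x y z :
  Tr (bmul (convolution x y) z) = Tr (bmul y (convolution (half_turn x) z)).
Proof. by rewrite /Tr (trace_convolutionr hP). Qed.

Lemma Tr_bone : Tr (bone P 2 b) = loop ^+ 2.
Proof. by rewrite /Tr (trace_bone hP) scalar_ofZ. Qed.

Lemma loop_gt0 : 0 < loop. Proof. by rewrite ltcR (delta_gt0 hP). Qed.

Lemma Tr0 : Tr (0 : P (2%N, b)) = 0.
Proof.
have := Tr_linear 1 0 0; rewrite scaler0 addr0 mul1r => /eqP.
by rewrite -subr_eq subrr eq_sym => /eqP.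
Qed.

Lemma bone_neq0 : bone P 2 b != 0.
Proof.
apply/eqP => b0; have := Tr_bone; rewrite b0 Tr0 => /esym/eqP.
by rewrite expf_eq0 /= gt_eqF // loop_gt0.
Qed.

Lemma Tr_schur_ge0 (a c z : P (2%N, b)) :
  0 <= Tr (bmul (star z) (bmul (convolution (bmul (star a) a) (bmul (star c) c)) z)).
Proof.
rewrite /Tr (trace_schur hP) -/(Tr _).
set v := schur_vector a c z.
have [->|] := eqVneq v 0; last by move/(Tr_positive hP)/ltW.
have -> : bmul (star 0) 0 = 0 :> P (3%N, b).
  have := (act_linear2 1 0 0 (star 0) (mul3_planar b)).2.
  by rewrite scale1r addr0 scale1r => /eqP; rewrite -subr_eq subrr eq_sym => /eqP.
rewrite /Tr (_ : act _ _ _ = 0) ?scalar_of0 //.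
have pt : planar (trace_tangle 3 b).
  by apply: one_planar (trace_draws 3 b 0); case: b; vm_compute.
have := act_linear1 1 0 0 pt.
by rewrite scale1r addr0 scale1r => /eqP; rewrite -subr_eq subrr eq_sym => /eqP.
Qed.

Hypothesis hirr : irreducible P.

(** By irreducibility the capped box is a multiple of the unit 1-box. The constant comes from
    traces: [loop * Tr x] on one side, [loop ^+ 2] for the unit on the other. *)
Lemma convolution_bonel x :
  convolution (bone P 2 b) x = (Tr x / loop) *: bone P 2 b.
Proof.
have l0 : loop != 0 by rewrite gt_eqF // loop_gt0.
have lin := left_strand_planar b.
have ls0 : left_strand (0 : P (1%N, ~~ b)) = 0.
  have := act_linear1 1 0 0 lin.
  by rewrite scale1r addr0 scale1r => /eqP; rewrite -subr_eq subrr eq_sym => /eqP.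
have b1 : bone P 1 (~~ b) != 0.
  apply: contra bone_neq0 => /eqP b1; by rewrite -(left_strand_bone hP) b1 ls0.
have [c cE] := vect_line (left_cap x) (hirr (~~ b)) b1.
have xE : convolution (bone P 2 b) x = c *: bone P 2 b.
  rewrite (convolution_bone hP) cE -(left_strand_bone hP).
  have := act_linear1 c (bone P 1 (~~ b)) 0 lin.
  by rewrite -!/(left_strand _) ls0 !addr0.
have : Tr (convolution (bone P 2 b) x) = loop * Tr x.
  rewrite {1}/Tr (trace_convolution_bone hP) -[_ *: _]addr0 scalar_of_linear scalar_of0.
  by rewrite addr0.
rewrite xE -[c *: _]addr0 Tr_linear Tr0 Tr_bone !addr0 => e.
by congr (_ *: _); apply: (mulIf (expf_neq0 2 l0)); rewrite e; field.
Qed.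

Lemma convolution_boner x :
  convolution x (bone P 2 b) = (Tr x / loop) *: bone P 2 b.
Proof.
(* An involutive anti-automorphism fixes the unit. *)
have h1 : half_turn (bone P 2 b) = bone P 2 b.
  by rewrite -[LHS](bmul1l hP) -{1}[bone P 2 b](half_turnK hP) -(half_turn_bmul hP)
       (bmul1l hP) (half_turnK hP).
rewrite -[LHS](half_turnK hP) (half_turn_convolution hP) h1 convolution_bonel.
rewrite Tr_half_turn -[_ *: bone _ _ _ in LHS]addr0 half_turn_linear h1.
have -> : half_turn 0 = 0 :> P (2%N, b); last by rewrite addr0.
have := half_turn_linear 1 0 0.
by rewrite scale1r addr0 scale1r => /eqP; rewrite -subr_eq subrr eq_sym => /eqP.
Qed.

End Scalars.

(** * Entropy and mixing *)

Section RealEntropy.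
Variable R : realType.

Definition eta (t : R) : R := - (t * ln t).

(* The difference of both sides is the sum of
   w i j * (m j - l i - l i * ln (m j) + l i * ln (l i)). *)
Lemma entropy_mixing (I J : finType) (l : I -> R) (m : J -> R) (w : I -> J -> R) :
  (forall i j, 0 <= w i j) -> (forall i, 0 <= l i) ->
  (forall j, \sum_i l i * w i j = m j * \sum_i w i j) ->
  \sum_i eta (l i) * (\sum_j w i j) <= \sum_j eta (m j) * (\sum_i w i j) /\
  (\sum_i eta (l i) * (\sum_j w i j) = \sum_j eta (m j) * (\sum_i w i j) ->
   forall i j, w i j = 0 \/ l i = m j).
Proof.
move=> w0 l0 wm.
pose D i j := m j - l i - l i * ln (m j) + l i * ln (l i).
have D0 i j : 0 <= w i j * D i j /\ (w i j * D i j = 0 -> w i j = 0 \/ l i = m j).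
  have [->|wn0] := eqVneq (w i j) 0; first by rewrite mul0r; split=> // _; left.
  have wp : 0 < w i j by rewrite lt_neqAle eq_sym wn0 w0.
  have W0 : 0 < \sum_i w i j.
    by rewrite (bigD1 i) //= ltr_pwDl // sumr_ge0.
  have lw : l i * w i j <= m j * \sum_i w i j.
    by rewrite -wm (bigD1 i) //= lerDl sumr_ge0 // => k _; rewrite mulr_ge0.
  have m0 : 0 <= m j.
    by rewrite -(pmulr_lge0 _ W0); apply: le_trans lw; rewrite mulr_ge0.
  suff : 0 <= D i j /\ (D i j = 0 -> l i = m j).
    case=> d1 d2; split; first by rewrite mulr_ge0.
    by move=> /eqP; rewrite mulf_eq0 (negbTE wn0) /= => /eqP/d2; right.
  rewrite /D; have [mj0|mjn0] := eqVneq (m j) 0.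
    have -> : l i = 0.
      apply/eqP; rewrite eq_le l0 andbT -(pmulr_lle0 _ wp).
      by apply: le_trans lw _; rewrite mj0 mul0r.
    by rewrite mj0 !(mul0r, subr0, addr0).
  have mp : 0 < m j by rewrite lt_neqAle eq_sym mjn0.
  have [li0|lin0] := eqVneq (l i) 0.
    by rewrite li0 !(mul0r, subr0, addr0).
  have lp : 0 < l i by rewrite lt_neqAle eq_sym lin0 l0.
  (* With [s = ln (m j / l i)] this is [l i * (exp s - 1 - s)]: positivity and the equality case are
     those of the tangent to [exp] at 0. *)
  have E : m j - l i - l i * ln (m j) + l i * ln (l i) =
      l i * (expR (ln (m j / l i)) - (1 + ln (m j / l i))).
    by rewrite lnK ?posrE ?divr_gt0 // ln_div ?posrE //; field.
  rewrite E; split; first by rewrite mulr_ge0 // subr_ge0 expR_ge1Dx.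
  move/eqP; rewrite mulf_eq0 gt_eqF //= subr_eq0.
  have [s0|s0] := eqVneq (ln (m j / l i)) 0; last first.
    by have := expR_gt1Dx s0; case: ltgtP.
  move=> _; have := lnK (x := m j / l i); rewrite posrE divr_gt0 // => /(_ isT).
  by rewrite s0 expR0 => e; rewrite -[LHS]mul1r e divfK.
have key : \sum_j eta (m j) * (\sum_i w i j) - \sum_i eta (l i) * (\sum_j w i j) =
    \sum_i \sum_j w i j * D i j.
  have -> : \sum_j eta (m j) * (\sum_i w i j) =
      \sum_j (m j * (\sum_i w i j) - \sum_i l i * w i j
              - ln (m j) * \sum_i l i * w i j).
    by apply: eq_bigr => j _; rewrite wm /eta; ring.
  have -> : \sum_i eta (l i) * (\sum_j w i j) =
      \sum_i \sum_j - (l i * ln (l i) * w i j).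
    by apply: eq_bigr => i _; rewrite mulr_sumr; apply: eq_bigr => j _; rewrite /eta; ring.
  rewrite -sumrN [in RHS]exchange_big /=.
  under [X in _ + X]eq_bigr do rewrite -sumrN.
  rewrite [X in _ + X]exchange_big -big_split /=; apply: eq_bigr => j _.
  rewrite !mulr_sumr -!sumrB -big_split /=; apply: eq_bigr => i _.
  by rewrite /D; ring.
split.
  rewrite -subr_ge0 key; apply: sumr_ge0 => i _; apply: sumr_ge0 => j _.
  exact: (D0 i j).1.
move=> e i j; have := key; rewrite e subrr => /esym/eqP.
rewrite psumr_eq0 => [/allP/(_ i)|k _]; last by apply: sumr_ge0 => n _; case: (D0 k n).
rewrite mem_index_enum => /(_ isT)/implyP/(_ isT).
rewrite psumr_eq0 => [/allP/(_ j)|n _]; last by case: (D0 i n).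
rewrite mem_index_enum => /(_ isT)/implyP/(_ isT)/eqP.
by case: (D0 i j).
Qed.

End RealEntropy.

(** * Finite-dimensional tracial star algebras *)

Section SpectralTheorem.
Variables (R : realType) (A : falgType R[i]) (star : A -> A) (tr : A -> R[i]).

Record tracial_algebra : Prop := {
  adj_semilinear : forall a x y, star (a *: x + y) = a^*%C *: star x + star y;
  adjK : involutive star;
  adjM : forall x y, star (x * y) = star y * star x;
  tr_linear : forall a x y, tr (a *: x + y) = a * tr x + tr y;
  trC : forall x y, tr (x * y) = tr (y * x);
  tr_pos : forall x, x != 0 -> 0 < tr (star x * x)
}.

Hypothesis hA : tracial_algebra.

Definition is_proj (p : A) : Prop := p * p = p /\ star p = p.
Definition is_pos (x : A) : Prop := exists a, x = star a * a.

Lemma tr0 : tr 0 = 0.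
Proof.
have := tr_linear hA 1 0 0; rewrite scaler0 addr0 mul1r => /eqP.
by rewrite -subr_eq subrr eq_sym => /eqP.
Qed.

Lemma trZ a x : tr (a *: x) = a * tr x.
Proof. by rewrite -[a *: x]addr0 (tr_linear hA) tr0 addr0. Qed.

Lemma trD x y : tr (x + y) = tr x + tr y.
Proof. by rewrite -[x]scale1r (tr_linear hA) scale1r mul1r. Qed.

Lemma trB x y : tr (x - y) = tr x - tr y.
Proof. by rewrite trD -scaleN1r trZ mulN1r. Qed.

Lemma tr_sum (I : Type) (r : seq I) (Q : pred I) (F : I -> A) :
  tr (\sum_(i <- r | Q i) F i) = \sum_(i <- r | Q i) tr (F i).
Proof. by apply: (big_morph tr trD tr0). Qed.

Lemma adj0 : star 0 = 0.
Proof.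
have := adj_semilinear hA 1 0 0.
rewrite scaler0 addr0 rmorph1 scale1r => /eqP.
by rewrite -subr_eq subrr eq_sym => /eqP.
Qed.

Lemma adjZ a x : star (a *: x) = a^*%C *: star x.
Proof. by rewrite -[a *: x]addr0 (adj_semilinear hA) adj0 addr0. Qed.

Lemma adjD x y : star (x + y) = star x + star y.
Proof. by rewrite -[x]scale1r (adj_semilinear hA) rmorph1 !scale1r. Qed.

Lemma adjB x y : star (x - y) = star x - star y.
Proof. by rewrite adjD -scaleN1r adjZ rmorphN rmorph1 scaleN1r. Qed.

Lemma adj_sum (I : Type) (r : seq I) (Q : pred I) (F : I -> A) :
  star (\sum_(i <- r | Q i) F i) = \sum_(i <- r | Q i) star (F i).
Proof. by apply: (big_morph star adjD adj0). Qed.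

Lemma adj1 : star 1 = 1.
Proof. by have := adjM hA (star 1) 1; rewrite mulr1 (adjK hA) mulr1 => <-. Qed.

Lemma adj_mul_eq0 x : star x * x = 0 -> x = 0.
Proof.
by move=> e; apply/eqP/negP => /negP /(tr_pos hA); rewrite e tr0 ltxx.
Qed.

Lemma tr_ge0 x : is_pos x -> 0 <= tr x.
Proof.
case=> a ->; have [->|/(tr_pos hA)/ltW//] := eqVneq a 0.
by rewrite mulr0 tr0.
Qed.

Lemma pos_adj x : is_pos x -> star x = x.
Proof. by case=> a ->; rewrite (adjM hA) (adjK hA). Qed.

Lemma proj_pos p : is_proj p -> is_pos p.
Proof. by case=> pp ps; exists p; rewrite ps pp. Qed.

Lemma projC p : is_proj p -> is_proj (1 - p).
Proof.
case=> pp ps; split; last by rewrite adjB adj1 ps.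
by rewrite mulrBl mul1r mulrBr mulr1 pp subrr subr0.
Qed.

Lemma tr_mul_ge0 x y : is_pos x -> is_pos y -> 0 <= tr (x * y).
Proof.
case=> a -> [c ->]; rewrite -mulrA (trC hA).
have -> : a * (star c * c) * star a = star (c * star a) * (c * star a).
  by rewrite (adjM hA) (adjK hA) !mulrA.
by apply: tr_ge0; exists (c * star a).
Qed.

(* With x = a^* a and y = c^* c, the trace is the squared norm of c a^*. *)
Lemma tr_mul_eq0 x y : is_pos x -> is_pos y -> tr (x * y) = 0 ->
  x * y = 0 /\ y * x = 0.
Proof.
move=> px py t0.
suff yx : y * x = 0 by split=> //; rewrite -(pos_adj px) -(pos_adj py) -(adjM hA) yx adj0.
case: px py t0 => a -> [c ->]; rewrite -mulrA (trC hA) => t0.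
have c0 : c * star a = 0.
  apply/eqP/negP => /negP /(tr_pos hA); rewrite (adjM hA) (adjK hA).
  by move: t0; rewrite !mulrA => ->; rewrite ltxx.
by rewrite -mulrA (mulrA c) c0 mul0r mulr0.
Qed.

Lemma tr_gt0_proj p : is_proj p -> p != 0 -> 0 < tr p.
Proof. by case=> pp ps /(tr_pos hA); rewrite ps pp. Qed.

Lemma real_scalar (a : R[i]) : 0 <= a -> a^*%C = a.
Proof. by case: a => a b; rewrite lecE /= => /andP[/eqP -> _]; rewrite oppr0. Qed.

(* A positive element whose expectation on a projection vanishes is zero there;
   apply this to t - s on p and to s on 1 - p. *)
Lemma pos_eq_scaled_proj s p (t : R[i]) : is_proj p -> is_pos s ->
  is_pos (t%:A - s) -> tr (p * s) = t * tr p -> tr s = t * tr p -> s = t *: p.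
Proof.
move=> hp ps pts tps ts.
have e1 : p * (t%:A - s) = 0.
  apply: (tr_mul_eq0 (proj_pos hp) pts _).1.
  by rewrite mulrBr trB tps -scalerAr mulr1 trZ subrr.
have e2 : (1 - p) * s = 0.
  apply: (tr_mul_eq0 (proj_pos (projC hp)) ps _).1.
  by rewrite mulrBl mul1r trB tps ts subrr.
have -> : s = p * s by apply/eqP; rewrite -subr_eq0 -{1}[s]mul1r -mulrBl e2.
by apply/eqP; rewrite eq_sym -subr_eq0 -[X in t *: X - _]mulr1 scalerAr -mulrBr e1.
Qed.

Lemma pos_proportional_proj s t : t != 0 -> t^*%C = t -> is_pos s ->
  s * s = t *: s -> is_proj (t^-1 *: s).
Proof.
move=> t0 tc ps ss; split.
  by rewrite -scalerAl -scalerAr ss [t^-1 *: (t *: s)]scalerA mulVf // scale1r.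
by rewrite adjZ pos_adj // fmorphV /= tc.
Qed.

Section SelfAdjoint.
Variable x : A.
Hypothesis xs : star x = x.

Local Notation h := (horner_alg x).

Lemma annihilating_poly : exists2 q : {poly R[i]}, q != 0 & h q = 0.
Proof.
pose n := dim A; pose X := [tuple x ^+ i | i < n.+1].
have : ~~ free X.
  rewrite /free size_tuple neq_ltn ltnS.
  by rewrite (leq_trans (dimvS (subvf _))) // dimvf.
move=> /freeP/existsNP[k /not_implyP[k0 /existsNP[i ki]]].
exists (\poly_(j < n.+1) k (inord j)).
  apply/eqP => /polyP/(_ i); rewrite coef_poly ltn_ord inord_val coef0.
  exact: ki.
rewrite poly_def linear_sum -[RHS]k0; apply: eq_bigr => j _.
by rewrite -tnth_nth tnth_mktuple linearZ /= rmorphXn /= horner_algX inord_val mulr_algl.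
Qed.

Lemma horner_alg_eigen q a l : x * a = l *: a -> h q * a = q.[l] *: a.
Proof.
move=> xa; elim/poly_ind: q => [|q c IH]; first by rewrite rmorph0 mul0r horner0 scale0r.
rewrite rmorphD rmorphM /= horner_algX horner_algC hornerMXaddC mulrDl -mulrA xa.
by rewrite -scalerAr IH scalerA mulr_algl -scalerDl [l * _]mulrC.
Qed.

Definition eigenvalue_of (l : R[i]) : Prop := exists2 a, a != 0 & x * a = l *: a.

Lemma eigenvalue_real l : eigenvalue_of l -> exists r : R, l = r%:C%C.
Proof.
case=> a a0 xa; have ta := tr_pos hA a0.
have e : l * tr (star a * a) = l^*%C * tr (star a * a).
  rewrite -!trZ scalerAr -xa; congr tr.
  by rewrite mulrA -{1}xs -(adjM hA) xa adjZ -scalerAl.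
have /mulIf/(_ _ _ e) : tr (star a * a) != 0 by rewrite gt_eqF.
case: l {xa e} => r s /= [/eqP]; rewrite -subr_eq0 opprK -mulr2n mulrn_eq0 /= => /eqP ->.
by exists r.
Qed.

(** For real [r] the factor is self-adjoint, and [star z * z = 0] forces [z = 0]. This removes
    repeated roots. *)
Lemma cancel_square (r : R) a : (x - r%:C%C%:A) * ((x - r%:C%C%:A) * a) = 0 ->
  (x - r%:C%C%:A) * a = 0.
Proof.
move=> e; apply: adj_mul_eq0; rewrite (adjM hA) -mulrA.
have -> : star (x - r%:C%C%:A) = x - r%:C%C%:A by rewrite adjB adjZ adj1 xs conjc_real.
by rewrite e mulr0.
Qed.

Local Notation linears s := (\prod_(l <- s) ('X - (l%:C%C)%:P)).

(** A root that is not an eigenvalue gives a left-cancellable factor, and a repeated one is dropped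
    by [cancel_square]. The statement quantifies over [a] because a factor is cancelled against what
    the others leave of [a], not among polynomials. *)
Lemma reduce_roots (rs : seq R[i]) : exists s : seq R,
  [/\ uniq s, forall l, l \in s -> eigenvalue_of l%:C%C
    & forall a, h (\prod_(z <- rs) ('X - z%:P)) * a = 0 -> h (linears s) * a = 0].
Proof.
have hX c : h ('X - c%:P) = x - c%:A by rewrite rmorphB /= horner_algX horner_algC.
have hC p q : h p * h q = h q * h p by rewrite -!rmorphM mulrC.
elim: rs => [|z rs [s [us es hs]]]; first by exists [::]; split=> // a; rewrite !big_nil.
have [ez|nez] := pselect (eigenvalue_of z); last first.
  exists s; split=> // a; rewrite big_cons rmorphM hC -mulrA => /hs.
  rewrite mulrA hC -mulrA hX => e; apply: contrapT => /eqP b0; apply: nez.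
  exists (h (linears s) * a) => //; apply/eqP.
  by rewrite -subr_eq0 -[z *: _]mulr_algl -mulrBl e.
have [r rE] := eigenvalue_real ez; have [rs_|rs_] := boolP (r \in s); last first.
  exists (r :: s); split=> /=; first by rewrite rs_.
    by move=> l; rewrite inE => /orP[/eqP->|/es//]; rewrite -rE.
  move=> a; rewrite big_cons rmorphM hC -mulrA => /hs.
  by rewrite big_cons rmorphM hC -mulrA -rE.
exists s; split=> // a; rewrite big_cons rmorphM hC -mulrA => /hs.
rewrite (big_rem r rs_) /= rmorphM /= !hX -rE; set g := h _; set e := x - _.
have ge : g * e = e * g by rewrite /e -hX hC.
have -> : e * g * (e * a) = e * (e * (g * a)) by rewrite -(mulrA e) (mulrA g) ge -mulrA.
by rewrite -(mulrA e) /e rE => /cancel_square.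
Qed.

(** The spectral projections are the values at [x] of the Lagrange polynomials [L i] of the simple
    real roots. *)
Lemma spectral_theorem : exists (m : nat) (l : 'I_m -> R) (p : 'I_m -> A),
  [/\ forall i, is_proj (p i), forall i j, i != j -> p i * p j = 0,
      \sum_i p i = 1, x = \sum_i (l i)%:C%C *: p i
    & injective l /\ forall i, p i != 0].
Proof.
have [q q0 hq] := annihilating_poly.
have [rs qE] := closed_field_poly_normal q.
have [s [us es hs]] := reduce_roots rs.
have {hs}hs : h (linears s) = 0.
  rewrite -[LHS]mulr1; apply: hs; rewrite mulr1; apply/eqP.
  have : h q == 0 by rewrite hq.
  by rewrite qE linearZ /= mulr_algl scaler_eq0 lead_coef_eq0 (negbTE q0).
pose m := size s; pose l (i : 'I_m) := nth 0 s i.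
have l_inj : injective l.
  by move=> i j /eqP; rewrite nth_uniq ?ltn_ord // => /eqP/val_inj.
pose c i j : R[i] := ((l i)%:C%C - (l j)%:C%C)^-1.
pose L i := \prod_(j < m | j != i) (c i j *: ('X - ((l j)%:C%C)%:P)).
have LE i j : (L i).[(l j)%:C%C] = (i == j)%:R.
  rewrite horner_prod; have [<-|ij] := eqVneq i j.
    rewrite big1 // => k ki; rewrite !hornerE mulVf // subr_eq0.
    by apply: contra ki => /eqP[/l_inj->].
  by rewrite (bigD1 j) 1?eq_sym //= !hornerE subrr mulr0 mul0r.
(* The difference has size at most [m] and vanishes at [m] distinct points. *)
have Lsum : \sum_i L i = 1.
  apply/eqP; rewrite -subr_eq0; apply/negPn/negP => n0.
  have rts : all (root (\sum_i L i - 1)) [seq (l i)%:C%C | i : 'I_m].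
    apply/allP => _ /mapP[i _ ->]; rewrite rootE hornerD hornerN hornerC horner_sum.
    rewrite (bigD1 i) //= LE eqxx big1 ?addr0 ?subrr // => j ji.
    by rewrite LE (negbTE ji).
  have := max_poly_roots n0 rts.
  rewrite map_inj_uniq ?enum_uniq; last by move=> i j [/l_inj].
  rewrite size_map size_enum_ord => /(_ isT); apply/negP; rewrite -leqNgt.
  have sL i : (size (L i) <= m)%N.
    apply: leq_trans (size_prod_leq _ _) _; rewrite leq_subLR.
    have cE : (#|[pred j | j != i]|).+1 = m.
      by rewrite cardC1 card_ord prednK //; apply: leq_ltn_trans (ltn_ord i).
    apply: (@leq_trans (\sum_(j < m | j != i) 2)%N.+1).
      rewrite ltnS; apply: leq_sum => j _; apply: leq_trans (size_scale_leq _ _) _.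
      by rewrite size_XsubC.
    by rewrite sum_nat_const muln2 -addnn -[X in (_ <= _ + X)%N]cE addnS.
  rewrite -size_polyN opprB; apply: leq_trans (size_polyD _ _) _.
  rewrite size_polyN geq_max; apply/andP; split.
    (* For [m = 0] the empty product would annihilate, that is [1 = 0]. *)
    have [m0|m0] := posnP m; last by rewrite size_poly1.
    by move: hs; rewrite (size0nil m0) big_nil rmorph1 => /eqP; rewrite oner_eq0.
  by apply: leq_trans (size_sum _ _ _) _; apply/bigmax_leqP.
have xp i : x * h (L i) = (l i)%:C%C *: h (L i).
  (* The missing factor completes [L i] to a multiple of the annihilating product. *)
  have cE : ('X - ((l i)%:C%C)%:P) * L i = (\prod_(j < m | j != i) c i j) *: linears s.
    rewrite /L scaler_prod -scalerAr; congr (_ *: _).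
    by rewrite [RHS](big_nth 0) big_mkord [RHS](bigD1 i).
  apply/eqP; rewrite -subr_eq0 -[_ *: h _]mulr_algl -mulrBl.
  have -> : x - (l i)%:C%C%:A = h ('X - ((l i)%:C%C)%:P).
    by rewrite rmorphB /= horner_algX horner_algC.
  by rewrite -rmorphM cE -mul_polyC rmorphM /= hs mulr0.
have pp i j : h (L i) * h (L j) = (i == j)%:R *: h (L j).
  by rewrite (horner_alg_eigen _ (xp j)) LE.
exists m, l, (fun i => h (L i)); split=> //.
- move=> i; split; first by rewrite pp eqxx scale1r.
  rewrite /L; elim/big_ind: _ => [|q1 q2 s1 s2|j _].
  + by rewrite rmorph1 adj1.
  + by rewrite rmorphM (adjM hA) s1 s2 -!rmorphM mulrC.
  + have cc : (c i j)^*%C = c i j by rewrite /c -rmorphB -fmorphV conjc_real.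
    rewrite linearZ /= mulr_algl rmorphB /= horner_algX horner_algC.
    by rewrite adjZ adjB adjZ adj1 xs conjc_real cc.
- by move=> i j ij; rewrite pp (negbTE ij) scale0r.
- by rewrite -[RHS](rmorph1 h) -Lsum rmorph_sum.
- rewrite -[LHS]mulr1 -[in LHS](rmorph1 h) -Lsum rmorph_sum mulr_sumr.
  by apply: eq_bigr => i _; rewrite xp.
(* [h (L i)] fixes an eigenvector for [l i], so it cannot vanish. *)
- split=> // i; have [a a0 xa] := es _ (mem_nth 0 (ltn_ord i)).
  apply: contra a0 => /eqP p0; have := horner_alg_eigen (L i) xa.
  by rewrite p0 mul0r LE eqxx scale1r => <-.
Qed.

End SelfAdjoint.
Lemma pos_complex (c : R[i]) : 0 <= c -> c = (complex.Re c)%:C%C.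
Proof. by case: c => a e; rewrite lecE /= => /andP[/eqP -> _]. Qed.

Lemma pos_of_spectrum m (l : 'I_m -> R) (p : 'I_m -> A) :
  (forall i, is_proj (p i)) -> (forall i j, i != j -> p i * p j = 0) ->
  (forall i, 0 <= l i) -> is_pos (\sum_i (l i)%:C%C *: p i).
Proof.
move=> pp po l0; exists (\sum_i (Num.sqrt (l i))%:C%C *: p i).
rewrite adj_sum mulr_suml; apply: eq_bigr => i _.
rewrite mulr_sumr (bigD1 i) //= big1 => [|j ji].
  rewrite adjZ conjc_real (pp i).2 -scalerAl -scalerAr (pp i).1 scalerA addr0.
  by rewrite -rmorphM -expr2 sqr_sqrtr.
by rewrite adjZ (pp i).2 -scalerAl -scalerAr po 1?eq_sym // !scaler0.
Qed.

Lemma spectrum_mulr m (l : 'I_m -> R) (p : 'I_m -> A) i :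
  (forall i, is_proj (p i)) -> (forall i j, i != j -> p i * p j = 0) ->
  (\sum_i (l i)%:C%C *: p i) * p i = (l i)%:C%C *: p i.
Proof.
move=> pp po; rewrite mulr_suml (bigD1 i) //= big1 => [|j ji].
  by rewrite -scalerAl (pp i).1 addr0.
by rewrite -scalerAl po // scaler0.
Qed.

(** Positivity is tested in trace on each spectral projection, the form in which the Schur
    inequality is available. *)
Lemma spectrum_ge0 m (l : 'I_m -> R) (p : 'I_m -> A) :
  (forall i, is_proj (p i)) -> (forall i j, i != j -> p i * p j = 0) ->
  (forall i, p i != 0) ->
  (forall i, 0 <= tr (p i * (\sum_i (l i)%:C%C *: p i) * p i)) ->
  forall i, 0 <= l i.
Proof.
move=> pp po pn h i; have := h i.
rewrite -mulrA spectrum_mulr // -scalerAr (pp i).1 trZ.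
by rewrite pmulr_lge0 ?lecR // tr_gt0_proj.
Qed.

Lemma proj_sum n (r : 'I_n -> A) (Q : pred 'I_n) :
  (forall i, is_proj (r i)) -> (forall i j, i != j -> r i * r j = 0) ->
  is_proj (\sum_(k | Q k) r k).
Proof.
move=> hr ro; split; last first.
  by rewrite adj_sum; apply: eq_bigr => k _; rewrite (hr k).2.
rewrite mulr_suml; apply: eq_bigr => k Qk; rewrite mulr_sumr (bigD1 k) //=.
rewrite big1 ?addr0 ?(hr k).1 // => j /andP[_ jk].
by rewrite ro // eq_sym.
Qed.

End SpectralTheorem.

Section LinearMaps.
Variables (K : nzRingType) (A : lmodType K).

Lemma linear_fun0 (f : A -> A) : (forall a x y, f (a *: x + y) = a *: f x + f y) -> f 0 = 0.
Proof.
move=> fl; apply: (@addrI _ (f 0)); rewrite addr0 -{1}[f 0]scale1r -fl.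
by rewrite scaler0 addr0.
Qed.

Lemma linear_funZ (f : A -> A) a x :
  (forall a x y, f (a *: x + y) = a *: f x + f y) -> f (a *: x) = a *: f x.
Proof. by move=> fl; rewrite -[a *: x]addr0 fl (linear_fun0 fl) addr0. Qed.

Lemma linear_funD (f : A -> A) x y :
  (forall a x y, f (a *: x + y) = a *: f x + f y) -> f (x + y) = f x + f y.
Proof. by move=> fl; rewrite -[x]scale1r fl !scale1r. Qed.

Lemma linear_fun_sum (f : A -> A) (I : Type) (r : seq I) (Q : pred I) (F : I -> A) :
  (forall a x y, f (a *: x + y) = a *: f x + f y) ->
  f (\sum_(i <- r | Q i) F i) = \sum_(i <- r | Q i) f (F i).
Proof.
move=> fl; apply: (big_morph f _ (linear_fun0 fl)) => x y; exact: (linear_funD _ _ fl).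
Qed.

End LinearMaps.

(** * Jensen's inequality for unital trace-preserving positive maps *)

Section BistochasticMap.
Variables (R : realType) (A : falgType R[i]) (star : A -> A) (tr : A -> R[i]).
Hypothesis hA : tracial_algebra star tr.

Local Notation is_proj := (is_proj star).
Local Notation is_pos := (is_pos star).

Variable phi : A -> A.
Hypotheses (phi_lin : forall a x y, phi (a *: x + y) = a *: phi x + phi y).
Hypotheses (phi_pos : forall p, is_proj p -> is_pos (phi p)).
Hypotheses (phi1 : phi 1 = 1) (tr_phi : forall x, tr (phi x) = tr x).
Variables (m n : nat) (l : 'I_m -> R) (p : 'I_m -> A) (u : 'I_n -> R) (q : 'I_n -> A).
Hypotheses (pp : forall i, is_proj (p i)) (p1 : \sum_i p i = 1)
  (l0 : forall i, 0 <= l i).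
Hypotheses (qp : forall i, is_proj (q i)) (qo : forall i j, i != j -> q i * q j = 0).
Hypotheses (q1 : \sum_i q i = 1).
Hypothesis phi_spec : phi (\sum_i (l i)%:C%C *: p i) = \sum_j (u j)%:C%C *: q j.

Let w i j := complex.Re (tr (q j * phi (p i))).

Local Lemma wE i j : tr (q j * phi (p i)) = (w i j)%:C%C.
Proof. exact/pos_complex/(tr_mul_ge0 hA)/phi_pos/pp/proj_pos. Qed.

(** The matrix [w] is nonnegative, and its marginals are the traces of the [p i] and of the [q j],
    because [phi] preserves the trace and the unit; [phi_spec] is the averaging condition. So the
    operator inequality reduces to [entropy_mixing]. *)
Lemma entropy_bistochastic :
  \sum_i eta (l i) * complex.Re (tr (p i)) <= \sum_j eta (u j) * complex.Re (tr (q j)) /\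
  (\sum_i eta (l i) * complex.Re (tr (p i)) = \sum_j eta (u j) * complex.Re (tr (q j)) ->
   forall i j, l i != u j -> tr (q j * phi (p i)) = 0).
Proof.
have w0 i j : 0 <= w i j.
  by rewrite -lecR -wE; apply: (tr_mul_ge0 hA (proj_pos (qp j)) (phi_pos (pp i))).
have wj i : \sum_j w i j = complex.Re (tr (p i)).
  rewrite -[in RHS]tr_phi -[phi (p i)]mul1r -q1 mulr_suml (tr_sum hA).
  by rewrite (eq_bigr _ (fun j _ => wE i j)) -rmorph_sum.
have wi j : \sum_i w i j = complex.Re (tr (q j)).
  rewrite -[q j in RHS]mulr1 -phi1 -p1 (linear_fun_sum _ _ _ phi_lin) mulr_sumr (tr_sum hA).
  by rewrite (eq_bigr _ (fun i _ => wE i j)) -rmorph_sum.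
have wl j : \sum_i l i * w i j = u j * \sum_i w i j.
  apply: (@complexI R); rewrite wi rmorph_sum rmorphM.
  rewrite -[X in _ = _ * X](pos_complex (tr_ge0 hA (proj_pos (qp j)))) -(trZ hA).
  rewrite -(spectrum_mulr u j qp qo) -phi_spec (trC hA) (linear_fun_sum _ _ _ phi_lin).
  rewrite mulr_sumr (tr_sum hA); apply: eq_bigr => i _.
  by rewrite (linear_funZ _ _ phi_lin) -scalerAr (trZ hA) wE rmorphM.
have [h1 h2] := entropy_mixing w0 l0 wl.
under eq_bigr => i _ do rewrite -wj.
under [X in _ <= X /\ _]eq_bigr => j _ do rewrite -wi.
under [X in _ /\ (_ = X -> _)]eq_bigr => j _ do rewrite -wi.
split=> // /h2 h i j lu; rewrite wE.
by have [->//|e] := h i j; rewrite e eqxx in lu.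
Qed.

Hypotheses (l_inj : injective l) (u_inj : injective u) (pn : forall i, p i != 0).

(** As the eigenvalues are distinct, [phi (p i)] meets at most one [q j], and at least one since its
    trace is not zero. The images sum to 1 and no other one meets this [q j], so
    [phi (p i) = q j]. *)
Lemma bistochastic_rigid :
  (forall i j, l i != u j -> tr (q j * phi (p i)) = 0) ->
  forall i, is_proj (phi (p i)).
Proof.
move=> h i; have h0 k j : l k != u j -> q j * phi (p k) = 0.
  by move=> /h /(tr_mul_eq0 hA (proj_pos (qp j)) (phi_pos (pp k))) [].
have pE : phi (p i) = \sum_j q j * phi (p i) by rewrite -mulr_suml q1 mul1r.
have [[j luj]|nex] := pselect (exists j, l i = u j); last first.
  have : phi (p i) = 0.
    by rewrite pE big1 // => j _; apply: h0; apply/eqP => e; apply: nex; exists j.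
  move=> e; have := tr_gt0_proj hA (pp i) (pn i).
  by rewrite -tr_phi e (tr0 hA) ltxx.
suff -> : phi (p i) = q j by [].
transitivity (q j * phi (p i)).
  rewrite {1}pE (bigD1 j) //= big1 ?addr0 // => k kj; apply: h0.
  by rewrite luj; apply: contra kj => /eqP/u_inj->.
rewrite -[RHS]mulr1 -phi1 -p1 (linear_fun_sum _ _ _ phi_lin) mulr_sumr.
rewrite [RHS](bigD1 i) //= big1 ?addr0 // => k ki; apply: h0.
by rewrite -luj; apply: contra ki => /eqP/l_inj->.
Qed.

End BistochasticMap.

(** * Convolution *)

Section TwoBox.
Variables (R : realType) (A : falgType R[i]) (star : A -> A) (tr : A -> R[i]).
Variables (conv : A -> A -> A) (bar : A -> A) (d : R[i]).

Local Notation is_proj := (is_proj star).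
Local Notation is_pos := (is_pos star).

(** [bar] is the half turn and [d] the loop value. Positivity of convolution is stated as a
    quadratic form in trace, which is what a planar diagram gives directly. *)
Record two_box_algebra : Prop := {
  tb_tracial : tracial_algebra star tr;
  conv_linl : forall a x y z, conv (a *: x + y) z = a *: conv x z + conv y z;
  conv_linr : forall a x y z, conv z (a *: x + y) = a *: conv z x + conv z y;
  convA : forall x y z, conv (conv x y) z = conv x (conv y z);
  conv_adj : forall x y, star (conv x y) = conv (star x) (star y);
  conv_schur : forall a c z, 0 <= tr (star z * (conv (star a * a) (star c * c) * z));
  conv1l : forall x, conv 1 x = (tr x / d) *: 1;
  conv1r : forall x, conv x 1 = (tr x / d) *: 1;
  bar_lin : forall a x y, bar (a *: x + y) = a *: bar x + bar y;
  barK : involutive bar;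
  barM : forall x y, bar (x * y) = bar y * bar x;
  bar_adj : forall x, star (bar x) = bar (star x);
  tr_bar : forall x, tr (bar x) = tr x;
  bar_conv : forall x y, bar (conv x y) = conv (bar y) (bar x);
  tr_convl : forall x y z, tr (conv x y * z) = tr (x * conv z (bar y));
  tr_convr : forall x y z, tr (conv x y * z) = tr (y * conv (bar x) z);
  d_gt0 : 0 < d
}.

Hypothesis hB : two_box_algebra.
Let hA := tb_tracial hB.

Lemma d_neq0 : d != 0. Proof. by rewrite gt_eqF // (d_gt0 hB). Qed.

Let cl z a x y : conv (a *: x + y) z = a *: conv x z + conv y z.
Proof. exact: conv_linl. Qed.
Let cr z a x y : conv z (a *: x + y) = a *: conv z x + conv z y.
Proof. exact: conv_linr. Qed.

Lemma convZl a x z : conv (a *: x) z = a *: conv x z.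
Proof. exact: (linear_funZ _ _ (cl z)). Qed.

Lemma convZr a x z : conv z (a *: x) = a *: conv z x.
Proof. exact: (linear_funZ _ _ (cr z)). Qed.

Lemma convBl x y z : conv (x - y) z = conv x z - conv y z.
Proof. by rewrite (linear_funD _ _ (cl z)) -scaleN1r convZl scaleN1r. Qed.

Lemma convBr x y z : conv z (x - y) = conv z x - conv z y.
Proof. by rewrite (linear_funD _ _ (cr z)) -scaleN1r convZr scaleN1r. Qed.

Lemma barZ a x : bar (a *: x) = a *: bar x.
Proof. exact: (linear_funZ _ _ (bar_lin hB)). Qed.

(** The Schur inequality, applied to the spectral projections of the self-adjoint [conv x y], shows
    that its eigenvalues are nonnegative. *)
Lemma conv_pos x y : is_pos x -> is_pos y -> is_pos (conv x y).
Proof.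
move=> px py; have sx : star (conv x y) = conv x y.
  by rewrite (conv_adj hB) (pos_adj hA px) (pos_adj hA py).
have [m [l [p [pp po _ e [_ pn]]]]] := spectral_theorem hA sx.
rewrite e; apply: (pos_of_spectrum hA) => //.
apply: (spectrum_ge0 hA) => // i; rewrite -e -mulrA -{1}(pp i).2.
by case: px py => a -> [c ->]; apply: conv_schur.
Qed.

Lemma tr_conv x y : tr (conv x y) = tr x * tr y / d.
Proof.
rewrite -[conv x y]mulr1 (tr_convl hB) (conv1l hB) (tr_bar hB) -scalerAr mulr1 (trZ hA).
by rewrite mulrC mulrA.
Qed.

Lemma bar_pos x : is_pos x -> is_pos (bar x).
Proof.
case=> a ->; exists (star (bar a)).
by rewrite (barM hB) (adjK hA) (bar_adj hB).
Qed.

(** The difference is [conv (1 - p) y]. *)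
Lemma conv_proj_compl p y : is_proj p -> is_pos y ->
  is_pos ((tr y / d)%:A - conv p y).
Proof.
move=> hp py; rewrite -(conv1l hB) -convBl.
exact: conv_pos (proj_pos (projC hA hp)) py.
Qed.

Lemma conv_compl_proj p y : is_proj p -> is_pos y ->
  is_pos ((tr y / d)%:A - conv y p).
Proof.
move=> hp py; rewrite -(conv1r hB) -convBr.
exact: conv_pos py (proj_pos (projC hA hp)).
Qed.

Section Support.
Variables (c : A -> A -> A) (p y : A).
Hypotheses (c_lin : forall a x y, c p (a *: x + y) = a *: c p x + c p y).
Hypotheses (c_pos : forall x y, is_pos x -> is_pos y -> is_pos (c x y)).
Hypotheses (tr_c : forall x y, tr (c x y) = tr x * tr y / d).
Hypotheses (c_compl : forall q, is_proj q -> is_pos ((tr p / d)%:A - c p q)).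
Hypotheses (hp : is_proj p) (pn : p != 0) (hq : is_proj (c p y)) (ty : tr y = d).

(* Each p * r_k lies under the projection q = p * y and p * Y is at most
   Tr p / d, where Y is the support of y; compare the traces. *)
Lemma support_trace_le n (u : 'I_n -> R) (r : 'I_n -> A) :
  (forall i, is_proj (r i)) -> (forall i j, i != j -> r i * r j = 0) ->
  (forall k, 0 <= u k) -> y = \sum_k (u k)%:C%C *: r k ->
  \sum_(k | u k != 0) tr (r k) <= tr p.
Proof.
move=> hr ro u0 yE; move: hq; have [q qE] : exists q, q = c p y by exists (c p y).
rewrite -qE => hq'; have qC := proj_pos (projC hA hq'); have cr_pos k := c_pos (proj_pos hp) (proj_pos (hr k)).
have z0 k : u k != 0 -> (1 - q) * c p (r k) = 0.
  move=> uk; apply: (tr_mul_eq0 hA qC (cr_pos k) _).1.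
  have : tr ((1 - q) * c p y) = 0.
    by rewrite mulrBl mul1r -qE hq'.1 subrr (tr0 hA).
  rewrite yE (linear_fun_sum _ _ _ c_lin) mulr_sumr (tr_sum hA) => /eqP.
  rewrite psumr_eq0 => [/allP/(_ k)|j _]; last first.
    rewrite (linear_funZ _ _ c_lin) -scalerAr (trZ hA) mulr_ge0 ?lecR ?u0 //.
    exact: (tr_mul_ge0 hA).
  rewrite mem_index_enum => /(_ isT) /=.
  rewrite (linear_funZ _ _ c_lin) -scalerAr (trZ hA) mulf_eq0 => /orP[|/eqP//].
  by rewrite -[0]/(0%:C%C) (inj_eq (@complexI R)) (negbTE uk).
set Y := \sum_(k | u k != 0) r k.
have hY : is_proj Y by exact: (proj_sum hA).
have sE : c p Y = q * c p Y.
  apply/eqP; rewrite -subr_eq0 -{1}[c p Y]mul1r -mulrBl /Y.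
  by rewrite (linear_fun_sum _ _ _ c_lin) mulr_sumr big1 // => j; exact: z0.
(* Since [q * c p Y = c p Y] and [tr q = tr p], this reads [tr p * tr Y / d <= tr p * tr p / d]. *)
have := tr_mul_ge0 hA (proj_pos hq') (c_compl hY).
have tp := tr_gt0_proj hA hp pn; have d0 := d_gt0 hB.
rewrite mulrBr -sE (trB hA) -scalerAr mulr1 (trZ hA) qE !tr_c ty subr_ge0.
by rewrite mulfK ?d_neq0 // [leLHS]mulrAC ler_pM2l ?divr_gt0 // (tr_sum hA).
Qed.

End Support.

(* Each spectral projection of x has at least the trace of the support of y and
   conversely, which leaves room for only one of each. *)
Lemma rigid_pair m n (l : 'I_m -> R) (p : 'I_m -> A) (u : 'I_n -> R) (r : 'I_n -> A) :
  (forall i, is_proj (p i)) -> (forall i j, i != j -> p i * p j = 0) ->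
  (forall i, is_proj (r i)) -> (forall i j, i != j -> r i * r j = 0) ->
  (forall i, 0 <= l i) -> (forall i, 0 <= u i) ->
  (forall i, p i != 0) -> (forall i, r i != 0) ->
  let x := \sum_i (l i)%:C%C *: p i in let y := \sum_k (u k)%:C%C *: r k in
  tr x = d -> tr y = d ->
  (forall i, is_proj (conv (p i) y)) -> (forall k, is_proj (conv x (r k))) ->
  exists (t : R[i]) (X Y Q : A),
    [/\ 0 < t, [/\ is_proj X, is_proj Y & is_proj Q],
        x = t^-1 *: X /\ y = t^-1 *: Y, conv X Y = t *: Q
      & [/\ tr X = t * d, tr Y = t * d & tr Q = t * d]].
Proof.
move=> hp po hr ro l0 u0 pn rn x y tx ty px ry.
have hx : is_pos x by exact: (pos_of_spectrum hA).
have hy : is_pos y by exact: (pos_of_spectrum hA).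
have tp i := tr_gt0_proj hA (hp i) (pn i); have tr_ i := tr_gt0_proj hA (hr i) (rn i).
have le1 i : \sum_(k | u k != 0) tr (r k) <= tr (p i).
  apply: (@support_trace_le conv (p i) y) => //.
  - exact: conv_pos.
  - exact: tr_conv.
  - by move=> q hq; apply: conv_compl_proj => //; apply: proj_pos.
have le2 k : \sum_(i | l i != 0) tr (p i) <= tr (r k).
  apply: (@support_trace_le (fun a c => conv c a) (r k) x) => //.
  - by move=> v w pv pw; apply: conv_pos.
  - by move=> v w; rewrite tr_conv [tr w * _]mulrC.
  - by move=> q hq; apply: conv_proj_compl => //; apply: proj_pos.
have exn k0 (v : 'I_k0 -> R) (s : 'I_k0 -> A) :
    tr (\sum_i (v i)%:C%C *: s i) = d -> exists i, v i != 0.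
  move=> e; apply: contrapT => /forallNP h; have := d_neq0; rewrite -e big1 ?(tr0 hA) ?eqxx //.
  by move=> i _; have /negP/negPn/eqP-> := h i; rewrite scale0r.
have [i0 li0] := exn _ _ _ tx; have [k0 uk0] := exn _ _ _ ty.
have single k1 (v : 'I_k1 -> R) (s : 'I_k1 -> A) i : (forall i, 0 < tr (s i)) ->
    v i != 0 -> \sum_(j | v j != 0) tr (s j) <= tr (s i) ->
    \sum_j (v j)%:C%C *: s j = (v i)%:C%C *: s i.
  move=> ts vi; rewrite (bigD1 i) //= gerDl => le0.
  rewrite [LHS](bigD1 i) //= big1 ?addr0 // => j ji.
  have [->|vj] := eqVneq (v j) 0; first by rewrite scale0r.
  have : 0 < \sum_(i0 < k1 | (v i0 != 0) && (i0 != i)) tr (s i0).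
    rewrite (bigD1 j) ?vj //= ltr_pwDl // sumr_ge0 // => k _; exact: ltW.
  by move/lt_le_trans/(_ le0); rewrite ltxx.
have eqs : tr (p i0) = tr (r k0).
  apply: le_anti; apply/andP; split.
    apply: le_trans (le2 k0); rewrite (bigD1 i0) //= lerDl sumr_ge0 // => i _; exact: ltW.
  apply: le_trans (le1 i0); rewrite (bigD1 k0) //= lerDl sumr_ge0 // => i _; exact: ltW.
have xE : x = (l i0)%:C%C *: p i0.
  apply: single => //; apply: le_trans (le2 k0) _; by rewrite eqs.
have yE : y = (u k0)%:C%C *: r k0.
  apply: single => //; apply: le_trans (le1 i0) _; by rewrite eqs.
(* [tr x = tr y = d] then forces both coefficients to be [t^-1]. *)
pose t := tr (p i0) / d.
have t0 : 0 < t by rewrite divr_gt0 // (d_gt0 hB).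
have td : t * d = tr (p i0) by rewrite divfK ?d_neq0.
have ltE c s : tr (c *: s) = d -> tr s = tr (p i0) -> c = t^-1.
  rewrite (trZ hA) => e es; apply: (mulIf (x := t * d)).
    by rewrite td gt_eqF.
  by rewrite {1}td -es e mulKf ?gt_eqF.
have lE : (l i0)%:C%C = t^-1 by apply: (ltE _ (p i0)); rewrite -?xE.
have uE : (u k0)%:C%C = t^-1 by apply: (ltE _ (r k0)); rewrite -?yE ?eqs.
exists t, (p i0), (r k0), (conv (p i0) y); split=> //.
- by rewrite {1}xE {1}yE lE uE.
- by rewrite yE uE convZr scalerA divff ?scale1r // gt_eqF.
- by rewrite tr_conv ty mulfK ?d_neq0 // -eqs td.
Qed.

(** The trace identity says that the positive elements [s] and [t - s] are orthogonal. *)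
Lemma pos_square_eq s t : is_pos s -> is_pos (t%:A - s) -> tr (s * s) = t * tr s ->
  s * s = t *: s.
Proof.
move=> ps pts e; have : s * (t%:A - s) = 0.
  apply: (tr_mul_eq0 hA ps pts _).1.
  by rewrite mulrBr -scalerAr mulr1 (trB hA) (trZ hA) e subrr.
by rewrite mulrBr -scalerAr mulr1 => /eqP; rewrite subr_eq0 => /eqP.
Qed.

(** * From a factorization to shifts of biprojections *)

Section Factorization.
Variables (X Y Q : A) (t : R[i]).
Hypotheses (hX : is_proj X) (hY : is_proj Y) (hQ : is_proj Q) (t0 : 0 < t).
Hypotheses (XY : conv X Y = t *: Q).
Hypotheses (tX : tr X = t * d) (tY : tr Y = t * d) (tQ : tr Q = t * d).

Let pX := proj_pos hX.
Let pY := proj_pos hY.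
Let pQ := proj_pos hQ.
Let tn : t != 0. Proof. by rewrite gt_eqF. Qed.
Let tc : t^*%C = t. Proof. exact/real_scalar/ltW. Qed.
Let tXd : tr X / d = t. Proof. by rewrite tX mulfK ?d_neq0. Qed.
Let tYd : tr Y / d = t. Proof. by rewrite tY mulfK ?d_neq0. Qed.

(** By Frobenius reciprocity the trace against [X] equals that of [conv X Y] against [Q]. This is
    the largest value that the bound by [t] allows and already the whole trace, so
    [pos_eq_scaled_proj] applies. *)
Lemma factor_left : conv Q (bar Y) = t *: X.
Proof.
apply: (pos_eq_scaled_proj hA hX) => //.
- exact: conv_pos pQ (bar_pos pY).
- by rewrite -tYd -(tr_bar hB Y); apply: conv_proj_compl => //; apply: bar_pos.
- by rewrite -(tr_convl hB) XY -scalerAl hQ.1 (trZ hA) tQ tX.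
- by rewrite tr_conv (tr_bar hB) -mulrA tYd tQ -tX mulrC.
Qed.

Lemma factor_right : conv (bar X) Q = t *: Y.
Proof.
apply: (pos_eq_scaled_proj hA hY) => //.
- exact: conv_pos (bar_pos pX) pQ.
- by rewrite -tXd -(tr_bar hB X); apply: conv_compl_proj => //; apply: bar_pos.
- by rewrite -(tr_convr hB) XY -scalerAl hQ.1 (trZ hA) tQ tY.
- by rewrite tr_conv (tr_bar hB) mulrAC tXd tQ tY.
Qed.

Let S := conv Y (bar Y).
Let V := conv (bar X) X.
Let S2 := conv X (bar X).

Let pS : is_pos S. Proof. exact: conv_pos pY (bar_pos pY). Qed.
Let pV : is_pos V. Proof. exact: conv_pos (bar_pos pX) pX. Qed.
Let pS2 : is_pos S2. Proof. exact: conv_pos pX (bar_pos pX). Qed.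

Let trS : tr S = t * tr X.
Proof. by rewrite tr_conv (tr_bar hB) -mulrA tYd tY tX mulrC. Qed.
Let trV : tr V = t * tr X.
Proof. by rewrite tr_conv (tr_bar hB) -mulrA tXd mulrC. Qed.
Let trS2 : tr S2 = t * tr X.
Proof. by rewrite tr_conv (tr_bar hB) -mulrA tXd mulrC. Qed.

Let cS : is_pos (t%:A - S).
Proof. by rewrite -tYd -(tr_bar hB Y); apply: conv_proj_compl => //; apply: bar_pos. Qed.
Let cV : is_pos (t%:A - V).
Proof. by rewrite -tXd -(tr_bar hB X); apply: conv_compl_proj => //; apply: bar_pos. Qed.
Let cS2 : is_pos (t%:A - S2).
Proof. by rewrite -tXd -(tr_bar hB X); apply: conv_proj_compl => //; apply: bar_pos. Qed.

Let XS : conv X S = (t * t) *: X.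
Proof. by rewrite -(convA hB) XY convZl factor_left scalerA. Qed.

Let trVS : tr (V * S) = t * (t * tr X).
Proof.
by rewrite (tr_convr hB) (barK hB) XS -scalerAr hX.1 (trZ hA) mulrA.
Qed.

(** [V] and [S] are bounded by [t], and [tr (V * S)] attains both bounds [t * tr V] and [t * tr S].
    Hence [(t - V) * S] and [V * (t - S)] vanish, and [t V = V S = t S]. *)
Lemma factor_square : conv (bar X) X = conv Y (bar Y).
Proof.
rewrite -/V -/S; apply: (scalerI tn).
have e1 : (t%:A - V) * S = 0.
  apply: (tr_mul_eq0 hA cV pS _).1.
  by rewrite mulrBl -scalerAl mul1r (trB hA) (trZ hA) trVS trS subrr.
have e2 : V * (t%:A - S) = 0.
  apply: (tr_mul_eq0 hA pV cS _).1.
  by rewrite mulrBr -scalerAr mulr1 (trB hA) (trZ hA) trVS trV subrr.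
move: e1 e2; rewrite mulrBl -scalerAl mul1r mulrBr -scalerAr mulr1.
by move=> /eqP; rewrite subr_eq0 => /eqP -> /eqP; rewrite subr_eq0 => /eqP.
Qed.

Let SS : S * S = t *: S.
Proof.
apply: pos_square_eq => //; have VS : V = S by exact: factor_square.
by rewrite -{1}VS trVS trS.
Qed.

Let S2X : conv S2 X = (t * t) *: X.
Proof. by rewrite (convA hB) factor_square XS. Qed.

Let S2S2 : S2 * S2 = t *: S2.
Proof.
apply: pos_square_eq => //.
by rewrite {1}/S2 (tr_convl hB) (barK hB) S2X -scalerAr hX.1 (trZ hA) trS2 mulrA.
Qed.

(** Here left means the left factor of [conv X Y]; the shift obtained is a right shift. The last two
    clauses are what makes the projection a biprojection. *)
Lemma left_shift_of_factor :
  [/\ is_proj (t^-1 *: S2), tr (t^-1 *: S2) = tr X, conv (t^-1 *: S2) X = t *: X,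
      bar (t^-1 *: S2) = t^-1 *: S2
    & conv (t^-1 *: S2) (t^-1 *: S2) = t *: (t^-1 *: S2)].
Proof.
split.
- exact: (pos_proportional_proj hA tn tc pS2 S2S2).
- by rewrite (trZ hA) trS2 mulKf.
- by rewrite convZl S2X scalerA mulKf.
- by rewrite barZ (bar_conv hB) (barK hB).
- rewrite convZl convZr {2}/S2 -(convA hB) S2X convZl -/S2 !scalerA.
  by congr (_ *: _); field.
Qed.

Lemma right_shift_of_factor :
  [/\ is_proj (t^-1 *: S), tr (t^-1 *: S) = tr Y, conv (t^-1 *: S) Y = t *: Y,
      bar (t^-1 *: S) = t^-1 *: S
    & conv (t^-1 *: S) (t^-1 *: S) = t *: (t^-1 *: S)].
Proof.
have SY : conv S Y = (t * t) *: Y.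
  by rewrite /S -factor_square (convA hB) XY convZr factor_right scalerA.
split.
- exact: (pos_proportional_proj hA tn tc pS SS).
- by rewrite (trZ hA) trS mulKf // tX tY.
- by rewrite convZl SY scalerA mulKf.
- by rewrite barZ (bar_conv hB) (barK hB).
- rewrite convZl convZr {2}/S -(convA hB) SY convZl -/S !scalerA.
  by congr (_ *: _); field.
Qed.

End Factorization.

(** * Convolution of two shifts *)

Section Shift.
Variables (B X : A) (t : R[i]).
Hypotheses (hBp : is_proj B) (hX : is_proj X).
Hypotheses (tX : tr X = t * d) (tB : tr B = tr X) (BX : conv B X = t *: X).

(** By Frobenius reciprocity [BX] says that the trace of [conv X (bar X)] is concentrated on [B] and
    maximal there. *)
Lemma shift_square : conv X (bar X) = t *: B.
Proof.
have pX := proj_pos hX; have tXd : tr X / d = t by rewrite tX mulfK ?d_neq0.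
apply: (pos_eq_scaled_proj hA hBp).
- exact: conv_pos pX (bar_pos pX).
- by rewrite -tXd -(tr_bar hB X); apply: conv_proj_compl => //; apply: bar_pos.
- by rewrite -(tr_convl hB) BX -scalerAl hX.1 (trZ hA) tB.
- by rewrite tr_conv (tr_bar hB) -mulrA tXd tB mulrC.
Qed.

Lemma shift_cube : conv (conv X (bar X)) X = (t * t) *: X.
Proof. by rewrite shift_square convZl BX scalerA. Qed.

Lemma shift_square_idem :
  conv (conv X (bar X)) (conv X (bar X)) = (t * t) *: conv X (bar X).
Proof. by rewrite -(convA hB) shift_cube convZl. Qed.

(** [BX] bears on the opposite product [conv X (bar X)]; reassociating brings out the cube of
    [shift_cube]. *)
Lemma shift_square_idem' :
  conv (conv (bar X) X) (conv (bar X) X) = (t * t) *: conv (bar X) X.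
Proof.
by rewrite (convA hB) -[conv X (conv _ _)](convA hB) shift_cube convZr.
Qed.

Lemma tr_shift_square : tr (conv X (bar X) * conv X (bar X)) = t ^+ 3 * d.
Proof.
rewrite shift_square -scalerAr -scalerAl hBp.1 scalerA (trZ hA) tB tX.
by ring.
Qed.

(** Frobenius reciprocity leaves a triple product which is the half turn of the cube in
    [shift_cube]. *)
Lemma tr_shift_square' : tr (conv (bar X) X * conv (bar X) X) = t ^+ 3 * d.
Proof.
rewrite (tr_convl hB) (convA hB).
have -> : conv (bar X) (conv X (bar X)) = bar (conv (conv X (bar X)) X).
  by rewrite !(bar_conv hB) (barK hB).
rewrite shift_cube barZ -scalerAr -(barM hB) hX.1 (trZ hA) (tr_bar hB) tX.
by ring.
Qed.

End Shift.

(** The last hypothesis is the equality of ranges with the Fourier transform undone. The traces of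
    the squares of its sides are [d / t1] and [d / t2], so [t1 = t2]; then it turns
    [conv (conv X Y) (bar Y)] into the cube of [X], which gives [M * M = t1 *: M]. *)
Lemma conv_shifts B1 B2 X Y (t1 t2 : R[i]) :
  is_proj B1 -> is_proj B2 -> is_proj X -> is_proj Y -> 0 < t1 -> 0 < t2 ->
  tr X = t1 * d -> tr Y = t2 * d -> tr B1 = tr X -> tr B2 = tr Y ->
  conv B1 X = t1 *: X -> conv B2 Y = t2 *: Y ->
  t1 ^- 2 *: conv (bar X) X = t2 ^- 2 *: conv Y (bar Y) ->
  t1 = t2 /\ exists Q, [/\ is_proj Q, tr Q = t1 * d & conv X Y = t1 *: Q].
Proof.
move=> h1 h2 hX hY t10 t20 tX tY tB1 tB2 e1 e2 e.
have [t1n t2n] : t1 != 0 /\ t2 != 0 by rewrite !gt_eqF.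
have t12 : t1 = t2.
  have : tr ((t1 ^- 2 *: conv (bar X) X) * (t1 ^- 2 *: conv (bar X) X)) =
         tr ((t2 ^- 2 *: conv Y (bar Y)) * (t2 ^- 2 *: conv Y (bar Y))) by rewrite e.
  rewrite -!scalerAl -!scalerAr !(trZ hA).
  rewrite (tr_shift_square' h1 hX tX tB1 e1) (tr_shift_square h2 hY tY tB2 e2).
  have -> : t1 ^- 2 * (t1 ^- 2 * (t1 ^+ 3 * d)) = t1^-1 * d by field.
  have -> : t2 ^- 2 * (t2 ^- 2 * (t2 ^+ 3 * d)) = t2^-1 * d by field.
  by move/(mulIf d_neq0)/invr_inj.
split=> //; subst t2.
have {}e : conv (bar X) X = conv Y (bar Y).
  by apply: (scalerI _ e); rewrite invr_eq0 expf_neq0.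
have pX := proj_pos hX; have pY := proj_pos hY.
set M := conv X Y; have pM : is_pos M by exact: conv_pos.
have tYd : tr Y / d = t1 by rewrite tY mulfK ?d_neq0.
have trM : tr M = t1 * (t1 * d) by rewrite tr_conv -mulrA tYd tX mulrC.
have MM : M * M = t1 *: M.
  apply: pos_square_eq => //; first by rewrite -tYd; exact: conv_proj_compl.
  rewrite {1}/M (tr_convl hB) (convA hB) -e -(convA hB) (shift_cube h1 hX tX tB1 e1).
  by rewrite -scalerAr hX.1 (trZ hA) trM tX -mulrA.
exists (t1^-1 *: M); split.
- exact: (pos_proportional_proj hA t1n (real_scalar (ltW t10)) pM MM).
- by rewrite (trZ hA) trM mulKf.
- by rewrite scalerA divff // scale1r.
Qed.

End TwoBox.

(** The ring laws of 2-boxes are consequences of [hP], so the carrier takes [hP] as a parameter,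
    from which the instances recover it. *)
Definition box_algebra (R : realType) (P : planar_data R)
  (hP : subfactor_planar_algebra P) (b : bool) : Type := P (2%N, b).

(** * The algebra of 2-boxes, its functional calculus and range projections *)

Section BoxAlgebra.
Variables (R : realType) (P : planar_data R) (hP : subfactor_planar_algebra P).
Variable b : bool.
Local Notation A := (box_algebra hP b).

HB.instance Definition _ := Vector.copy A (P (2%N, b)).

Let mulDl (x y z : A) : bmul (x + y) z = bmul x z + bmul y z.
Proof. by have := bmul_linearl hP 1 x y z; rewrite !scale1r. Qed.

Let mulDr (x y z : A) : bmul x (y + z) = bmul x y + bmul x z.
Proof. by have := bmul_linearr hP 1 y z x; rewrite !scale1r. Qed.

Let mulA (x y z : A) : bmul x (bmul y z) = bmul (bmul x y) z.
Proof. by rewrite (bmulA hP). Qed.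

HB.instance Definition _ := GRing.Zmodule_isNzRing.Build A
  mulA (@bmul1l _ _ hP b) (@bmul1r _ _ hP b) mulDl mulDr (bone_neq0 hP b).

Let mulZl (a : R[i]) (x y : A) : a *: (x * y) = (a *: x) * y.
Proof.
have z : bmul 0 y = 0 := mul0r (y : A).
have := bmul_linearl hP a x 0 y; rewrite z !addr0 => e; exact: esym e.
Qed.

HB.instance Definition _ := GRing.Lmodule_isLalgebra.Build R[i] A mulZl.

Let mulZr (a : R[i]) (x y : A) : a *: (x * y) = x * (a *: y).
Proof.
have z : bmul x 0 = 0 := mulr0 (x : A).
have := bmul_linearr hP a y 0 x; rewrite z !addr0 => e; exact: esym e.
Qed.

HB.instance Definition _ := GRing.Lalgebra_isAlgebra.Build R[i] A mulZr.
HB.instance Definition _ := Algebra_isFalgebra.Build R[i] A.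

Lemma box_tracial : @tracial_algebra R A (@star R P (2%N, b)) (@Tr R P 2 b).
Proof.
split.
- exact: star_semilinear.
- exact: star_involutive.
- exact: star_bmul.
- exact: Tr_linear.
- exact: TrC.
- exact: Tr_positive.
Qed.

Lemma box_two_box (hirr : irreducible P) :
  @two_box_algebra R A (@star R P (2%N, b)) (@Tr R P 2 b) (@convolution R P b)
    (@half_turn R P b) ((delta P)%:C%C).
Proof.
split.
- exact: box_tracial.
- exact: convolution_linearl.
- exact: convolution_linearr.
- exact: convolutionA.
- exact: star_convolution.
- exact: Tr_schur_ge0.
- exact: convolution_bonel.
- exact: convolution_boner.
- exact: half_turn_linear.
- exact: half_turnK.
- exact: half_turn_bmul.
- exact: star_half_turn.
- exact: Tr_half_turn.
- exact: half_turn_convolution.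
- exact: Tr_convolutionl.
- exact: Tr_convolutionr.
- exact: loop_gt0.
Qed.

Local Notation star := (@star R P (2%N, b) : A -> A).
Local Notation Tr := (@Tr R P 2 b : A -> R[i]).
Let hA : tracial_algebra star Tr := box_tracial.

(** [fcalc] chooses among the values given by all spectral decompositions. They agree, because
    [p i * q j != 0] forces [l i = u j]. *)
Lemma fcalcE (f : R -> R) m (l : 'I_m -> R) (p : 'I_m -> A) :
  (forall i, is_proj star (p i)) -> (forall i j, i != j -> p i * p j = 0) ->
  \sum_i p i = 1 ->
  fcalc f (\sum_i (l i)%:C%C *: p i : A) = \sum_i (f (l i))%:C%C *: p i.
Proof.
move=> hp po p1; rewrite /fcalc; apply: xget_unique.
  by exists m, l, p; split.
move=> y [n [u [q [hq qo q1 xE ->]]]].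
have hq' : forall i, is_proj star (q i : A) := hq.
have qo' : forall i j, i != j -> (q i : A) * q j = 0 := qo.
have q1' : \sum_i (q i : A) = 1 := q1.
have xE' : \sum_i (l i)%:C%C *: p i = \sum_j (u j)%:C%C *: (q j : A) := xE.
have pq i j : (f (u j))%:C%C *: (p i * q j) = (f (l i))%:C%C *: (p i * q j).
  have : (u j)%:C%C *: (p i * q j) = (l i)%:C%C *: (p i * q j).
    rewrite scalerAr -(spectrum_mulr u j hq' qo') -xE' mulrA scalerAl.
    congr (_ * _); rewrite mulr_sumr (bigD1 i) //= big1 ?addr0 => [|k ki].
      by rewrite -scalerAr (hp i).1.
    by rewrite -scalerAr po 1?eq_sym // scaler0.
  have [->//|z] := eqVneq (p i * q j) 0; first by rewrite !scaler0.
  move/eqP; rewrite -subr_eq0 -scalerBl scaler_eq0 (negbTE z) orbF subr_eq0.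
  by rewrite (inj_eq (@complexI R)) => /eqP->.
have lhs : \sum_j (f (u j))%:C%C *: (q j : A) = \sum_j \sum_i (f (u j))%:C%C *: (p i * q j).
  by apply: eq_bigr => j _; rewrite -scaler_sumr -mulr_suml p1 mul1r.
have rhs : \sum_i (f (l i))%:C%C *: p i = \sum_j \sum_i (f (u j))%:C%C *: (p i * q j).
  rewrite exchange_big /=; apply: eq_bigr => i _.
  rewrite (eq_bigr _ (fun j _ => pq i j)) -scaler_sumr -mulr_sumr q1' mulr1 //.
exact: (etrans lhs (esym rhs)).
Qed.

Lemma entropyE m (l : 'I_m -> R) (p : 'I_m -> A) :
  (forall i, is_proj star (p i)) -> (forall i j, i != j -> p i * p j = 0) ->
  \sum_i p i = 1 ->
  entropy (\sum_i (l i)%:C%C *: p i : A) = \sum_i eta (l i) * complex.Re (Tr (p i)).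
Proof.
move=> hp po p1; rewrite /entropy fcalcE //.
rewrite (tr_sum hA) raddf_sum; apply: eq_bigr => i _.
rewrite (trZ hA) /eta; case: (Tr (p i)) => u v /=.
by rewrite mul0r subr0.
Qed.

Lemma pos_spectrum (x : A) : is_pos star x -> exists m (l : 'I_m -> R) (p : 'I_m -> A),
  [/\ forall i, is_proj star (p i), forall i j, i != j -> p i * p j = 0,
      \sum_i p i = 1, x = \sum_i (l i)%:C%C *: p i
    & [/\ injective l, forall i, p i != 0 & forall i, 0 <= l i]].
Proof.
move=> px; have [m [l [p [hp po p1 xE [li pn]]]]] := spectral_theorem hA (pos_adj hA px).
exists m, l, p; split=> //; split=> //.
apply: (spectrum_ge0 hA hp po pn) => i; rewrite -xE.
case: px => a ->; apply: (tr_ge0 hA); exists (a * p i).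
by rewrite (adjM hA) (hp i).2 !mulrA.
Qed.

Lemma pnorm1E (x : A) : is_pos star x -> pnorm 1 x = complex.Re (Tr x).
Proof.
move=> px; have [m [l [p [hp po p1 xE [li pn l0]]]]] := pos_spectrum px.
have xx : bmul (star x) x = \sum_i (l i ^+ 2)%:C%C *: p i :> A.
  rewrite (pos_adj hA px) {2}xE -[bmul _ _]/(x * _) mulr_sumr; apply: eq_bigr => i _.
  by rewrite -scalerAr xE (spectrum_mulr l i hp po) scalerA -rmorphM -expr2.
have absE : absolute x = x.
  rewrite /absolute xx fcalcE // [in RHS]xE; apply: eq_bigr => i _.
  by rewrite sqrtr_sqr ger0_norm.
have f1 : fcalc (fun t => t `^ 1) x = x.
  by rewrite {1}xE fcalcE // [in RHS]xE; apply: eq_bigr => i _; rewrite powRr1.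
rewrite /pnorm absE f1 invr1 powRr1 //.
have := tr_ge0 hA px; rewrite (pos_complex (tr_ge0 hA px)) /= lecR.
exact.
Qed.

Lemma entropy_scaled_proj (X : A) (c : R) : is_proj star X ->
  entropy (c%:C%C *: X : A) = eta c * complex.Re (Tr X).
Proof.
(* A spectral decomposition sums to 1, so [1 - X] is added with eigenvalue 0, where [eta]
   vanishes. *)
move=> hX; pose l (i : 'I_2) : R := if i == ord0 then c else 0.
pose p (i : 'I_2) : A := if i == ord0 then X else 1 - X.
have := @entropyE 2 l p; rewrite !big_ord_recl !big_ord0 /l /p /=.
rewrite scale0r !addr0 => -> //.
- by rewrite /eta mul0r oppr0 mul0r addr0.
- by move=> i; case: ifP => _ //; exact: (projC hA hX).
- move=> i j; case: ifP => [/eqP->|i0]; case: ifP => [/eqP->|j0] //.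
  + by rewrite mulrBr mulr1 hX.1 subrr.
  + by rewrite mulrBl mul1r hX.1 subrr.
  + by case: i j i0 j0 => -[|[|i]] // ? [[|[|j]] // ?] _ _ /eqP[]; apply: val_inj.
- by rewrite addrC subrK.
Qed.

(** A projection [p] fixes [z] on the left exactly when it fixes [z * star z], by faithfulness of
    the trace. *)
Lemma range_projection_eq (x y : A) : x * star x = y * star y ->
  range_projection x = range_projection y.
Proof.
have absorb (p z : A) : p * z = z <-> p * (z * star z) = z * star z.
  split=> [e|e]; first by rewrite mulrA e.
  apply/eqP; rewrite -subr_eq0 -[X in _ - X]mul1r -mulrBl; set u := _ * _.
  suff : star u = 0 by move=> u0; rewrite -[u](adjK hA) u0 (adj0 hA).
  apply: (adj_mul_eq0 hA); rewrite (adjK hA) /u (adjM hA) mulrA -(mulrA _ z).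
  by rewrite mulrBl mul1r e subrr mul0r.
move=> xy; have E (p : A) : p * x = x <-> p * y = y.
  split=> /absorb e; apply/absorb; first by rewrite -xy.
  by rewrite xy.
have {}E (p : P (2%N, b)) : bmul p x = x <-> bmul p y = y by exact: E.
rewrite /range_projection; congr (xget 0 _); apply/seteqP.
by split=> p /= [hp /E h1 h2]; split=> // q hq /E; apply: h2.
Qed.

Lemma range_projectionE (x : A) : (x * star x) * (x * star x) = x * star x ->
  range_projection x = x * star x.
Proof.
set e := x * star x => ee.
have es : star e = e by rewrite /e (adjM hA) (adjK hA).
have ex : e * x = x.
  apply/eqP; rewrite -subr_eq0 -[X in _ - X]mul1r -mulrBl; set u := _ * _.
  suff : star u = 0 by move=> u0; rewrite -[u](adjK hA) u0 (adj0 hA).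
  apply: (adj_mul_eq0 hA); rewrite (adjK hA) /u (adjM hA) mulrA -(mulrA _ x).
  by rewrite -/e mulrBl mul1r ee subrr mul0r.
have least q : q * x = x -> q * e = e by move=> qx; rewrite /e mulrA qx.
rewrite /range_projection; apply: xget_unique => /=.
  by split=> // q _; apply: least.
move=> p [[pp ps] px h]; have pe : (e : A) * p = p := h e (conj ee es) ex.
by rewrite -[LHS]ps -[p in LHS]pe (adjM hA) es ps; apply: least.
Qed.

End BoxAlgebra.

(** * Entropy of a convolution *)

Section Main.
Variables (R : realType) (P : planar_data R) (hP : subfactor_planar_algebra P).
Hypothesis hirr : irreducible P.
Variable b : bool.
Local Notation A := (box_algebra hP b).
Local Notation A' := (box_algebra hP (~~ b)).
Local Notation star := (@Defs.star R P (2%N, b) : A -> A).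
Local Notation star' := (@Defs.star R P (2%N, ~~ b) : A' -> A').
Local Notation Tr := (@Tr R P 2 b : A -> R[i]).
Local Notation conv := (@convolution R P b : A -> A -> A).
Local Notation bar := (@half_turn R P b : A -> A).
Local Notation F := (@inv_fourier R P b : A -> A').
Local Notation d := ((delta P)%:C%C).

Let hA : tracial_algebra star Tr := box_tracial hP b.
Let hA' := box_tracial hP (~~ b).
Let hB : two_box_algebra star Tr conv bar d := @box_two_box R P hP b hirr.

Lemma inv_fourierZ a (x : A) : F (a *: x) = a *: F x.
Proof.
have z : inv_fourier (0 : P (2%N, b)) = 0.
  apply: (@addrI _ (inv_fourier (0 : P (2%N, b)))); rewrite addr0.
  rewrite -{1}[inv_fourier _]scale1r -(inv_fourier_linear hP).
  by rewrite scaler0 addr0.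
have := inv_fourier_linear hP a (x : P (2%N, b)) 0.
by rewrite z !addr0.
Qed.

Lemma inv_fourier_adj (x : A) : star' (F x) = F (bar (star x)).
Proof. by rewrite (star_inv_fourier hP) (inv_fourier_half_turn hP). Qed.

Lemma inv_fourier_conv (x y : A) : F (conv x y) = F x * F y.
Proof. exact: inv_fourier_convolution. Qed.

(** Invariance under [bar] makes [F W] self-adjoint and equal to [fourier W]; since [F] turns
    convolutions into products, [F W] squares to [t] times itself. *)
Lemma biprojection_of (W : A) (t : R[i]) : 0 < t -> is_proj star W -> bar W = W ->
  conv W W = t *: W -> biprojection W.
Proof.
move=> t0 hW bW WW; split; first exact: hW.
pose f : A' := F W.
have tn : t != 0 by rewrite gt_eqF.
have tc : t^*%C = t by exact/real_scalar/ltW.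
have fs : star' f = f by rewrite /f inv_fourier_adj hW.2 bW.
have ff : f * f = t *: f by rewrite -inv_fourier_conv WW inv_fourierZ.
exists t, (t^-1 *: f); split; last first.
  by rewrite -(inv_fourier_half_turn hP) [half_turn W]bW scalerA divff // scale1r.
split; last by rewrite -[LHS]/(star' (t^-1 *: f)) (adjZ hA') fs fmorphV /= tc.
rewrite -[LHS]/((t^-1 *: f) * (t^-1 *: f)) -scalerAl -scalerAr ff.
by rewrite [t^-1 *: (t *: f)]scalerA mulVf // scale1r.
Qed.

Lemma inv_fourier_range_left (x : A) : star x = x ->
  star' (F x) * star' (star' (F x)) = F (conv (bar x) x).
Proof. by move=> xs; rewrite (adjK hA') inv_fourier_adj xs inv_fourier_conv. Qed.

Lemma inv_fourier_range_right (x : A) : star x = x ->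
  F x * star' (F x) = F (conv x (bar x)).
Proof. by move=> xs; rewrite inv_fourier_adj xs inv_fourier_conv. Qed.

Variables (x y : A).
Hypotheses (hx : is_pos star x) (hy : is_pos star y).
Hypotheses (tx : Tr x = d) (ty : Tr y = d).

Let dn : d != 0 := d_neq0 hB.
Let convx a u v : conv (a *: u + v) y = a *: conv u y + conv v y := conv_linl hB a u v y.
Let convy a u v : conv x (a *: u + v) = a *: conv x u + conv x v := conv_linr hB a u v x.

Let convx_pos (p : A) : is_proj star p -> is_pos star (conv p y).
Proof. by move=> hp; apply: (conv_pos hB) => //; apply: (proj_pos hp). Qed.

Let convy_pos (p : A) : is_proj star p -> is_pos star (conv x p).
Proof. by move=> hp; apply: (conv_pos hB) => //; apply: (proj_pos hp). Qed.

Let convx1 : conv 1 y = 1. Proof. by rewrite (conv1l hB) ty divff // scale1r. Qed.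
Let convy1 : conv x 1 = 1. Proof. by rewrite (conv1r hB) tx divff // scale1r. Qed.

Let tr_convx u : Tr (conv u y) = Tr u. Proof. by rewrite (tr_conv hB) ty mulfK. Qed.
Let tr_convy u : Tr (conv x u) = Tr u. Proof. by rewrite (tr_conv hB) tx mulrC mulKf. Qed.

Lemma entropy_conv_ge : entropy x <= entropy (conv x y) /\ entropy y <= entropy (conv x y).
Proof.
have hz : is_pos star (conv x y) by exact: (conv_pos hB).
have [m [l [p [hp po p1 xE [_ _ l0]]]]] := pos_spectrum hx.
have [n [u [r [hr ro r1 yE [_ _ u0]]]]] := pos_spectrum hy.
have [k [v [q [hq qo q1 zE _]]]] := pos_spectrum hz.
have Ex := entropyE l hp po p1; rewrite -xE in Ex.
have Ey := entropyE u hr ro r1; rewrite -yE in Ey.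
have Ez := entropyE v hq qo q1; rewrite -zE in Ez.
rewrite Ex Ey Ez; split.
  have e : conv (\sum_i (l i)%:C%C *: p i) y = \sum_j (v j)%:C%C *: q j by rewrite -xE.
  exact: (entropy_bistochastic hA convx convx_pos convx1 tr_convx hp p1 l0 hq qo q1 e).1.
have e : conv x (\sum_i (u i)%:C%C *: r i) = \sum_j (v j)%:C%C *: q j by rewrite -yE.
exact: (entropy_bistochastic hA convy convy_pos convy1 tr_convy hr r1 u0 hq qo q1 e).1.
Qed.

Lemma shifts_of_entropy_eq :
  entropy (conv x y) = entropy x -> entropy (conv x y) = entropy y ->
  [/\ multiple_of_right_shift x, multiple_of_right_shift y
    & range_projection (star' (F x)) = range_projection (F y)].
Proof.
have hz : is_pos star (conv x y) by exact: (conv_pos hB).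
have [m [l [p [hp po p1 xE [li pn l0]]]]] := pos_spectrum hx.
have [n [u [r [hr ro r1 yE [ui rn u0]]]]] := pos_spectrum hy.
have [k [v [q [hq qo q1 zE [vi _ _]]]]] := pos_spectrum hz.
move=> ex ey.
have px i : is_proj star (conv (p i) y).
  have e : conv (\sum_i (l i)%:C%C *: p i) y = \sum_j (v j)%:C%C *: q j by rewrite -xE.
  apply: (bistochastic_rigid hA convx convx_pos convx1 tr_convx hp p1 hq q1 li vi pn).
  apply: (entropy_bistochastic hA convx convx_pos convx1 tr_convx hp p1 l0 hq qo q1 e).2.
  by rewrite -(entropyE l hp po p1) -(entropyE v hq qo q1) -xE -zE.
have py i : is_proj star (conv x (r i)).
  have e : conv x (\sum_i (u i)%:C%C *: r i) = \sum_j (v j)%:C%C *: q j by rewrite -yE.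
  apply: (bistochastic_rigid hA convy convy_pos convy1 tr_convy hr r1 hq q1 ui vi rn).
  apply: (entropy_bistochastic hA convy convy_pos convy1 tr_convy hr r1 u0 hq qo q1 e).2.
  by rewrite -(entropyE u hr ro r1) -(entropyE v hq qo q1) -yE -zE.
have := rigid_pair hB hp po hr ro l0 u0 pn rn; rewrite -xE -yE.
case/(_ tx ty px py) => t [X [Y [Q [t0 [hX hY hQ] [xX yY] XY [tX tY tQ]]]]].
have tn : t != 0 by rewrite gt_eqF.
have [W1 W2 W3 W4 W5] := left_shift_of_factor hB hX hY hQ t0 XY tX tY tQ.
have [Z1 Z2 Z3 Z4 Z5] := right_shift_of_factor hB hX hY hQ t0 XY tX tY tQ.
split.
- exists t^-1, (t^-1 *: conv X (bar X)), X; split=> //.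
    exact: biprojection_of t0 W1 W4 W5.
  by split; [exact: hX | rewrite W2 | rewrite W2 tX mulfK].
- exists t^-1, (t^-1 *: conv Y (bar Y)), Y; split=> //.
    exact: biprojection_of t0 Z1 Z4 Z5.
  by split; [exact: hY | rewrite Z2 | rewrite Z2 tY mulfK].
(* Both sides become [F] of [t^-1 * t^-1] times a convolution, and [factor_square] identifies the
   two convolutions. *)
- apply: range_projection_eq.
  rewrite inv_fourier_range_left ?(pos_adj hA hx) //.
  rewrite inv_fourier_range_right ?(pos_adj hA hy) //.
  rewrite xX yY !(barZ hB) !(convZl hB) !(convZr hB).
  by rewrite (factor_square hB hX hY hQ t0 XY tX tY tQ).
Qed.

(** The normalization [Tr z = d] determines the a priori complex coefficient as [d / Tr X]. *)
Lemma shift_density (z : A) : Tr z = d -> multiple_of_right_shift z ->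
  exists (t : R[i]) (B X : A), [/\ 0 < t, is_proj star B, is_proj star X, z = t^-1 *: X
    & [/\ Tr X = t * d, Tr B = Tr X & conv B X = t *: X]].
Proof.
move=> tz [c [B [X [[hB0 _] [hX tBX BX] zX]]]].
have tX : c * Tr X = d by rewrite -tz zX -(trZ hA).
have X0 : (X : A) != 0.
  by apply/eqP => X0; move/eqP: tX; rewrite X0 (tr0 hA) mulr0 eq_sym (negbTE dn).
have TX := tr_gt0_proj hA (hX : is_proj star X) X0.
have d0 := d_gt0 hB.
exists (Tr X / d), B, X; split=> //.
- by rewrite divr_gt0.
- by rewrite zX; congr (_ *: _); rewrite invf_div -tX mulfK ?gt_eqF.
- split; [by rewrite divfK | by rewrite tBX | by rewrite tBX].
Qed.

Lemma entropy_eq_of_shifts :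
  multiple_of_right_shift x -> multiple_of_right_shift y ->
  range_projection (star' (F x)) = range_projection (F y) ->
  entropy (conv x y) = entropy x /\ entropy (conv x y) = entropy y.
Proof.
move=> /(shift_density tx) [t1 [B1 [X [t10 h1 hX xX [tX tB1 e1]]]]].
move=> /(shift_density ty) [t2 [B2 [Y [t20 h2 hY yY [tY tB2 e2]]]]].
have [t1n t2n] : t1 != 0 /\ t2 != 0 by rewrite !gt_eqF.
have sx : conv (bar x) x = t1 ^- 2 *: conv (bar X) X.
  by rewrite xX (barZ hB) (convZl hB) (convZr hB) scalerA -invfM expr2.
have sy : conv y (bar y) = t2 ^- 2 *: conv Y (bar Y).
  by rewrite yY (barZ hB) (convZl hB) (convZr hB) scalerA -invfM expr2.
(* Both [z * star z] are then projections, so the range projections are explicit and the injective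
   [F] can be cancelled from their equality. *)
have idem (S : A) (t : R[i]) : t != 0 -> conv S S = (t * t) *: S ->
    F (t ^- 2 *: S) * F (t ^- 2 *: S) = F (t ^- 2 *: S).
  move=> tn SS; rewrite -inv_fourier_conv (convZl hB) (convZr hB) SS !scalerA.
  by congr (F (_ *: _)); field.
rewrite range_projectionE; last first.
  rewrite inv_fourier_range_left ?(pos_adj hA hx) // sx.
  exact: (idem _ _ t1n (shift_square_idem' hB h1 hX tX tB1 e1)).
rewrite range_projectionE; last first.
  rewrite inv_fourier_range_right ?(pos_adj hA hy) // sy.
  exact: (idem _ _ t2n (shift_square_idem hB h2 hY tY tB2 e2)).
rewrite inv_fourier_range_left ?(pos_adj hA hx) //.
rewrite inv_fourier_range_right ?(pos_adj hA hy) // sx sy => /(inv_fourier_inj hP) e.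
have [t12 [Q [hQ tQ XY]]] := conv_shifts hB h1 h2 hX hY t10 t20 tX tY tB1 tB2 e1 e2 e.
have zQ : conv x y = t1^-1 *: Q.
  by rewrite xX yY (convZl hB) (convZr hB) XY -t12 [t1^-1 *: (t1 *: Q)]scalerA mulVf // scale1r.
have cE : t1^-1 = (complex.Re t1^-1)%:C%C by apply: pos_complex; rewrite invr_ge0 ltW.
(* The three elements are now the same multiple of projections of equal trace. *)
rewrite zQ xX yY -t12 cE !entropy_scaled_proj //.
by rewrite tQ tX tY -t12.
Qed.

End Main.

(** The gap in the entropy inequality is a convex combination of two nonnegative gaps; for
    [0 < theta < 1] it vanishes only if both do, which turns one equality into two. *)
Lemma convex_gap (R : realFieldType) (theta a c z : R) :
  z - ((1 - theta) * a + theta * c) = (1 - theta) * (z - a) + theta * (z - c).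
Proof. by ring. Qed.

Theorem theorem4p3 (R : realType) (P : planar_data R)
    (hP : subfactor_planar_algebra P) (hirr : irreducible P)
    (b : bool) (x y : P (2%N, b))
    (hx : positive x) (hy : positive y)
    (hx1 : pnorm 1 x = delta P) (hy1 : pnorm 1 y = delta P) :
  (forall theta : R, 0 <= theta <= 1 ->
     (1 - theta) * entropy x + theta * entropy y <= entropy (convolution x y)) /\
  ((exists theta : R, 0 < theta < 1 /\
      entropy (convolution x y) = (1 - theta) * entropy x + theta * entropy y) <->
   [/\ multiple_of_right_shift x, multiple_of_right_shift y
     & range_projection (star (inv_fourier x)) =
       range_projection (inv_fourier y)]).
Proof.
have hA := box_tracial hP b.
have px : is_pos (@star R P (2%N, b) : box_algebra hP b -> box_algebra hP b) x by exact: hx.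
have py : is_pos (@star R P (2%N, b) : box_algebra hP b -> box_algebra hP b) y by exact: hy.
have tx : Tr x = (delta P)%:C%C.
  by rewrite -hx1 (pnorm1E px); apply: pos_complex; exact: (tr_ge0 hA px).
have ty : Tr y = (delta P)%:C%C.
  by rewrite -hy1 (pnorm1E py); apply: pos_complex; exact: (tr_ge0 hA py).
have [zx zy] := entropy_conv_ge hirr px py tx ty.
split.
  move=> theta /andP[t0 t1]; rewrite -subr_ge0 convex_gap.
  by rewrite addr_ge0 // mulr_ge0 // subr_ge0.
split=> [[theta [/andP[t0 t1] e]]|[sx sy rxy]].
  have [t0' t1'] := (ltW t0, ltW t1).
  move/eqP: e; rewrite -subr_eq0 convex_gap paddr_eq0 ?mulr_ge0 ?subr_ge0 //.
  rewrite !mulf_eq0 !subr_eq0 (gt_eqF t0) (gt_eqF t1) /= => /andP[/eqP ex /eqP ey].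
  by apply: (shifts_of_entropy_eq hirr px py tx ty); [exact: ex | exact: ey].
have [ex ey] := entropy_eq_of_shifts hirr px py tx ty sx sy rxy.
exists 2^-1; split; first by rewrite invr_gt0 ltr0n invf_lt1 ?ltr0n // ltr1n.
by apply/eqP; rewrite -subr_eq0 convex_gap -[X in _ * (_ - X) + _]ex -[X in _ + _ * (_ - X)]ey
   !subrr !mulr0 addr0.
Qed.
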